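(* Let $b,\sigma:[0,T]\times\mathbb{R}^d\to\mathbb{R}^d$ be continuous and satisfy the assumptions $(H_1)$ and $(H_2)$ stated in the context, and let $1-H<\alpha<\alpha_0$. Let $K(t)=\overline{K(t)}\subset\mathbb{R}^d$, $t\in[0,T]$, be a family of closed sets, and let $\varphi\in\mathcal H$, with associated constants $a_\varphi<b_\varphi$. Then for every $\varepsilon>0$, every $t\in[0,T]$ and every $x\in K(t)$ with $a_\varphi+\varepsilon\le|x|\le b_\varphi-\varepsilon$: $$(b(t,x),\sigma(t,x))\in S_{\varphi^{-1}(\varphi(K(t)))}(t,x)$$ if and only if $$(\varphi'(x)b(t,x),\varphi'(x)\sigma(t,x))\in S_{\varphi(K(t))}(t,\varphi(x)).$$
   Context: Fix $T>0$, $d,m\ge 1$, $H\in(\frac12,1)$ and a real-valued fractional Brownian motion $B^H=\{B^H_t,t\ge 0\}$ with Hurst parameter $H$ on a complete probability space $(\Omega,\mathcal F,\mathbb P)$. Integrals with respect to $B^H$ are pathwise Riemann-Stieltjes (Young) integrals. $(H_1)$: $\sigma(t,x)$ is differentiable in $x$, and there are constants $\beta,\delta\in(0,1]$, $M_0>0$, and for every $\rho>0$ a constant $M_\rho>0$, such that for all $s,t\in[0,T]$: (i) $|\sigma(t,x)-\sigma(s,y)|\le M_0(|t-s|^\beta+|x-y|)$ for all $x,y\in\mathbb{R}^d$; (ii) $|\nabla_x\sigma(t,y)-\nabla_x\sigma(s,z)|\le M_\rho(|t-s|^\beta+|y-z|^\delta)$ for all $|y|,|z|\le \rho$. Set $\alpha_0=\min\{\frac12,\beta,\frac{\delta}{1+\delta}\}$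 and $M_{0,T}=|\sigma(0,0)|+M_0+M_0T$. $(H_2)$: there are $\mu\in(1-\alpha_0,1]$, $L_0>0$, and for every $\rho\ge0$ a constant $L_\rho>0$, such that for all $s,t\in[0,T]$: (i) $|b(t,x)-b(s,y)|\le L_\rho(|t-s|^\mu+|x-y|)$ for all $|x|,|y|\le\rho$; (ii) $|b(t,x)|\le L_0(1+|x|)$ for all $x\in\mathbb{R}^d$. The class $\mathcal H$: functions $\varphi:\mathbb{R}^d\to\mathbb{R}^m$ of class $C^2$ with bounded and Lipschitz continuous second derivative, for which there exist $a_\varphi<b_\varphi$ and constants $M>0$, $L>0$ such that for all $x$ with $a_\varphi\le|x|\le b_\varphi$ the matrix $\varphi'(x)$ has a right inverse, denoted $\varphi'(x)^+$, satisfying (1) $|[\varphi'(x)^+]'|\le M$ and (2) $|[\varphi'(x)^+]'-[\varphi'(y)^+]'|\le L|x-y|$ (for $x,y$ in this region), where $[\varphi'(\cdot)^+]'$ is the derivative of $x\mapsto\varphi'(x)^+$. Let $\Lambda_\alpha(B^H)=\frac{1}{\Gamma(1-\alpha)\Gamma(\alpha)}\sup_{0<r<s<T}\left|\frac{B^H_r-B^H_s}{(s-r)^{1-\alpha}}+(1-\alpha)\int_r^s\frac{B^H_r-B^H_y}{(y-r)^{2-\alpha}}dy\right|$. Tangent set: for a family of sets $K(s)\subset\mathbb{R}^d$, $t\in[0,T]$, $x\in K(t)$, the $(1-\alpha)$-fractional $B^H$-tangent set $S_{K(t)}(t,x)$ to $K(t)$ in $x$ is the set of pairs $(u,v)\in\mathbb{R}^d\times\mathbb{R}^d$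 for which there exist a random variable $\bar h=\bar h^{t,x}>0$ and two stochastic processes $U=U^{t,x},V=V^{t,x}:\Omega\times[t,t+\bar h]\to\mathbb{R}^d$ with $U(t)=V(t)=0$, and, for every $\rho>0$ with $|x|\le\rho$, two random variables $D_\rho,\tilde D_\rho>0$, which do not depend on $(t,\bar h)$ and depend only on $\rho,L_\rho,M_{0,T},M_0,L_0,T,\alpha,\beta,\Lambda_\alpha(B^H)$, such that $\mathbb P$-a.s. for all $s,\tau\in[t,t+\bar h]$ $$|U(s)-U(\tau)|\le D_\rho|s-\tau|^{1-\alpha},\qquad |V(s)-V(\tau)|\le\tilde D_\rho|s-\tau|^{\min\{\beta,1-\alpha\}},$$ $$x+\int_t^s(u+U(r))dr+\int_t^s(v+V(r))dB^H_r\in K(s).$$ $S_{\varphi^{-1}(\varphi(K(t)))}(t,x)$ is this set for the family $\{\varphi^{-1}(\varphi(K(s)))\}_s$. The set $S_{\varphi(K(t))}(t,\varphi(x))$ is defined in the same way, with pairs $(u,v)\in\mathbb{R}^m\times\mathbb{R}^m$ and $\mathbb{R}^m$-valued processes $U,V$, the last condition being replaced by $\varphi(x)+\int_t^s(u+U(r))dr+\int_t^s(v+V(r))dB^H_r\in\varphi(K(s))$. *)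

(* Defs.v *)
From HB Require Import structures.
From mathcomp Require Import all_boot all_order all_algebra.
From mathcomp Require Import all_classical all_reals all_analysis.

Set Implicit Arguments.
Unset Strict Implicit.
Unset Printing Implicit Defensive.

Import Order.TTheory GRing.Theory Num.Theory.
Import numFieldNormedType.Exports.

Local Open Scope classical_set_scope.
Local Open Scope ring_scope.

(* The norm that the library puts on matrices is the maximum norm; |.| is the
   Euclidean norm of a column vector and the Frobenius norm of a matrix.  The
   two norms induce the same topology and the same notion of derivative. *)
Definition enorm (R : realType) (m n : nat) (A : 'M[R]_(m, n)) : R :=
  Num.sqrt (\sum_i \sum_j A i j ^+ 2).

(* f'(x) as an m x n matrix acting on column vectors from the left (the
   library's jacobian is for row vectors, i.e. it is the transpose). *)
Definition jac (R : realType) (n m : nat) (f : 'cV[R]_n -> 'cV[R]_m)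
    (x : 'cV[R]_n) : 'M[R]_(m, n) :=
  \matrix_(i, j) ('d f x (delta_mx j 0)) i 0.

Definition Gamma (R : realType) (z : R) : R :=
  (\int[lebesgue_measure]_(x in `]0, +oo[%classic) (x `^ (z - 1) * expR (- x)))%R.

(** Fractional Brownian motion *)

(* normal_prob m 0 is not the Dirac mass at m, hence the case distinction. *)
Definition gaussian_law d (Omega : measurableType d) (R : realType)
    (P : probability Omega R) (X : Omega -> R) : Prop :=
  exists m s : R,
    if s == 0 then {ae P, forall w, X w = m}
    else forall A : set R, measurable A -> P (X @^-1` A) = normal_prob m s A.

Definition gaussian_process d (Omega : measurableType d) (R : realType)
    (P : probability Omega R) (B : R -> Omega -> R) : Prop :=
  forall (n : nat) (c t : 'I_n -> R), (forall i, 0 <= t i) ->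
    gaussian_law P (fun w => \sum_i c i * B (t i) w).

(* Time is a real number, but only the times t >= 0 matter. *)
Definition fBm d (Omega : measurableType d) (R : realType)
    (P : probability Omega R) (H : R) (B : R -> Omega -> R) : Prop :=
  [/\ forall t, 0 <= t -> measurable_fun setT (B t),
      gaussian_process P B,
      forall t, 0 <= t -> ('E_P[B t] = 0)%E,
      forall s t, 0 <= s -> 0 <= t ->
        covariance P (B s) (B t) =
        ((s `^ (2 * H) + t `^ (2 * H) - `|t - s| `^ (2 * H)) / 2)%:E
    & {ae P, forall w, {within `[0, +oo[, continuous (B ^~ w)}} ].

(* Lambda_alpha(g); it is a priori an extended real number. *)
Definition Lambda (R : realType) (T alpha : R) (g : R -> R) : \bar R :=
  let incr (r s : R) : R :=
    (g r - g s) / (s - r) `^ (1 - alpha)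
    + (1 - alpha) * (\int[lebesgue_measure]_(y in `[r, s])
                       ((g r - g y) / (y - r) `^ (2 - alpha)))%R in
  (((Gamma (1 - alpha) * Gamma alpha)^-1)%:E *
   ereal_sup [set (`|incr p.1 p.2|)%:E |
                p in [set p : R * R | (0 < p.1 < p.2)%R /\ (p.2 < T)%R]])%E.

(** Pathwise integrals *)

(* A partition a < p_0 < ... < p_k = b of [a, b] is given by the sequence p,
   without the point a; xi i is the tag of its i-th interval. *)
Definition RS_sum (R : realType) (n : nat) (f : R -> 'cV[R]_n) (g : R -> R)
    (a : R) (p : seq R) (xi : nat -> R) : 'cV[R]_n :=
  \sum_(i < size p) (g (nth a p i) - g (nth a (a :: p) i)) *: f (xi i).

Definition RS_integral (R : realType) (n : nat) (f : R -> 'cV[R]_n)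
    (g : R -> R) (a b : R) (I : 'cV[R]_n) : Prop :=
  forall e : R, 0 < e -> exists2 dl : R, 0 < dl &
    forall (p : seq R) (xi : nat -> R),
      itv_partition a b p ->
      (forall i, (i < size p)%N ->
         nth a (a :: p) i <= xi i <= nth a p i /\
         nth a p i - nth a (a :: p) i < dl) ->
      enorm (RS_sum f g a p xi - I) < e.

Definition vintegral (R : realType) (n : nat) (f : R -> 'cV[R]_n) (a b : R) :
    'cV[R]_n :=
  \col_i (\int[lebesgue_measure]_(r in `[a, b]) (f r i 0))%R.

(** Assumptions on the coefficients *)

Definition H1 (R : realType) (d : nat) (T : R) (sigma : R -> 'cV[R]_d -> 'cV[R]_d)
    (beta delta M0 : R) (M : R -> R) : Prop :=
  [/\ 0 < beta <= 1 /\ 0 < delta <= 1,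
      0 < M0 /\ (forall rho, 0 < rho -> 0 < M rho),
      forall t x, 0 <= t <= T -> differentiable (sigma t) x,
      forall s t x y, 0 <= s <= T -> 0 <= t <= T ->
        enorm (sigma t x - sigma s y) <= M0 * (`|t - s| `^ beta + enorm (x - y))
    & forall rho s t y z, 0 < rho -> 0 <= s <= T -> 0 <= t <= T ->
        enorm y <= rho -> enorm z <= rho ->
        enorm (jac (sigma t) y - jac (sigma s) z) <=
          M rho * (`|t - s| `^ beta + enorm (y - z) `^ delta)].

Definition alpha0 (R : realType) (beta delta : R) : R :=
  Num.min (2^-1) (Num.min beta (delta / (1 + delta))).

Definition H2 (R : realType) (d : nat) (T : R) (b : R -> 'cV[R]_d -> 'cV[R]_d)
    (a0 mu L0 : R) (L : R -> R) : Prop :=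
  [/\ 1 - a0 < mu <= 1,
      0 < L0 /\ (forall rho, 0 <= rho -> 0 < L rho),
      forall rho s t x y, 0 <= rho -> 0 <= s <= T -> 0 <= t <= T ->
        enorm x <= rho -> enorm y <= rho ->
        enorm (b t x - b s y) <= L rho * (`|t - s| `^ mu + enorm (x - y))
    & forall t x, 0 <= t <= T -> enorm (b t x) <= L0 * (1 + enorm x)].

(** The class of functions phi *)

(* The second derivative at x is the linear map 'd (jac phi) x. *)
Definition C2_bounded_lipschitz (R : realType) (d m : nat)
    (phi : 'cV[R]_d -> 'cV[R]_m) : Prop :=
  [/\ forall x, differentiable phi x,
      forall x, differentiable (jac phi) x,
      forall v, continuous (fun x => 'd (jac phi) x v),
      exists C : R, forall x v, enorm ('d (jac phi) x v) <= C * enorm v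
    & exists C : R, forall x y v,
        enorm ('d (jac phi) x v - 'd (jac phi) y v)
          <= C * enorm (x - y) * enorm v].

Definition annulus (R : realType) (d : nat) (a b : R) : set 'cV[R]_d :=
  [set x | a <= enorm x <= b].

(* l is a derivative of f at x relative to the set A: the increments of f are
   only looked at along the points of A. *)
Definition is_diff_within (R : realType) (n p q : nat) (A : set 'cV[R]_n)
    (f : 'cV[R]_n -> 'M[R]_(p, q)) (x : 'cV[R]_n)
    (l : {linear 'cV[R]_n -> 'M[R]_(p, q)}) : Prop :=
  forall e : R, 0 < e -> \forall y \near within A (nbhs x),
    enorm (f y - f x - l (y - x)) <= e * enorm (y - x).

(* psi x stands for phi'(x)^+ and dpsi x for its derivative; both only matter
   for x in the annulus. *)
Definition calH (R : realType) (d m : nat) (phi : 'cV[R]_d -> 'cV[R]_m)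
    (a b : R) : Prop :=
  [/\ C2_bounded_lipschitz phi, a < b &
      exists (M L : R) (psi : 'cV[R]_d -> 'M[R]_(d, m))
             (dpsi : 'cV[R]_d -> {linear 'cV[R]_d -> 'M[R]_(d, m)}),
      [/\ 0 < M /\ 0 < L,
          forall x, annulus a b x -> jac phi x *m psi x = 1%:M,
          forall x, annulus a b x -> is_diff_within (annulus a b) psi x (dpsi x),
          forall x v, annulus a b x -> enorm (dpsi x v) <= M * enorm v
        & forall x y v, annulus a b x -> annulus a b y ->
            enorm (dpsi x v - dpsi y v) <= L * enorm (x - y) * enorm v]].

(** Tangent sets *)

(* A family of random variables that do not depend on (t, h) and depend on
   omega only through Lambda_alpha(B^H): the variable with index rho is
   w |-> D rho (Lambda_alpha(B^H) w) for a deterministic function D.  The other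
   quantities D_rho may depend on (L_rho, M_{0,T}, M_0, L_0, T, alpha, beta)
   are functions of rho or constants once the coefficients are fixed. *)
Definition bound_rv d (Omega : measurableType d) (R : realType)
    (T alpha : R) (B : R -> Omega -> R) (D : R -> \bar R -> R) (rho : R)
    (w : Omega) : R :=
  D rho (Lambda T alpha (B ^~ w)).

(* The process U is defined on {(s, w) | s in [t, t + h w], s <= T}. *)
Definition process_on d (Omega : measurableType d) (R : realType) (n : nat)
    (T t : R) (h : Omega -> R) (U : R -> Omega -> 'cV[R]_n) : Prop :=
  forall s, t <= s <= T -> forall i,
    measurable_fun [set w | s <= t + h w] (fun w => U s w i 0).

(* The tangent set to K(t) in y for given bounds D and Dt.  The radius rx is
   the norm which is compared with rho: it is |y| for the tangent set to K(t)
   in y = x, and |x| for the tangent set to phi(K(t)) in y = phi(x).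
   As K(s) only makes sense for s <= T, so does the interval [t, t + h]. *)
Definition tangent_set_with d (Omega : measurableType d) (R : realType)
    (P : probability Omega R) (B : R -> Omega -> R) (T alpha beta : R)
    (D Dt : R -> \bar R -> R) (n : nat) (K : R -> set 'cV[R]_n)
    (t rx : R) (y : 'cV[R]_n) : set ('cV[R]_n * 'cV[R]_n) :=
  [set uv | exists (h : Omega -> R) (U V : R -> Omega -> 'cV[R]_n),
    [/\ measurable_fun setT h /\ (forall w, 0 < h w),
        process_on T t h U /\ process_on T t h V,
        forall w, U t w = 0 /\ V t w = 0,
        forall rho, 0 < rho -> rx <= rho ->
          [/\ measurable_fun setT (bound_rv T alpha B D rho),
              measurable_fun setT (bound_rv T alpha B Dt rho),
              forall w, 0 < bound_rv T alpha B D rho w,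
              forall w, 0 < bound_rv T alpha B Dt rho w
            & {ae P, forall w, forall s r,
                t <= s <= Num.min (t + h w) T ->
                t <= r <= Num.min (t + h w) T ->
                enorm (U s w - U r w)
                  <= bound_rv T alpha B D rho w * `|s - r| `^ (1 - alpha) /\
                enorm (V s w - V r w)
                  <= bound_rv T alpha B Dt rho w
                     * `|s - r| `^ (Num.min beta (1 - alpha))}]
      & {ae P, forall w, forall s, t <= s <= Num.min (t + h w) T ->
          exists2 I : 'cV[R]_n,
            RS_integral (fun r => uv.2 + V r w) (B ^~ w) t s I &
            K s (y + vintegral (fun r => uv.1 + U r w) t s + I)}]].

Definition tangent_set d (Omega : measurableType d) (R : realType)
    (P : probability Omega R) (B : R -> Omega -> R) (T alpha beta : R)
    (n : nat) (K : R -> set 'cV[R]_n) (t rx : R) (y : 'cV[R]_n) :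
    set ('cV[R]_n * 'cV[R]_n) :=
  [set uv | exists D Dt : R -> \bar R -> R,
     tangent_set_with P B T alpha beta D Dt K t rx y uv].

(* Main.v *)
(** The Hölder regularity of B is the one of Kolmogorov's criterion: almost surely
    |B_s - B_r| <= |s - r|^(1 - alpha) as soon as |s - r| is below a random scale.
    As the horizon of a tangent path may be shrunk, only this constant 1 enters,
    and the new bounds are polynomials in the old ones, independent of the point.
    A path x + int (u + U) dr + int (v + V) dB is the same as a path whose
    increments over [s, r] are (r - s) (u + U_s) + (B_r - B_s) (v + V_s) up to
    O((r - s)^theta) with theta > 1.  By Taylor's formula, phi maps such paths to
    such paths (the chain rule).  Conversely, a path Y in phi(K) is lifted by
    solving phi(z_s + phi'(x)^+ c_s) = Y_s near x, where
    z_s = x + (s - t) b + (B_s - B_t) sigma: simplified Newton iteration gives a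
    unique small c_s, which is Lipschitz in (z_s, Y_s) and measurable as a limit
    of iterates. *)

Require Import Defs.
From HB Require Import structures.
From mathcomp Require Import all_boot all_order all_algebra.
From mathcomp Require Import all_classical all_reals all_analysis.
From mathcomp Require Import measurable_realfun.
From mathcomp Require Import ring lra.

Set Implicit Arguments.
Unset Strict Implicit.
Unset Printing Implicit Defensive.

Import Order.TTheory GRing.Theory Num.Theory.
Import numFieldNormedType.Exports.

Local Open Scope classical_set_scope.
Local Open Scope ring_scope.

(** * Kolmogorov regularity of fractional Brownian motion *)

(** The bounds of a tangent set may depend on omega only through Lambda_alpha(B), while the Hölder
    constant of B is another random variable; the horizon h, however, may depend on omega freely.
    All uncontrolled randomness is therefore pushed into h. With gam = 1 - alpha and kap = min(beta,
    1 - alpha), the assumption 1 - H < alpha gives gam < H, and alpha < min(1/2, beta) gives theta =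
    kap + gam > 1, which is what summing local errors over a partition requires. The remaining
    constants are dominated by a single S = s0 + D + Dt, with s0 a deterministic function of rho,
    and estimates are recorded as powers of S. In the lift, a curve x + P c alone would have its
    velocity in the range of P and could miss the component of (b, sigma) in the kernel of phi'(x).
    So z carries the whole velocity (b, sigma), and the correction P c has velocity zero at time t,
    as the conditions U(t) = V(t) = 0 demand. *)

(** Comparison with a Gaussian density of another mean bounds a tail without computing an integral,
    since the comparison density has total mass 1. *)
Lemma normal_prob_le_shift (R : realType) (m m1 s c : R) (A : set R) :
    measurable A -> 0 <= c ->
    (forall x, A x -> normal_pdf m s x <= c * normal_pdf m1 s x) ->
  (normal_prob m s A <= c%:E)%E.
Proof.
move=> mA c0 le; rewrite /normal_prob.
have mpdf m2 : measurable_fun setT (EFin \o normal_pdf m2 s).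
  by apply/measurable_EFinP; exact: measurable_normal_pdf.
apply: (@le_trans _ _ (\int[lebesgue_measure]_(x in A)
   (c%:E * (normal_pdf m1 s x)%:E))%E).
  apply: ge0_le_integral => //.
  - by move=> x _; rewrite lee_fin normal_pdf_ge0.
  - exact: measurable_funTS (mpdf _).
  - apply: measurable_funTS; exact: measurable_funeM (mpdf _).
rewrite ge0_integralZl//; last 2 first.
- exact: measurable_funTS (mpdf _).
- by move=> x _; rewrite lee_fin normal_pdf_ge0.
rewrite -[leRHS]mule1 lee_wpmul2l ?lee_fin ?expR_ge0//.
rewrite -(integral_normal_pdf m1 s); apply: ge0_subset_integral => //.
- exact: mpdf.
- by move=> x _; rewrite lee_fin normal_pdf_ge0.
Qed.

(** For x >= m + l one has (x - m)^2 >= l^2 + (x - m - l)^2, so the density there is at most exp(-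
    l^2 / (2 s^2)) times the density centred at m + l; the other half-line is symmetric. *)
Lemma normal_prob_tail (R : realType) (m s l : R) : s != 0 -> 0 <= l ->
  (normal_prob m s [set x | l <= `|x - m|]%R <=
   (2 * expR (- l ^+ 2 / (s ^+ 2 *+ 2)))%:E)%E.
Proof.
move=> s0 l0.
have s2 : 0 < s ^+ 2 *+ 2 by rewrite pmulrn_lgt0// exprn_even_gt0.
have -> : [set x | l <= `|x - m|]%R = `[(m + l)%R, +oo[ `|` `]-oo, (m - l)%R].
  apply/seteqP; split => x /=; rewrite !in_itv/= ?andbT.
  - by rewrite ler_normr => /orP[h|h]; [left|right]; lra.
  - by rewrite ler_normr => -[h|h]; apply/orP; [left|right]; lra.
apply: (le_trans (measureU2 (normal_prob m s) _ _)) => //.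
rewrite mulrDl !mul1r EFinD.
apply: leeD.
- apply: (normal_prob_le_shift (m1 := m + l)) => // x.
  rewrite /= in_itv/= andbT => lx.
  rewrite !normal_pdfE// /normal_fun mulrCA.
  rewrite ler_wpM2l ?normal_peak_ge0// -expRD ler_expR.
  rewrite -mulrDl ler_pM2r ?invr_gt0//.
  by nra.
- apply: (normal_prob_le_shift (m1 := m - l)) => // x.
  rewrite /= in_itv/= => lx.
  rewrite !normal_pdfE// /normal_fun mulrCA.
  rewrite ler_wpM2l ?normal_peak_ge0// -expRD ler_expR.
  rewrite -mulrDl ler_pM2r ?invr_gt0//.
  by nra.
Qed.

(** The density never exceeds its peak 1 / (|s| sqrt(2 pi)), which is at most 1 / (2 |s|) because pi
    >= 2, and the interval has length 2 l. *)
Lemma normal_prob_small_ball (R : realType) (m s l : R) : s != 0 -> 0 <= l ->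
  (normal_prob m s `](- l)%R, l[ <= (l * `|s|^-1)%:E)%E.
Proof.
move=> s0 l0; rewrite /normal_prob.
apply: (@le_trans _ _ (\int[lebesgue_measure]_(x in `](- l)%R, l[)
   (normal_peak s)%:E)%E).
  apply: ge0_le_integral => //.
  - by move=> x _; rewrite lee_fin normal_pdf_ge0.
  - by apply: measurable_funTS; apply/measurable_EFinP; exact: measurable_normal_pdf.
  - by move=> x _; rewrite lee_fin normal_pdf_ub.
rewrite integral_cst//= lebesgue_measure_itv/=.
have pk : normal_peak s <= (2 * `|s|)^-1.
  rewrite /normal_peak lef_pV2 ?posrE ?mulr_gt0 ?normr_gt0//; last first.
    by rewrite sqrtr_gt0 pmulrn_lgt0// mulr_gt0 ?pi_gt0// exprn_even_gt0.
  rewrite -[leLHS](ger0_norm)// -sqrtr_sqr ler_wsqrtr//.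
  rewrite exprMn real_normK ?num_real// -mulr_natr -mulrA mulrC.
  have := pi_ge2 R; have : 0 <= s ^+ 2 by rewrite sqr_ge0.
  by nra.
rewrite lte_fin; have [lN|] := ltP; last first.
  by move=> _; rewrite mule0 lee_fin mulr_ge0// invr_ge0.
rewrite -EFinD -EFinM lee_fin opprK.
rewrite (le_trans (ler_wpM2r _ pk)) ?addr_ge0// invfM.
by rewrite le_eqVlt; apply/orP; left; apply/eqP; field; rewrite normr_eq0.
Qed.

(** With n = N + 1: exp(y) = exp(y / n)^n and exp(y / n) >= 1 + y / n. *)
Lemma expR_ge_exprn (R : realType) (y : R) (N : nat) : 0 <= y ->
  (y / N.+1%:R) ^+ N.+1 <= expR y.
Proof.
move=> y0; have yN : 0 <= y / N.+1%:R by rewrite divr_ge0.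
have -> : expR y = expR (y / N.+1%:R) ^+ N.+1 by rewrite -expRM_natl mulrC divfK.
by rewrite lerXn2r ?nnegrE ?expR_ge0// (le_trans _ (expR_ge1Dx _))// lerDr.
Qed.

(* A polynomial tail in terms of the second moment: with law N(m, s^2) a second
   moment at most v forces s^2 <= 8 v and m^2 <= 128 v, so neither the mean nor
   the variance has to be identified. *)
Lemma gaussian_tail d (Omega : measurableType d) (R : realType)
    (P : probability Omega R) (X : Omega -> R) (K v l : R) (N : nat) :
    512 <= K ->
    measurable_fun setT X -> gaussian_law P X ->
    (\int[P]_w ((X w) ^+ 2)%:E <= v%:E)%E -> 0 < v -> 0 < l ->
  (P [set w | l <= `|X w|]%R <= (2 * (K * N.+1%:R * v / l ^+ 2) ^+ N.+1)%:E)%E.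
Proof.
move=> hK mX [m [s gX]] EX v0 l0.
have mset (A : set R) : measurable A -> measurable (X @^-1` A).
  by move=> mA; rewrite -[X in measurable X]setTI; exact: mX.
have mabs (k c : R) : measurable [set x : R | k <= `|x - c|].
  rewrite [X in measurable X](_ : _ = `[(c + k)%R, +oo[ `|` `]-oo, (c - k)%R]).
    exact: measurableU.
  apply/seteqP; split => x /=; rewrite !in_itv/= ?andbT.
  - by rewrite ler_normr => /orP[h|h]; [left|right]; lra.
  - by rewrite ler_normr => -[h|h]; apply/orP; [left|right]; lra.
have mabs0 (k : R) : measurable [set x : R | k <= `|x|].
  by have := mabs k 0; under eq_set do rewrite subr0.
(* Chebyshev's inequality. *)
have moment (k p : R) : 0 <= k -> (p%:E <= P (X @^-1` [set x | k <= `|x|]%R))%E ->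
    k ^+ 2 * p <= v.
  move=> k0 pP; rewrite -lee_fin (le_trans _ EX)// EFinM.
  apply: (@le_trans _ _ ((k ^+ 2)%:E * P (X @^-1` [set x | k <= `|x|]%R))%E).
    by rewrite lee_wpmul2l// lee_fin sqr_ge0.
  rewrite -integral_cst; last exact: mset.
  have mX2 : measurable_fun setT (fun w => ((X w) ^+ 2)%:E).
    by apply/measurable_EFinP; exact: measurable_funX.
  apply: (@le_trans _ _ (\int[P]_(w in X @^-1` [set x | k <= `|x|]%R) ((X w) ^+ 2)%:E)%E).
    apply: ge0_le_integral => //.
    - exact: mset.
    - by move=> x _; rewrite lee_fin sqr_ge0.
    - exact: measurable_funTS.
    - move=> w /= kw; rewrite lee_fin -[leRHS]real_normK ?num_real//.
      by rewrite lerXn2r ?nnegrE.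
  apply: ge0_subset_integral => //; first exact: mset.
  by move=> x _; rewrite lee_fin sqr_ge0.
(* For small l the right-hand side is at least 2 and there is nothing to prove; afterwards l^2 > 512
   v. *)
have [lv|lv] := leP (l ^+ 2) (K * N.+1%:R * v).
  apply: (le_trans (probability_le1 _ (mset _ (mabs0 l)))).
  rewrite lee_fin; set z := _ / _.
  have z1 : 1 <= z by rewrite /z ler_pdivlMr ?mul1r// exprn_gt0.
  have := exprn_ege1 N.+1 z1; lra.
have N1 : 1 <= N.+1%:R :> R by rewrite ler1n.
have K0 : 0 < K by lra.
have KN : 512 <= K * N.+1%:R by nra.
have w0 : 0 <= K * N.+1%:R * v by apply: mulr_ge0 (ltW v0); lra.
have lv2 : 512 * v < l ^+ 2 by apply: le_lt_trans lv; rewrite ler_wpM2r// ltW.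
(* Degenerate law, X = m almost surely: |m| >= l would give l^2 <= v by Chebyshev. *)
case: eqP gX => [_ [/= Z [mZ Z0 ZX]]|/eqP s0 gX].
  have [lm|lm] := ltP `|m| l.
    apply: (@le_trans _ _ (P Z)).
      apply: le_measure; rewrite ?inE//; first exact: (mset _ (mabs0 l)).
      move=> w /= lw; apply: (ZX w) => /= Xw.
      by move: lw; rewrite Xw leNgt lm.
    rewrite Z0 lee_fin; apply: mulr_ge0 => //; apply: exprn_ge0.
    by apply: divr_ge0 => //; exact: sqr_ge0.
  exfalso; have /moment : (1%:E <= P (X @^-1` [set x | l <= `|x|]%R))%E.
    have mS : measurable (X @^-1` [set x | l <= `|x|]%R) by exact: mset.
    rewrite -[X in (_ <= X)%E]add0e -Z0.
    rewrite -(probability_setT P) (le_trans _ (measureU2 P mZ mS))//.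
    apply: le_measure; rewrite ?inE//; first exact: measurableU.
    move=> w _; have [Zw|Zw] := pselect (Z w); [by left|right] => /=.
    have -> // : X w = m.
    by apply: contrapT => Xw; apply: Zw; exact: (ZX w).
  move=> /(_ (ltW l0)); rewrite mulr1 => lv'; suff : v < v by rewrite ltxx.
  by lra.
have gP (A : set R) : measurable A -> P (X @^-1` A) = normal_prob m s A by exact: gX.
have s2 : 0 < s ^+ 2 by rewrite exprn_even_gt0.
have s1 : 0 < `|s| by rewrite normr_gt0.
have sE : `|s| ^+ 2 = s ^+ 2 by rewrite real_normK ?num_real.
have compl (A : set R) (p : R) : measurable A ->
    (normal_prob m s A <= (1 - p)%:E)%E -> (p%:E <= P (X @^-1` (~` A)))%E.
  move=> mA; rewrite -gP// preimage_setC probability_setC; last exact: mset.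
  rewrite -(fineK (fin_num_measure P _ (mset _ mA))) -EFinD !lee_fin; lra.
(* The ball of radius |s| / 2 has mass at most 1/2, so Chebyshev on its complement gives (s^2 / 4) /
   2 <= v. *)
have sv : s ^+ 2 <= 8 * v.
  have /moment : (2^-1%:E <= P (X @^-1` [set x | `|s| / 2 <= `|x|]%R))%E.
    have -> : [set x | `|s| / 2 <= `|x|]%R = ~` `](- (`|s| / 2))%R, (`|s| / 2)[.
      apply/seteqP; split => x /=; rewrite in_itv/= -ltr_norml ltNge.
        by move=> ->.
      by move=> /negP; rewrite negbK.
    apply: compl => //; apply: (le_trans (normal_prob_small_ball m s0 _)).
      by rewrite divr_ge0.
    rewrite lee_fin mulrAC divff ?gt_eqF// mul1r; lra.
  by rewrite divr_ge0// => /(_ isT); rewrite expr_div_n sE; lra.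
(* If |m| <= 4 |s|, then m^2 <= 16 s^2 <= 128 v. Otherwise |X - m| < 2 |s| forces |X| >= |m| / 2 and
   has probability at least 1 - 2 exp(-2) >= 1/3, so Chebyshev gives m^2 <= 12 v. *)
have mv : m ^+ 2 <= 128 * v.
  have [ms|ms] := leP `|m| (4 * `|s|).
    have : `|m| ^+ 2 <= (4 * `|s|) ^+ 2 by rewrite lerXn2r ?nnegrE// mulr_ge0.
    by rewrite exprMn sE real_normK ?num_real//; lra.
  have /moment : (3^-1%:E <= P (X @^-1` [set x | `|m| / 2 <= `|x|]%R))%E.
    apply: (@le_trans _ _ (P (X @^-1` (~` [set x | 2 * `|s| <= `|x - m|]%R)))).
      apply: compl; first exact: mabs.
      apply: (le_trans (normal_prob_tail m s0 _)); first by rewrite mulr_ge0.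
      rewrite lee_fin exprMn sE.
      have -> : - (2 ^+ 2 * s ^+ 2) / (s ^+ 2 *+ 2) = - 2 :> R.
        by field; rewrite s0.
      rewrite expRN.
      have e3 : 3 <= expR 2 :> R.
        by apply: le_trans (expR_ge1Dx _); lra.
      have : (expR 2)^-1 <= 3^-1 :> R by rewrite lef_pV2 ?posrE ?expR_gt0.
      lra.
    apply: le_measure; rewrite ?inE; [exact: (mset _ (measurableC (mabs _ _)))|exact: mset|].
    move=> w /= /negP; rewrite -ltNge => h.
    have := ler_normD (X w) (m - X w); rewrite addrC subrK -[`|m - _|]distrC; lra.
  rewrite divr_ge0// => /(_ isT); rewrite expr_div_n real_normK ?num_real//; lra.
(* This is where 512 = 4 * 128 comes from: the mean accounts for at most half of the level l. *)
have lm : `|m| <= l / 2.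
  rewrite -(@ler_pXn2r _ 2) ?nnegrE// ?divr_ge0 ?(ltW l0)//.
  rewrite real_normK ?num_real// expr_div_n; nra.
apply: (@le_trans _ _ (P (X @^-1` [set x | l / 2 <= `|x - m|]%R))).
  apply: le_measure; rewrite ?inE; [exact: (mset _ (mabs0 l))|exact: (mset _ (mabs _ _))|].
  move=> w /= h; have := ler_normD (X w - m) m; rewrite subrK; lra.
rewrite gP; last exact: mabs.
apply: (le_trans (normal_prob_tail m s0 _)); first by rewrite divr_ge0// ltW.
rewrite lee_fin ler_wpM2l// mulNr expRN.
set y := _ / _.
have yE : l ^+ 2 / (64 * v) <= y.
  rewrite /y expr_div_n ler_pdivrMr ?mulr_gt0// mulrAC ler_pdivlMr ?pmulrn_lgt0//.
  have : 0 < l ^+ 2 by rewrite exprn_gt0.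
  by rewrite -mulr_natr; nra.
have z0 : 0 < l ^+ 2 / (64 * v) by rewrite divr_gt0 ?exprn_gt0 ?mulr_gt0.
apply: (@le_trans _ _ ((l ^+ 2 / (64 * v) / N.+1%:R) ^+ N.+1)^-1).
  have u0 : 0 < l ^+ 2 / (64 * v) / N.+1%:R by rewrite divr_gt0.
  rewrite lef_pV2 ?posrE ?expR_gt0 ?(exprn_gt0 _ u0)//.
  by rewrite (le_trans (expR_ge_exprn N (ltW z0)))// ler_expR.
rewrite -exprVn lerXn2r ?nnegrE ?invr_ge0 ?(ltW (divr_gt0 z0 _))//.
  by apply: divr_ge0 => //; exact: sqr_ge0.
rewrite invfM invrK invf_div mulrAC ler_wpM2r ?invr_ge0 ?sqr_ge0//.
by rewrite mulrAC ler_wpM2r ?ler0n ?ler_wpM2r ?(ltW v0)//; lra.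
Qed.

Lemma fBm_increment_gaussian d (Omega : measurableType d) (R : realType)
    (P : probability Omega R) (H : R) (B : R -> Omega -> R) (s t : R) :
  fBm P H B -> 0 <= s -> 0 <= t -> gaussian_law P (fun w => B t w - B s w).
Proof.
move=> [_ gB _ _ _] s0 t0.
have /= := gB 2%N (fun i => if i == 0 then 1 else -1) (fun i => if i == 0 then t else s).
have -> : (fun w => \sum_(i < 2) (if i == 0 then 1 else -1) * B (if i == 0 then t else s) w)
    = (fun w => B t w - B s w).
  by apply/funext => w; rewrite big_ord_recl big_ord1/= mul1r mulN1r.
by apply=> i; case: ifP.
Qed.

Lemma fBm_increment_moment d (Omega : measurableType d) (R : realType)
    (P : probability Omega R) (H : R) (B : R -> Omega -> R) (s t : R) :
  fBm P H B -> 0 < H -> 0 <= s -> 0 <= t ->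
  (\int[P]_w ((B t w - B s w) ^+ 2)%:E)%E = (`|t - s| `^ (2 * H))%:E.
Proof.
move=> [mB _ EB covB _] H0 s0 t0.
have cov (a b : R) : 0 <= a -> 0 <= b -> (\int[P]_w (B a w * B b w)%:E)%E =
    ((a `^ (2 * H) + b `^ (2 * H) - `|b - a| `^ (2 * H)) / 2)%:E.
  move=> a0 b0; rewrite -covB// covariance.unlock !EB//= expectation.unlock.
  by apply: eq_integral => w _; rewrite !fctE /= !subr0.
have sq (a : R) : 0 <= a -> (\int[P]_w (B a w ^+ 2)%:E)%E = (a `^ (2 * H))%:E.
  move=> a0; under eq_integral do rewrite expr2.
  rewrite cov// subrr normr0 powR0 ?mulf_neq0 ?gt_eqF// subr0; congr EFin.
  by field.
(* Squares are integrable because their integrals were just computed to be finite; they dominate the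
   cross term below. *)
have iX2 (a : R) : 0 <= a -> P.-integrable setT (EFin \o (fun w => B a w ^+ 2)).
  move=> a0; apply/integrableP; split.
    by apply/measurable_EFinP; apply: measurable_funX; exact: mB.
  under eq_integral do rewrite /= ger0_norm ?sqr_ge0//.
  by rewrite sq// ltry.
have iD (a b : R) : 0 <= a -> 0 <= b ->
    P.-integrable setT (EFin \o (fun w => B a w ^+ 2 + B b w ^+ 2)).
  move=> a0 b0.
  by apply: (eq_integrable measurableT _ _ _ (integrableD measurableT (iX2 _ a0) (iX2 _ b0))).
have iM : P.-integrable setT (EFin \o (fun w => B t w * B s w)).
  apply: (le_integrable measurableT _ _ (iD _ _ t0 s0)).
    by apply/measurable_EFinP; apply: measurable_funM; exact: mB.
  move=> w _ /=; rewrite lee_fin normrM [leRHS]ger0_norm ?addr_ge0 ?sqr_ge0//.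
  rewrite -[B t w ^+ 2]real_normK ?num_real// -[B s w ^+ 2]real_normK ?num_real//.
  by have := normr_ge0 (B t w); have := normr_ge0 (B s w); nra.
have iM2 : P.-integrable setT (EFin \o (fun w => 2 * (B t w * B s w))).
  by apply: (eq_integrable measurableT _ _ _ (integrableZl measurableT 2 iM)).
transitivity (\int[P]_w ((B t w ^+ 2 + B s w ^+ 2)%:E - (2 * (B t w * B s w))%:E))%E.
  by apply: eq_integral => w _; rewrite -EFinB; congr EFin; ring.
rewrite integralB_EFin//; last exact: iD.
have -> : (\int[P]_w (B t w ^+ 2 + B s w ^+ 2)%:E)%E
    = (\int[P]_w (B t w ^+ 2)%:E + \int[P]_w (B s w ^+ 2)%:E)%E.
  by rewrite -(integralD_EFin measurableT (iX2 _ t0) (iX2 _ s0)).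
have -> : (\int[P]_w (2 * (B t w * B s w))%:E)%E
    = (2%:E * \int[P]_w (B t w * B s w)%:E)%E.
  by rewrite -(integralZl measurableT iM).
rewrite !sq// cov// -EFinM -EFinD distrC; congr EFin.
by field.
Qed.

Lemma pow2_div_lt (R : realType) (x e : R) : 0 < e -> exists i, x / 2 ^+ i < e.
Proof.
move=> e0; exists (Num.truncn (`|x| / e)); rewrite ltr_pdivrMr ?exprn_gt0//.
rewrite (le_lt_trans (ler_norm x))// mulrC -ltr_pdivrMr//.
have /truncn_itv/andP[_ h] : 0 <= `|x| / e by rewrite divr_ge0 ?normr_ge0 ?(ltW e0).
by rewrite (lt_le_trans h)// -natrX ler_nat ltn_expl.
Qed.

Lemma pow2_inv_lt (R : realType) (e : R) : 0 < e -> exists i, (2 ^+ i)^-1 < e.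
Proof. by move=> e0; have [i hi] := pow2_div_lt 1 e0; exists i; rewrite -div1r. Qed.

(** Kolmogorov's chaining. If 2^-(k+1) < r - s <= 2^-k, the left neighbours of s and r on the grid
    2^-k Z are equal or adjacent. Refining either neighbour towards its point costs a geometric
    series, at most A rho^k with A = c / (1 - rho), so the total is (2 A + c) rho^k, and rho^k <=
    2^gam (r - s)^gam. *)
Lemma dyadic_holder (R : realType) (g : R -> R) (gam c : R) (M n0 : nat) :
    0 < gam -> 0 <= c -> {within `[0, +oo[, continuous g} ->
    (forall k j, (n0 <= k)%N -> (j < M * 2 ^ k)%N ->
       `|g (j.+1%:R / 2 ^+ k) - g (j%:R / 2 ^+ k)| <= c * (2 `^ (- gam)) ^+ k) ->
  forall s r, 0 <= s <= M%:R -> 0 <= r <= M%:R -> `|s - r| <= (2 ^+ n0)^-1 ->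
    `|g s - g r| <= c * ((1 + 2 / (1 - 2 `^ (- gam))) * 2 `^ gam) * `|s - r| `^ gam.
Proof.
move=> gam0 c0 cg gj; set rho := 2 `^ (- gam).
have rho0 : 0 < rho by rewrite powR_gt0.
have rho1 : rho < 1.
  have e1 : 1 `^ gam = 1 :> R by rewrite powR1.
  rewrite /rho powRN invf_lt1 ?powR_gt0// -[ltLHS]e1.
  by rewrite gt0_ltr_powR ?nnegrE ?ler0n ?ltr1n.
have p2 k : 0 < 2 ^+ k :> R by rewrite exprn_gt0.
pose A := c / (1 - rho).
have A0 : 0 <= A by rewrite divr_ge0// subr_ge0 ltW.
pose jj (s : R) k := Num.truncn (s * 2 ^+ k).
pose ss (s : R) k : R := (jj s k)%:R / 2 ^+ k.
have jjP s k : 0 <= s -> (jj s k)%:R <= s * 2 ^+ k < (jj s k).+1%:R.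
  by move=> s0; apply: truncn_itv; rewrite mulr_ge0// ltW.
have adj s r k : 0 <= s -> 0 <= r <= M%:R -> (n0 <= k)%N ->
    (jj s k <= jj r k <= (jj s k).+1)%N -> `|g (ss r k) - g (ss s k)| <= c * rho ^+ k.
  move=> s0 /andP[r0 rM] nk /andP[]; rewrite leq_eqVlt => /orP[/eqP E _|lt le].
    by rewrite /ss E subrr normr0 mulr_ge0// exprn_ge0// ltW.
  have E : jj r k = (jj s k).+1 by apply/eqP; rewrite eqn_leq le lt.
  rewrite /ss E; apply: gj => //; rewrite -E -(@ler_nat R) natrM natrX.
  have /andP[h _] := jjP r k r0; apply: (le_trans h).
  by rewrite ler_wpM2r// ltW.
have step s k : 0 <= s <= M%:R -> (n0 <= k)%N ->
    `|g (ss s k.+1) - g (ss s k)| <= c * rho ^+ k.+1.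
  move=> /andP[s0 sM] nk.
  have -> : ss s k = ((jj s k).*2)%:R / 2 ^+ k.+1.
    by rewrite /ss -muln2 natrM exprS; field; rewrite lt0r_neq0// p2.
  have /andP[a1 a2] := jjP s k s0; have /andP[b1 b2] := jjP s k.+1 s0.
  have lo : ((jj s k).*2 <= jj s k.+1)%N.
    rewrite /jj truncn_ge_nat ?mulr_ge0 ?(ltW (p2 _))// -muln2 natrM exprS mulrCA mulrC.
    by rewrite ler_wpM2l.
  have hi : (jj s k.+1 <= (jj s k).*2.+1)%N.
    rewrite -ltnS -(@ltr_nat R) (le_lt_trans b1)// -doubleS -muln2 natrM exprS.
    by rewrite mulrCA mulrC ltr_pM2r.
  move: lo; rewrite leq_eqVlt => /orP[/eqP E|lo].
    by rewrite E subrr normr0 mulr_ge0// exprn_ge0// ltW.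
  have E : jj s k.+1 = (jj s k).*2.+1 by apply/eqP; rewrite eqn_leq hi lo.
  rewrite {1}/ss E; apply: gj; first exact: leqW.
  rewrite -E -(@ler_nat R) natrM natrX (le_trans b1)//.
  by rewrite ler_wpM2r// ltW.
(* The subtracted tail is what makes the induction on i close. *)
have tele s k i : 0 <= s <= M%:R -> (n0 <= k)%N ->
    `|g (ss s (k + i)%N) - g (ss s k)| <= A * rho ^+ k - A * rho ^+ (k + i).
  move=> sM nk; elim: i => [|i IH]; first by rewrite addn0 !subrr normr0.
  rewrite addnS.
  have h := step s (k + i)%N sM (leq_trans nk (leq_addr _ _)).
  have E : c * rho ^+ (k + i).+1 <= A * rho ^+ (k + i) - A * rho ^+ (k + i).+1.
    have -> : c = A * (1 - rho) by rewrite divfK// gt_eqF// subr_gt0.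
    rewrite exprS.
    have : 0 <= A * (1 - rho) ^+ 2 * rho ^+ (k + i).
      apply: mulr_ge0; last exact: exprn_ge0 (ltW rho0).
      by apply: mulr_ge0; rewrite // sqr_ge0.
    lra.
  have := ler_normD (g (ss s (k + i).+1) - g (ss s (k + i)%N))
     (g (ss s (k + i)%N) - g (ss s k)).
  rewrite addrA subrK; lra.
have ss0 s k : 0 <= s -> 0 <= ss s k by move=> s0; rewrite divr_ge0// ltW.
have ssd s k : 0 <= s -> `|s - ss s k| <= (2 ^+ k)^-1.
  move=> s0; have /andP[a1 a2] := jjP s k s0.
  rewrite -[s in `|s - _|](mulfK (lt0r_neq0 (p2 k))) -mulrBl normrM.
  rewrite [X in _ * X]ger0_norm ?invr_ge0 ?(ltW (p2 k))//.
  rewrite ger0_norm ?subr_ge0// ler_piMl ?invr_ge0 ?(ltW (p2 k))//.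
  by move: a2; rewrite -natr1; lra.
(* Continuity carries the estimate from grid points to arbitrary times. *)
have lim s k : 0 <= s <= M%:R -> (n0 <= k)%N -> `|g s - g (ss s k)| <= A * rho ^+ k.
  move=> sM nk; have /andP[s0 _] := sM; apply/ler_addgt0Pr => e e0.
  have /subspace_continuousP/(_ s) := cg.
  rewrite /= in_itv/= s0 => /(_ isT)/cvgrPdist_le/(_ e e0).
  rewrite near_withinE => /nbhs_ballP[dl /= dl0 hdl].
  have [i i1] : exists i, (2 ^+ (k + i))^-1 < dl.
    have [i hi] := pow2_inv_lt dl0; exists i; apply: le_lt_trans hi.
    by rewrite lef_pV2 ?posrE// ler_eXn2l ?ltr1n// leq_addl.
  have := hdl (ss s (k + i)%N) (le_lt_trans (ssd s _ s0) i1).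
  rewrite /= in_itv/= ss0// => /(_ isT) h1.
  have h2 := tele s k i sM nk.
  have : 0 <= A * rho ^+ (k + i) by rewrite mulr_ge0// exprn_ge0// ltW.
  have := ler_normD (g s - g (ss s (k + i)%N)) (g (ss s (k + i)%N) - g (ss s k)).
  rewrite addrA subrK; lra.
move=> s r; wlog sr : s r / s <= r.
  move=> W sM rM; have [/W|/ltW/W] := leP s r; first exact.
  by rewrite distrC [`|g s - _|]distrC; exact.
move=> sM rM; have /andP[s0 s1] := sM; have /andP[r0 r1] := rM.
rewrite distrC ger0_norm ?subr_ge0// => srn.
move: sr; rewrite le_eqVlt => /orP[/eqP ->|sr].
  by rewrite !subrr normr0 powR0 ?gt_eqF// mulr0.
have rs0 : 0 < r - s by rewrite subr_gt0.
have exk : exists k, (2 ^+ k.+1)^-1 < r - s.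
  have [i hi] := pow2_inv_lt rs0; exists i; apply: lt_trans hi.
  by rewrite ltf_pV2 ?posrE// ltr_eXn2l ?ltr1n.
(* If the least k with 2^-(k+1) < r - s lies below n0, then n0 itself works, since r - s <=
   2^-n0. *)
have [k [nk k1 k2]] : exists k, [/\ (n0 <= k)%N, (2 ^+ k.+1)^-1 < r - s & r - s <= (2 ^+ k)^-1].
  case: (ex_minnP exk) => k hk kmin; have [nk|kn] := leqP n0 k.
    exists k; split => //; have [k0|k0] := posnP k.
      move: srn; rewrite (_ : n0 = 0)%N ?k0//.
      by move: nk; rewrite k0 leqn0 => /eqP.
    rewrite leNgt; apply/negP => h; have := kmin k.-1; rewrite prednK// => /(_ h).
    by rewrite -ltnS prednK// ltnn.
  exists n0; split => //; apply: le_lt_trans hk.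
  by rewrite lef_pV2 ?posrE// ler_eXn2l ?ltr1n// ltnS ltnW.
have hs := lim s k sM nk; have hr := lim r k rM nk.
have hjj : (jj s k <= jj r k <= (jj s k).+1)%N.
  apply/andP; split; first by apply: le_truncn; rewrite ler_wpM2r ?(ltW sr)// ltW.
  have /andP[a1 a2] := jjP s k s0; have /andP[b1 b2] := jjP r k r0.
  rewrite -ltnS -(@ltr_nat R) (le_lt_trans b1)//.
  have : (r - s) * 2 ^+ k <= 1 by rewrite -ler_pdivlMr// div1r.
  move: a2; rewrite -!natr1; lra.
have hm := adj s r k s0 rM nk hjj.
have k3 : rho ^+ k <= 2 `^ gam * (r - s) `^ gam.
  have -> : rho ^+ k = 2 `^ gam * ((2 ^+ k.+1)^-1) `^ gam.
    have -> : (2 ^+ k.+1)^-1 = 2 `^ (- k.+1%:R) :> R by rewrite powRN powR_mulrn.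
    rewrite -powRrM -powRD; last by apply/implyP => _.
    rewrite -powR_mulrn ?powR_ge0// -powRrM; congr (_ `^ _).
    by rewrite -natr1; ring.
  rewrite ler_wpM2l ?powR_ge0// ge0_ler_powR ?(ltW gam0) ?nnegrE
    ?invr_ge0 ?(ltW (p2 _)) ?(ltW rs0)//.
  exact: ltW.
have tri : `|g s - g r| <= (2 * A + c) * rho ^+ k.
  have := ler_normD (g s - g (ss s k)) (g (ss s k) - g r); rewrite addrA subrK.
  have := ler_normD (g (ss s k) - g (ss r k)) (g (ss r k) - g r); rewrite addrA subrK.
  rewrite [`|g (ss s k) - g (ss r k)|]distrC [`|g (ss r k) - g r|]distrC; lra.
apply: (le_trans tri).
have -> : 2 * A + c = c * (1 + 2 / (1 - rho)) by rewrite /A; ring.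
rewrite -!mulrA ler_wpM2l// ler_wpM2l//.
by rewrite addr_ge0// divr_ge0// subr_ge0 ltW.
Qed.

(** Borel-Cantelli for the dyadic increments, followed by chaining. The random scale is 2^-n, where
    n is the first level from which no increment is too large. *)
Lemma fBm_local_holder d (Omega : measurableType d) (R : realType)
    (P : probability Omega R) (H gam T : R) (B : R -> Omega -> R) :
    fBm P H B -> 0 < gam < H -> 0 <= T ->
  exists eta : Omega -> R,
    [/\ measurable_fun setT eta, forall w, 0 < eta w
      & {ae P, forall w, forall s r, 0 <= s <= T -> 0 <= r <= T ->
          `|s - r| <= eta w -> `|B s w - B r w| <= `|s - r| `^ gam}].
Proof.
move=> hB /andP[gam0 gamH] T0; have H0 : 0 < H := lt_trans gam0 gamH.
have [mB _ _ _ cB] := hB.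
pose M := (Num.truncn T).+1.
have TM : T <= M%:R by have /andP[_ /ltW] := truncn_itv T0.
set rho : R := 2 `^ (- gam).
have rho0 : 0 < rho by rewrite powR_gt0.
have rho1 : rho < 1.
  have e1 : 1 `^ gam = 1 :> R by rewrite powR1.
  rewrite /rho powRN invf_lt1 ?powR_gt0// -[ltLHS]e1.
  by rewrite gt0_ltr_powR ?nnegrE ?ler0n ?ltr1n.
set C := (1 + 2 / (1 - rho)) * 2 `^ gam.
have C0 : 0 < C.
  rewrite /C mulr_gt0 ?powR_gt0// addr_gt0// divr_gt0// subr_gt0//.
(* Inverse of the chaining constant, so that the final Hölder constant is exactly 1. *)
set c := C^-1; have c0 : 0 < c by rewrite invr_gt0.
pose pt (k j : nat) : R := j%:R / 2 ^+ k.
have pt0 k j : 0 <= pt k j by rewrite divr_ge0// exprn_ge0.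
pose E k j := [set w | c * rho ^+ k <= `|B (pt k j.+1) w - B (pt k j) w|].
have mE k j : measurable (E k j).
  have mD : measurable_fun setT (fun w => `|B (pt k j.+1) w - B (pt k j) w|).
    by apply/measurableT_comp => //; apply: measurable_funB; exact: mB.
  rewrite [X in measurable X](_ : _ = setT `&`
    (fun w => `|B (pt k j.+1) w - B (pt k j) w|) @^-1` `[c * rho ^+ k, +oo[).
    exact: mD.
  by apply/seteqP; split => w /=; rewrite in_itv/= andbT //; case.
pose A k := \big[setU/set0]_(j < M * 2 ^ k) E k j.
have mA k : measurable (A k) by apply: bigsetU_measurable.
have [K512 hK] : exists K : R, 512 <= K by exists 512.
(* The power of the tail bound is taken so large that one increment of level k is bad with
   probability O(4^-k), which beats the M 2^k increments of that level. *)
have [N hN] : exists N : nat, 2 <= 2 * (H - gam) * N.+1%:R.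
  have h0 : 0 < H - gam by rewrite subr_gt0.
  exists (Num.truncn (H - gam)^-1).
  have /truncn_itv/andP[_ /ltW h] : 0 <= (H - gam)^-1 by rewrite invr_ge0 ltW.
  rewrite -mulrA ler_pMr// mulrC -ler_pdivrMr// mul1r//.
pose C1 : R := (K512 * N.+1%:R / c ^+ 2) ^+ N.+1.
have C1ge0 : 0 <= C1.
  apply: exprn_ge0; apply: divr_ge0; last exact: sqr_ge0.
  by apply: mulr_ge0; [lra|exact: ler0n].
have q0 k : 0 < (2 ^+ k)^-1 :> R by rewrite invr_gt0 exprn_gt0.
have q1 k : (2 ^+ k)^-1 <= 1 :> R.
  by rewrite invf_le1 ?exprn_gt0// exprn_ege1// ler1n.
have PE k j : (P (E k j) <= (2 * (C1 * (2 ^+ k)^-1 ^+ 2))%:E)%E.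
  set q := (2 ^+ k)^-1; have mom := fBm_increment_moment hB H0 (pt0 k j) (pt0 k j.+1).
  have ptE : `|pt k j.+1 - pt k j| = q.
    rewrite /pt -mulrBl -natr1 addrAC subrr add0r mul1r ger0_norm//.
  rewrite ptE in mom.
  have l0 : 0 < c * rho ^+ k by rewrite mulr_gt0// exprn_gt0.
  have v0 : 0 < q `^ (2 * H) by apply: powR_gt0; exact: q0.
  have mD : measurable_fun setT (fun w => B (pt k j.+1) w - B (pt k j) w).
    by apply: measurable_funB; exact: mB.
  have gD := fBm_increment_gaussian hB (pt0 k j) (pt0 k j.+1).
  have mom_le : (\int[P]_w ((B (pt k j.+1) w - B (pt k j) w) ^+ 2)%:E
      <= (q `^ (2 * H))%:E)%E by rewrite mom.
  apply: (le_trans (gaussian_tail N hK mD gD mom_le v0 l0)).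
  rewrite lee_fin ler_wpM2l//.
  have -> : K512 * N.+1%:R * q `^ (2 * H) / (c * rho ^+ k) ^+ 2
      = K512 * N.+1%:R / c ^+ 2 * q `^ (2 * (H - gam)).
    have rE : rho ^+ k = q `^ gam.
      rewrite /rho /q -powR_mulrn ?powR_ge0// -powRrM.
      have -> : (2 ^+ k)^-1 = 2 `^ (- k%:R) :> R by rewrite powRN powR_mulrn.
      by rewrite -powRrM; congr (_ `^ _); ring.
    have -> : q `^ (2 * (H - gam)) = q `^ (2 * H) * (q `^ gam) ^- 2.
      rewrite -powR_mulrn ?powR_ge0// -powRrM -powRN -powRD; last first.
        by apply/implyP => _; rewrite gt_eqF//; exact: q0.
      by congr (_ `^ _); ring.
    rewrite rE exprMn invfM; set z := q `^ _; set y := _ ^- 2.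
    by rewrite -!mulrA; congr (_ * (_ * _)); rewrite mulrCA.
  rewrite exprMn -/C1 ler_wpM2l// -powR_mulrn ?powR_ge0// -powRrM.
  by rewrite -(@powR_mulrn _ q 2) ?(ltW (q0 k))// ger_powR// q0 q1.
(* M 2^k events of probability at most 2 C1 4^-k sum to 2 M C1 / 2^k, written as C2 / 2^(k+1) to
   match the geometric series used below. *)
pose C2 : R := 4 * (M%:R * C1).
have PA k : (P (A k) <= (C2 / (2 ^ (k + 1))%:R)%:E)%E.
  apply: (le_trans (Boole_inequality _ _)) => //.
  apply: (@le_trans _ _ (\sum_(j < M * 2 ^ k) (2 * (C1 * (2 ^+ k)^-1 ^+ 2))%:E)%E).
    by apply: lee_sum => j _; exact: PE.
  rewrite sumEFin lee_fin sumr_const card_ord -[X in (X <= _)%R]mulr_natr natrM natrX /C2.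
  rewrite natrX addn1 (exprS _ k) le_eqVlt; apply/orP; left; apply/eqP.
  have : 2 ^+ k != 0 :> R by rewrite expf_neq0.
  by move: (2 ^+ k) => z z0; field.
have cvA : (\sum_(0 <= k <oo) P (A k) < +oo)%E.
  have := @cvg_geometric_eseries_half R C2 0 => /cvg_lim cE.
  apply: (@le_lt_trans _ _ (C2 / 2 ^+ 0)%:E); last exact: ltry.
  by rewrite -cE//; apply: lee_nneseries.
have P0 := lim_sup_set_cvg0 mA cvA.
set Z := lim_sup_set A in P0.
have mZ : measurable Z.
  by apply: bigcap_measurable => // n _; apply: bigcup_measurable.
pose G n := ~` (\bigcup_(k >= n) A k).
have mG n : measurable (G n) by apply: measurableC; apply: bigcup_measurable.
have ZG w : ~ Z w -> exists n, `[< G n w >].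
  by rewrite /Z /lim_sup_set => /existsNP[n /not_implyP[_ h]]; exists n; apply/asboolP.
(* The first good level, with default 0 where there is none, so that 2^-nn is positive
   everywhere. *)
pose nn w := if pselect (exists n, `[< G n w >]) is left h then ex_minn h else 0%N.
have nnG w : ~ Z w -> G (nn w) w.
  move=> /ZG h; rewrite /nn; case: pselect => // h'.
  by case: ex_minnP => m /asboolP.
exists (fun w => (2 ^+ nn w)^-1); split => //.
- have -> : setT = \bigcup_i (nn @^-1` [set i]).
    by apply/seteqP; split => // w _; exists (nn w).
  have mnn i : measurable (nn @^-1` [set i]).
    (* The second piece accounts for the default: [nn] is 0 also on the event that no level is
       good. *)
    rewrite [X in measurable X](_ : _ =
      (G i `&` ~` \bigcup_(k < i) G k) `|`
      (if i == 0%N then ~` \bigcup_k G k else set0)).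
      apply: measurableU.
        apply: measurableI => //; apply: measurableC.
        by apply: bigcup_measurable.
      by case: ifP => _ //; apply: measurableC; apply: bigcup_measurable.
    apply/seteqP; split => w /=.
    + rewrite /nn; case: pselect => [h|h].
        case: ex_minnP => m /asboolP Gm mmin <-; left; split => // -[k /= km Gk].
        by move: km; rewrite ltnNge mmin//; exact/asboolP.
      move=> <-; right; rewrite eqxx => -[k _ Gk]; apply: h.
      by exists k; exact/asboolP.
    + case=> [[Gi nG]|].
        rewrite /nn; case: pselect => [h|[]]; last by exists i; exact/asboolP.
        case: ex_minnP => m /asboolP Gm mmin; apply/eqP; rewrite eqn_leq.
        apply/andP; split; first by apply: mmin; exact/asboolP.
        by rewrite leqNgt; apply/negP => mi; apply: nG; exists m.
      case: eqP => // -> nG; rewrite /nn; case: pselect => [ex0|//]; exfalso.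
      by case: ex0 => k /asboolP Gk; apply: nG; exists k.
  apply/measurable_fun_bigcup => // i.
  apply: (eq_measurable_fun (fun _ : Omega => (2 ^+ i)^-1 : R)) => [w|]; last exact: measurable_cst.
  by rewrite inE /= => ->.
- have nZ : {ae P, forall w, ~ Z w}.
    by exists Z; split => // w /= /contrapT.
  apply: filterS2 cB nZ => w cw /nnG Gw s r /andP[s0 sT] /andP[r0 rT] sr.
  have := @dyadic_holder R (B ^~ w) gam c M (nn w) gam0 (ltW c0) cw.
  have h k j : (nn w <= k)%N -> (j < M * 2 ^ k)%N ->
    `|B (j.+1%:R / 2 ^+ k) w - B (j%:R / 2 ^+ k) w| <= c * (2 `^ (- gam)) ^+ k.
    move=> nk jk; rewrite leNgt; apply/negP => /ltW hE; apply: Gw.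
    exists k => //; rewrite /A -(bigcup_mkord (M * 2 ^ k) (E k)).
    by exists j.
  move=> /(_ h s r); rewrite s0 r0 (le_trans sT)//= (le_trans rT)//= => /(_ isT isT sr).
  by rewrite -/rho -/C /c mulVf ?mul1r// gt_eqF.
Qed.

(** * Young integrals *)

(** Estimates run in the maximum norm, where entrywise bounds suffice; the next lemmas convert to
    and from [enorm], at the cost of a factor equal to the number of entries. *)
Lemma mx_norm_entry (R : realType) (m n : nat) (A : 'M[R]_(m, n)) i j :
  `|A i j| <= `|A|.
Proof.
rewrite [leRHS]/Num.norm /= mx_normrE; apply/bigmax_geP; right => /=.
by exists (i, j).
Qed.

Lemma mx_norm_le (R : realType) (m n : nat) (A : 'M[R]_(m, n)) (c : R) :
  0 <= c -> (forall i j, `|A i j| <= c) -> `|A| <= c.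
Proof.
move=> c0 h; rewrite [leLHS]/Num.norm /= mx_normrE; apply/bigmax_leP.
by split => // -[i j] _ /=.
Qed.

Lemma mx_norm_le_enorm (R : realType) (m n : nat) (A : 'M[R]_(m, n)) :
  `|A| <= enorm A.
Proof.
apply: mx_norm_le => [|i j]; first exact: sqrtr_ge0.
rewrite -sqrtr_sqr ler_wsqrtr// (bigD1 i)//= (bigD1 j)//= -addrA lerDl.
rewrite addr_ge0// ?sumr_ge0// => k _; first exact: sqr_ge0.
by apply: sumr_ge0 => l _; exact: sqr_ge0.
Qed.

Lemma enorm_le_mx_norm (R : realType) (m n : nat) (A : 'M[R]_(m, n)) :
  enorm A <= (m * n)%:R * `|A|.
Proof.
rewrite -[leRHS]ger0_norm ?mulr_ge0//.
rewrite -sqrtr_sqr ler_wsqrtr//.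
apply: (@le_trans _ _ ((m * n)%:R * `|A| ^+ 2)).
  apply: (@le_trans _ _ (\sum_(i < m) \sum_(j < n) `|A| ^+ 2)).
    apply: ler_sum => i _; apply: ler_sum => j _.
    rewrite -[leLHS]real_normK ?num_real//.
    by rewrite lerXn2r ?nnegrE// mx_norm_entry.
  by rewrite !(sumr_const, card_ord) -mulrnA mulr_natl mulnC.
rewrite exprMn ler_wpM2r ?sqr_ge0// -natrX ler_nat.
by case: (m * n)%N => // k; rewrite expnS leq_pmulr.
Qed.

Lemma mx_norm_mulmx (R : realType) (m n p : nat) (A : 'M[R]_(m, n)) (B : 'M[R]_(n, p)) :
  `|A *m B| <= n%:R * `|A| * `|B|.
Proof.
apply: mx_norm_le => [|i j]; first by rewrite !mulr_ge0// ler0n.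
rewrite mxE (le_trans (ler_norm_sum _ _ _))//.
apply: (@le_trans _ _ (\sum_(k < n) `|A| * `|B|)).
  by apply: ler_sum => k _; rewrite normrM ler_pM// mx_norm_entry.
by rewrite sumr_const card_ord -mulrA mulr_natl.
Qed.

Lemma enorm_ge0 (R : realType) (m n : nat) (A : 'M[R]_(m, n)) : 0 <= enorm A.
Proof. exact: sqrtr_ge0. Qed.

Lemma powR_gt1_split (R : realType) (h theta : R) : 0 <= h -> 1 < theta ->
  h `^ theta = h `^ (theta - 1) * h.
Proof. by move=> h0 t1; rewrite [RHS]mulrC mulr_powRB1//; lra. Qed.

(** Left-point Riemann-Stieltjes sums, by recursion on the partition, so that sums over concatenated
    partitions add up. *)
Fixpoint left_sum (R : realType) (n : nat) (f : R -> 'cV[R]_n) (g : R -> R)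
    (a : R) (p : seq R) : 'cV[R]_n :=
  if p is x :: q then (g x - g a) *: f a + left_sum f g x q else 0.

Lemma left_sum_cat (R : realType) (n : nat) (f : R -> 'cV[R]_n) (g : R -> R)
    (a : R) (p q : seq R) :
  left_sum f g a (p ++ q) = left_sum f g a p + left_sum f g (last a p) q.
Proof. by elim: p a => [|x p IH] a /=; rewrite ?add0r// IH addrA. Qed.

Lemma RS_sum_cons (R : realType) (n : nat) (f : R -> 'cV[R]_n) (g : R -> R)
    (a x : R) (p : seq R) (xi : nat -> R) :
  RS_sum f g a (x :: p) xi =
  (g x - g a) *: f (xi 0%N) + RS_sum f g x p (fun i => xi i.+1).
Proof.
rewrite /RS_sum big_ord_recl /=; congr (_ + _); apply: eq_bigr => i _.
have e1 : nth a p i = nth x p i by apply: set_nth_default.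
have e2 : nth a (x :: p) i = nth x (x :: p) i.
  by apply: set_nth_default; rewrite /= ltnS ltnW.
by rewrite /bump /= add1n /= e1 e2.
Qed.

Lemma RS_sum_left (R : realType) (n : nat) (f : R -> 'cV[R]_n) (g : R -> R)
    (a : R) (p : seq R) (xi : nat -> R) :
    (forall i, (i < size p)%N -> xi i = nth a (a :: p) i) ->
  RS_sum f g a p xi = left_sum f g a p.
Proof.
elim: p a xi => [|x p IH] a xi h; first by rewrite /RS_sum big_ord0.
rewrite RS_sum_cons (h 0%N)//= IH// => i ip.
rewrite (h i.+1)//=.
by apply: (@set_nth_default _ (x :: p)); rewrite /= ltnS ltnW.
Qed.

Definition mesh_lt (R : realType) (dl : R) : rel R :=
  fun x y => (x < y) && (y - x < dl).

Lemma mesh_ltS (R : realType) (dl dl' a : R) (p : seq R) : dl <= dl' ->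
  path (mesh_lt dl) a p -> path (mesh_lt dl') a p.
Proof.
move=> le; apply: sub_path => x y /andP[xy h].
by rewrite /mesh_lt xy (lt_le_trans h).
Qed.

Lemma RS_integral_left (R : realType) (n : nat) (f : R -> 'cV[R]_n)
    (g : R -> R) (a b : R) (I : 'cV[R]_n) :
    RS_integral f g a b I -> forall e, 0 < e -> exists2 dl, 0 < dl &
  forall p, path (mesh_lt dl) a p -> last a p = b -> `|left_sum f g a p - I| < e.
Proof.
move=> h e /h[dl dl0 hdl]; exists dl => // p pp pb.
have lt : path <%R a p by apply: sub_path pp => x y /andP[].
rewrite -(@RS_sum_left _ _ _ _ _ _ (fun i => nth a (a :: p) i))//.
apply: (le_lt_trans (mx_norm_le_enorm _)); apply: hdl.
  by split => //; apply/eqP.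
move=> i ip; have /(pathP a)/(_ i ip)/andP[h1 h2] := pp.
by split => //; rewrite lexx ltW.
Qed.

(** Built by halving the interval rather than by listing points: one level of the recursion is one
    insertion of a midpoint, which is the induction step of Young's estimate. As in [itv_partition],
    the left end point is left out. *)
Fixpoint dyadic_part (R : realType) (s h : R) (k : nat) : seq R :=
  if k is k'.+1 then
    dyadic_part s (h / 2) k' ++ dyadic_part (s + h / 2) (h / 2) k'
  else [:: s + h].

Lemma last_dyadic_part (R : realType) (a s h : R) (k : nat) :
  last a (dyadic_part s h k) = s + h.
Proof.
elim: k a s h => //= k IH a s h.
by rewrite last_cat IH -addrA -splitr.
Qed.

Lemma path_dyadic_part (R : realType) (dl s h : R) (k : nat) :
  0 < h -> h / 2 ^+ k < dl -> path (mesh_lt dl) s (dyadic_part s h k).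
Proof.
elim: k s h => [|k IH] s h h0 hd /=.
  by move: hd; rewrite /mesh_lt ltrDl h0 expr0 divr1 [s + h]addrC addrK andbT.
have h2 : 0 < h / 2 by rewrite divr_gt0.
have hk : h / 2 / 2 ^+ k < dl by rewrite -mulrA -invfM -exprS.
by rewrite cat_path last_dyadic_part !IH.
Qed.

Lemma dyadic_part_ex (R : realType) (dl a b : R) : 0 < dl -> a <= b ->
  exists2 p, path (mesh_lt dl) a p & last a p = b.
Proof.
move=> dl0; rewrite le_eqVlt => /orP[/eqP <-|ab]; first by exists [::].
have ba : 0 < b - a by rewrite subr_gt0.
have [k hk] := pow2_div_lt (b - a) dl0.
exists (dyadic_part a (b - a) k); first exact: path_dyadic_part.
by rewrite last_dyadic_part addrC subrK.
Qed.

(** Inserting the midpoint changes the sum by at most F G (h / 2)^theta. With q = 2^(1 - theta) < 1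
    the two halves contribute K q h^theta and the insertion K (1 - q) (q / 2) h^theta, where K = F G
    / (1 - q); together they stay below K h^theta, uniformly in k. *)
Lemma dyadic_sum_bound (R : realType) (n : nat) (f : R -> 'cV[R]_n) (g : R -> R)
    (a b F G kap gam : R) (k : nat) (s h : R) :
    0 <= F -> 0 <= G -> 0 <= kap -> 0 <= gam -> 1 < kap + gam ->
    (forall s r, a <= s <= b -> a <= r <= b -> `|f s - f r| <= F * `|s - r| `^ kap) ->
    (forall s r, a <= s <= b -> a <= r <= b -> `|g s - g r| <= G * `|s - r| `^ gam) ->
    a <= s -> 0 < h -> s + h <= b ->
  `|left_sum f g s (dyadic_part s h k) - (g (s + h) - g s) *: f s| <=
  F * G / (1 - 2 `^ (1 - (kap + gam))) * h `^ (kap + gam).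
Proof.
move=> F0 G0 kap0 gam0; set theta := kap + gam => th1 hf hg.
set q := 2 `^ (1 - theta).
have q0 : 0 < q by rewrite powR_gt0.
have q1 : q < 1.
  have e1 : 1 `^ (theta - 1) = 1 :> R by rewrite powR1.
  rewrite /q -opprB powRN invf_lt1 ?powR_gt0// -[ltLHS]e1.
  by rewrite gt0_ltr_powR ?nnegrE ?ler0n ?ltr1n ?subr_gt0.
have q'0 : 0 < 1 - q by rewrite subr_gt0.
set K := F * G / (1 - q).
have K0 : 0 <= K by rewrite /K mulr_ge0 ?mulr_ge0// invr_ge0 ltW.
elim: k s h => [|k IH] s h as0 h0 sb /=.
  by rewrite addr0 subrr normr0 mulr_ge0 ?powR_ge0.
have h2 : 0 < h / 2 by rewrite divr_gt0.
have e : s + h / 2 + h / 2 = s + h by field.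
rewrite left_sum_cat last_dyadic_part.
have I1 : `|left_sum f g s (dyadic_part s (h / 2) k)
    - (g (s + h / 2) - g s) *: f s| <= K * (h / 2) `^ theta.
  by apply: IH => //; lra.
have I2 : `|left_sum f g (s + h / 2) (dyadic_part (s + h / 2) (h / 2) k)
    - (g (s + h) - g (s + h / 2)) *: f (s + h / 2)| <= K * (h / 2) `^ theta.
  by rewrite -e; apply: IH => //; lra.
have I3 : `|(g (s + h) - g (s + h / 2)) *: (f (s + h / 2) - f s)|
    <= F * G * (h / 2) `^ theta.
  rewrite mx_normZ mulrC powRD; last by rewrite (gt_eqF h2) implybT.
  rewrite mulrACA ler_pM//.
    have := hf (s + h / 2) s; rewrite [s + _ - s]addrC addKr [`|h / 2|]gtr0_norm//.
    by apply; lra.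
  have := hg (s + h) (s + h / 2).
  have -> : s + h - (s + h / 2) = h / 2 by field.
  by rewrite [`|h / 2|]gtr0_norm//; apply; lra.
have hE : (h / 2) `^ theta = q / 2 * h `^ theta.
  have e2 : 2^-1 = 2 `^ (-1) :> R by rewrite powR_inv1.
  rewrite powRM ?(ltW h0)// mulrC; congr (_ * _).
  rewrite e2 /q -powRrM -powRD ?pnatr_eq0 ?implybT//.
  by congr (_ `^ _); ring.
set S1 := left_sum f g s _ in I1 *; set S2 := left_sum f g (s + h / 2) _ in I2 *.
have -> : S1 + S2 - (g (s + h) - g s) *: f s =
  (S1 - (g (s + h / 2) - g s) *: f s) +
  (S2 - (g (s + h) - g (s + h / 2)) *: f (s + h / 2)) +
  (g (s + h) - g (s + h / 2)) *: (f (s + h / 2) - f s).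
  by apply/matrixP => i j; rewrite !mxE; ring.
apply: (le_trans (ler_normD _ _)).
apply: (le_trans (lerD (ler_normD _ _) (lexx _))).
apply: (le_trans (lerD (lerD I1 I2) I3)).
have FGE : F * G = K * (1 - q) by rewrite /K mulfVK ?gt_eqF.
rewrite hE FGE; clearbody K.
rewrite (_ : _ + _ = (K + K + K * (1 - q)) * (q / 2) * h `^ theta); last by ring.
rewrite ler_wpM2r ?powR_ge0//.
have : 0 <= K * (1 - q) * (1 - q / 2) by apply: mulr_ge0; [apply: mulr_ge0 => //; exact: ltW|lra].
by lra.
Qed.

(* Additivity is read off the sums: a fine partition of [a, s] followed by a
   dyadic one of [s, r]. *)
Lemma young_estimate (R : realType) (n : nat) (f : R -> 'cV[R]_n) (g : R -> R)
    (a b F G kap gam : R) (I : R -> 'cV[R]_n) (s r : R) :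
    0 <= F -> 0 <= G -> 0 <= kap -> 0 <= gam -> 1 < kap + gam ->
    (forall s r, a <= s <= b -> a <= r <= b -> `|f s - f r| <= F * `|s - r| `^ kap) ->
    (forall s r, a <= s <= b -> a <= r <= b -> `|g s - g r| <= G * `|s - r| `^ gam) ->
    (forall s, a <= s <= b -> RS_integral f g a s (I s)) ->
    a <= s -> s <= r -> r <= b ->
  `|I r - I s - (g r - g s) *: f s| <=
  F * G / (1 - 2 `^ (1 - (kap + gam))) * (r - s) `^ (kap + gam).
Proof.
move=> F0 G0 kap0 gam0 th1 hf hg hI as0; rewrite le_eqVlt => /orP[/eqP <-|sr] rb.
  rewrite !subrr scale0r subr0 normr0 powR0 ?mulr0//.
  by rewrite gt_eqF// (lt_trans _ th1).
have rs0 : 0 < r - s by rewrite subr_gt0.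
apply/ler_addgt0Pr => e e0.
have e2 : 0 < e / 2 by rewrite divr_gt0.
have sI : a <= s <= b by rewrite as0 (le_trans (ltW sr)).
have rI : a <= r <= b by rewrite rb andbT (le_trans as0) ?ltW.
have [d1 d10 h1] := RS_integral_left (hI s sI) e2.
have [d2 d20 h2] := RS_integral_left (hI r rI) e2.
have dm : 0 < Num.min d1 d2 by rewrite lt_min d10.
have [p pp ps] := dyadic_part_ex dm as0.
have [k hk] := pow2_div_lt (r - s) d20.
have {}h1 : `|left_sum f g a p - I s| < e / 2.
  by apply: h1 => //; apply: mesh_ltS pp; rewrite ge_min lexx.
have {}h2 : `|left_sum f g a (p ++ dyadic_part s (r - s) k) - I r| < e / 2.
  apply: h2; last by rewrite last_cat last_dyadic_part addrC subrK.
  rewrite cat_path ps path_dyadic_part// andbT.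
  by apply: mesh_ltS pp; rewrite ge_min lexx orbT.
rewrite left_sum_cat ps in h2.
have := @dyadic_sum_bound _ _ f g a b F G kap gam k s (r - s) F0 G0 kap0 gam0 th1 hf hg as0 rs0.
rewrite [s + _]addrC subrK => /(_ rb) h3.
set S1 := left_sum f g a p in h1 h2; set S2 := left_sum f g s _ in h2 h3.
have -> : I r - I s - (g r - g s) *: f s =
  (S1 - I s) + (S2 - (g r - g s) *: f s) - (S1 + S2 - I r).
  by apply/matrixP => i j; rewrite !mxE; ring.
apply: (le_trans (ler_normB _ _)); apply: (le_trans (lerD (ler_normD _ _) (lexx _))).
lra.
Qed.

(** Uniqueness and existence in one: the errors over a partition add up to at most a constant times
    mesh^(theta - 1) (b - a), which tends to 0 because theta > 1. Moving a tag away from the left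
    end point costs an error of the same order. *)
Lemma RS_integral_of_germ (R : realType) (n : nat) (f : R -> 'cV[R]_n) (g : R -> R)
    (a b F G C kap gam : R) (I : R -> 'cV[R]_n) :
    0 <= F -> 0 <= G -> 0 <= C -> 0 <= kap -> 0 <= gam -> 1 < kap + gam -> a <= b ->
    (forall s r, a <= s <= b -> a <= r <= b -> `|f s - f r| <= F * `|s - r| `^ kap) ->
    (forall s r, a <= s <= b -> a <= r <= b -> `|g s - g r| <= G * `|s - r| `^ gam) ->
    (forall s r, a <= s -> s <= r -> r <= b ->
      `|I r - I s - (g r - g s) *: f s| <= C * (r - s) `^ (kap + gam)) ->
  RS_integral f g a b (I b - I a).
Proof.
move=> F0 G0 C0 kap0 gam0; set theta := kap + gam => th1 ab hf hg hI e e0.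
have t0 : 0 < theta - 1 by rewrite subr_gt0.
pose N : R := (n * 1)%:R.
pose K := N * ((F * G + C) * (b - a)) + 1.
have N0 : 0 <= N by exact: ler0n.
have FG0 : 0 <= F * G by rewrite mulr_ge0.
have K0 : 0 < K.
  rewrite /K ltr_wpDl// mulr_ge0// mulr_ge0 ?subr_ge0// addr_ge0//.
have eK : 0 < e / K by rewrite divr_gt0.
(* The mesh for which mesh^(theta - 1) = e / K. The factor N in K pays for the passage to [enorm];
   the summand 1 keeps K positive and the final inequality strict. *)
exists ((e / K) `^ ((theta - 1)^-1)); first exact: powR_gt0.
set dl := _ `^ _; have dl0 : 0 < dl by exact: powR_gt0.
have dlE : dl `^ (theta - 1) = e / K.
  by rewrite /dl -powRrM mulVf ?gt_eqF// powRr1// ltW.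
(* The left end point is generalised to c so that the induction can peel off the first interval. *)
have main (p : seq R) : forall c xi, a <= c -> path <%R c p -> last c p <= b ->
   (forall i, (i < size p)%N ->
     nth c (c :: p) i <= xi i <= nth c p i /\ nth c p i - nth c (c :: p) i < dl) ->
   c <= last c p /\ `|RS_sum f g c p xi - (I (last c p) - I c)|
     <= (F * G + C) * (e / K) * (last c p - c).
  elim: p => [|x p IH] c xi ac /=.
    by rewrite /RS_sum big_ord0 !subrr normr0 mulr0.
  move=> /andP[cx xp] lb hx.
  have /= [/andP[cxi xix] xcd] := hx 0%N isT.
  have [] := IH x (fun i => xi i.+1) (ltW (le_lt_trans ac cx)) xp lb.
    move=> i ip; have /= := hx i.+1 ip.
    have e1 : nth c p i = nth x p i by apply: set_nth_default.
    have e2 : nth c (x :: p) i = nth x (x :: p) i.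
      by apply: set_nth_default; rewrite /= ltnS ltnW.
    by rewrite e1 e2.
  move=> xl IHp; split; first exact: ltW (lt_le_trans cx xl).
  have cb : x <= b := le_trans xl lb.
  have ax : a <= x := ltW (le_lt_trans ac cx).
  rewrite RS_sum_cons; set S := RS_sum _ _ _ _ _ in IHp *.
  have -> : (g x - g c) *: f (xi 0%N) + S - (I (last x p) - I c) =
     (g x - g c) *: (f (xi 0%N) - f c) - (I x - I c - (g x - g c) *: f c)
     + (S - (I (last x p) - I x)).
    by apply/matrixP => i j; rewrite !mxE; ring.
  have xc0 : 0 < x - c by rewrite subr_gt0.
  have J1 : `|(g x - g c) *: (f (xi 0%N) - f c)| <= F * G * (x - c) `^ theta.
    rewrite mx_normZ mulrC powRD; last by rewrite (gt_eqF xc0) implybT.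
    rewrite mulrACA ler_pM//.
      apply: (le_trans (hf _ _ _ _)); rewrite ?ac ?(le_trans ac cxi)
        ?(le_trans xix cb) ?(le_trans (ltW cx) cb)//.
      rewrite ler_wpM2l// ge0_ler_powR ?nnegrE ?(ltW xc0)//.
      by rewrite ger0_norm ?subr_ge0// lerB.
    apply: (le_trans (hg _ _ _ _)); rewrite ?ax ?cb ?ac ?(le_trans (ltW cx) cb)//.
    by rewrite gtr0_norm.
  have J2 := hI c x ac (ltW cx) cb.
  have J3 : (x - c) `^ theta <= e / K * (x - c).
    rewrite powR_gt1_split ?(ltW xc0)// ler_wpM2r ?(ltW xc0)// -dlE.
    by rewrite ge0_ler_powR ?nnegrE ?(ltW xc0) ?(ltW t0) ?(ltW dl0) ?(ltW xcd).
  apply: (le_trans (ler_normD _ _)); apply: (le_trans (lerD (ler_normB _ _) IHp)).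
  apply: (le_trans (lerD (lerD J1 J2) (lexx _))).
  rewrite -mulrDl.
  apply: (le_trans (lerD (ler_wpM2l (addr_ge0 FG0 C0) J3) (lexx _))).
  by rewrite le_eqVlt; apply/orP; left; apply/eqP; ring.
move=> p xi [pp /eqP pb] hp.
have [|_ h] := main p a xi (lexx _) pp _ hp; first by rewrite pb.
apply: (le_lt_trans (enorm_le_mx_norm _)).
rewrite pb in h; apply: (le_lt_trans (ler_wpM2l N0 h)).
have -> : N * ((F * G + C) * (e / K) * (b - a)) = (K - 1) / K * e.
  by rewrite /K addrK; ring.
rewrite gtr_pMl// ltr_pdivrMr// mul1r; lra.
Qed.

Lemma holder_within_continuous (R : realType) (f : R -> R) (a b F kap : R) :
    0 < kap ->
    (forall s r, a <= s <= b -> a <= r <= b -> `|f s - f r| <= F * `|s - r| `^ kap) ->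
  {within `[a, b], continuous f}.
Proof.
move=> k0 hf; apply/subspace_continuousP => x /=; rewrite in_itv/= => xab.
apply/cvgrPdist_le => e e0; rewrite near_withinE.
pose F1 := `|F| + 1; have F10 : 0 < F1 by rewrite ltr_wpDl.
have d0 : 0 < (e / F1) `^ kap^-1 by rewrite powR_gt0 ?divr_gt0.
apply/nbhs_ballP; exists ((e / F1) `^ kap^-1) => //= y xy.
rewrite in_itv/= => yab; apply: (le_trans (hf _ _ xab yab)).
have h : `|x - y| `^ kap <= e / F1.
  have -> : e / F1 = ((e / F1) `^ kap^-1) `^ kap.
    by rewrite -powRrM mulVf ?gt_eqF// powRr1// ltW// divr_gt0.
  by rewrite ge0_ler_powR ?nnegrE ?(ltW k0) ?(ltW d0) ?(ltW xy).
have p0 := powR_ge0 `|x - y| kap.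
apply: (@le_trans _ _ (F1 * `|x - y| `^ kap)).
  by rewrite ler_wpM2r// /F1; have := ler_norm F; lra.
by rewrite mulrC -ler_pdivlMr.
Qed.

Lemma Rintegral_holder_germ (R : realType) (f : R -> R) (a b F kap s r : R) :
    0 <= F -> 0 < kap -> a <= s -> s <= r -> r <= b ->
    (forall s r, a <= s <= b -> a <= r <= b -> `|f s - f r| <= F * `|s - r| `^ kap) ->
  `|\int[lebesgue_measure]_(x in `[a, r]) f x
    - \int[lebesgue_measure]_(x in `[a, s]) f x - (r - s) * f s|
  <= F * (r - s) `^ (1 + kap).
Proof.
move=> F0 k0 as0 sr rb hf; set mu := lebesgue_measure.
have intA : mu.-integrable `[a, r] (EFin \o f).
  apply: continuous_compact_integrable; first exact: segment_compact.
  apply: (@holder_within_continuous _ _ _ _ F kap) => // x y /andP[x1 x2] /andP[y1 y2].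
  by apply: hf; rewrite ?x1 ?y1 (le_trans _ rb).
rewrite Rintegral_itvB ?bnd_simp//.
have intB : mu.-integrable `]s, r] (EFin \o f).
  apply: integrableS intA => //; apply: subset_itvr; rewrite bnd_simp//.
have intc (c : R) : mu.-integrable `]s, r] (EFin \o cst c).
  apply: (@integrableS _ _ _ mu `[s, r]) => //.
    by apply: subset_itvr; rewrite bnd_simp.
  apply: continuous_compact_integrable; first exact: segment_compact.
  by apply: continuous_subspaceT => x; exact: cvg_cst.
have muE : fine (mu `]s, r]%classic) = r - s.
  rewrite /mu lebesgue_measure_itv/= lte_fin; case: ltP => // rs.
  by have -> : r = s by [apply/eqP; rewrite eq_le sr rs]; rewrite subrr.
have E : (r - s) * f s = \int[mu]_(x in `]s, r]) f s.
  by rewrite Rintegral_cst// muE mulrC.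
have intBc : mu.-integrable `]s, r] (EFin \o (fun x => f x - f s)).
  exact: (eq_integrable _ _ _ _ (integrableB _ intB (intc (f s)))).
rewrite E -RintegralB//; last exact: intc.
apply: (le_trans (le_normr_Rintegral _ intBc)) => //.
apply: (@le_trans _ _ (\int[mu]_(x in `]s, r]) (F * (r - s) `^ kap))).
  apply: le_Rintegral => //.
  - exact: integrable_norm intBc.
  - exact: intc.
  move=> x /=; rewrite in_itv/= => /andP[sx xr].
  apply: (le_trans (hf _ _ _ _)).
  - by rewrite (le_trans as0 (ltW sx)) (le_trans xr rb).
  - by rewrite as0 (le_trans sr rb).
  rewrite ler_wpM2l// ge0_ler_powR ?nnegrE ?(ltW k0) ?subr_ge0//.
  by rewrite gtr0_norm ?subr_gt0// lerB.
rewrite Rintegral_cst// muE -mulrA powRD; last by rewrite gt_eqF// addr_gt0.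
by rewrite powRr1 ?subr_ge0// [X in F * X]mulrC.
Qed.

Lemma vintegral_germ (R : realType) (n : nat) (f : R -> 'cV[R]_n) (a b F kap s r : R) :
    0 <= F -> 0 < kap -> a <= s -> s <= r -> r <= b ->
    (forall s r, a <= s <= b -> a <= r <= b -> `|f s - f r| <= F * `|s - r| `^ kap) ->
  `|vintegral f a r - vintegral f a s - (r - s) *: f s| <= F * (r - s) `^ (1 + kap).
Proof.
move=> F0 k0 as0 sr rb hf; apply: mx_norm_le => [|i j].
  by rewrite mulr_ge0// powR_ge0.
rewrite !mxE ord1; apply: (@Rintegral_holder_germ _ (fun x => f x i 0) a b) => // x y xab yab.
apply: le_trans (hf x y xab yab).
by have := mx_norm_entry (f x - f y) i 0; rewrite !mxE.
Qed.

Lemma vintegral_pt (R : realType) (n : nat) (f : R -> 'cV[R]_n) (a : R) :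
  vintegral f a a = 0.
Proof. by apply/matrixP => i j; rewrite !mxE set_itv1 Rintegral_set1. Qed.

(** * The class H *)

Lemma diff_jac (R : realType) (n m : nat) (f : 'cV[R]_n -> 'cV[R]_m) (x v : 'cV[R]_n) :
  'd f x v = jac f x *m v.
Proof.
rewrite {1}[v]matrix_sum_delta linear_sum; apply/matrixP => i j.
rewrite ord1 !mxE summxE; apply: eq_bigr => k _.
by rewrite big_ord1 linearZ/= !mxE mulrC.
Qed.

Lemma is_derive_line (R : realType) (n p q : nat) (f : 'cV[R]_n -> 'M[R]_(p, q))
    (x v : 'cV[R]_n) (t : R) i j :
  differentiable f (x + t *: v) ->
  is_derive t 1 (fun t : R => f (x + t *: v) i j) ('d f (x + t *: v) v i j).
Proof.
move=> df; have cv : derivable f (x + t *: v) v by exact: diff_derivable.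
pose k : R -> R := fun t => f (x + t *: v) i j.
have cq : (fun h : R => h^-1 *: ((k \o shift t) (h *: 1) - k t)) @ 0^'
    --> 'd f (x + t *: v) v i j.
  rewrite -deriveE// [X in X @ _ --> _](_ : _ = (fun M : 'M[R]_(p, q) => M i j) \o
    (fun h : R => h^-1 *: ((f \o shift (x + t *: v)) (h *: v) - f (x + t *: v)))).
    exact: cvg_comp cv (@coord_continuous _ _ _ i j _).
  apply/funext => h; rewrite /k /= !mxE /shift/=; congr (_ * (f _ i j - _)).
  by rewrite scalerDl addrCA /GRing.scale/= mulr1.
by split; [apply/cvg_ex; eexists; exact: cq|exact: cvg_lim cq].
Qed.

(** The mean value theorem is scalar, so the intermediate point depends on the entry; this is
    harmless for maximum norms. *)
Lemma mean_value_entry (R : realType) (n p q : nat) (f : 'cV[R]_n -> 'M[R]_(p, q))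
    (x v : 'cV[R]_n) i j :
  (forall y, differentiable f y) ->
  exists2 t : R, 0 < t < 1 & f (x + v) i j - f x i j = 'd f (x + t *: v) v i j.
Proof.
move=> df.
have der (t : R) : is_derive t 1 (fun t : R => f (x + t *: v) i j) ('d f (x + t *: v) v i j).
  exact: is_derive_line.
have cont : {within `[0, 1], continuous (fun t : R => f (x + t *: v) i j)}.
  apply: continuous_subspaceT => t; apply: differentiable_continuous.
  by apply/derivable1_diffP; have [] := der t.
have [t] := MVT ltr01 (fun t _ => der t) cont.
rewrite in_itv/= => t01; rewrite scale1r scale0r addr0 subr0 mulr1 => E.
by exists t.
Qed.

Lemma mxBE (R : realType) (m n : nat) (A B : 'M[R]_(m, n)) i j :
  (A - B) i j = A i j - B i j.
Proof. by rewrite !mxE. Qed.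

(** The mean value theorem for [jac phi] gives the Lipschitz bound. Applied to phi itself, it
    expresses the Taylor remainder as (phi'(xi) - phi'(x)) (y - x) entry by entry, which is
    quadratic by that bound. *)
Lemma C2_jac_lipschitz (R : realType) (d m : nat) (phi : 'cV[R]_d -> 'cV[R]_m) :
  C2_bounded_lipschitz phi ->
  exists2 C : R, 0 <= C & (forall x y, `|jac phi x - jac phi y| <= C * `|x - y|) /\
    (forall x y, `|phi y - phi x - jac phi x *m (y - x)| <= C * `|y - x| ^+ 2).
Proof.
move=> [dphi djac _ [C0 hC0] _].
pose C1 : R := `|C0| * (d * 1)%:R.
have C10 : 0 <= C1 by rewrite mulr_ge0.
have lip x y : `|jac phi x - jac phi y| <= C1 * `|x - y|.
  apply: mx_norm_le => [|i j]; first by rewrite mulr_ge0.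
  have [t _] := mean_value_entry y (x - y) i j djac.
  rewrite [y + _]addrC subrK mxBE => ->.
  apply: (le_trans (mx_norm_entry _ _ _)); apply: (le_trans (mx_norm_le_enorm _)).
  apply: (le_trans (hC0 _ _)).
  apply: (@le_trans _ _ (`|C0| * enorm (x - y))).
    by rewrite ler_wpM2r ?ler_norm// enorm_ge0.
  by rewrite -mulrA ler_wpM2l// enorm_le_mx_norm.
pose C := C1 + d%:R * C1.
have dC : 0 <= d%:R * C1 by rewrite mulr_ge0.
exists C; first by rewrite addr_ge0.
split=> x y.
  by apply: (le_trans (lip x y)); rewrite ler_wpM2r// lerDl.
apply: mx_norm_le => [|i j]; first by rewrite mulr_ge0 ?sqr_ge0// addr_ge0.
have [t /andP[t0 t1]] := mean_value_entry x (y - x) i j dphi.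
rewrite [x + (y - x)]addrC subrK diff_jac => E.
have -> : (phi y - phi x - jac phi x *m (y - x)) i j =
    ((jac phi (x + t *: (y - x)) - jac phi x) *m (y - x)) i j.
  by rewrite !mxBE E mulmxBl mxBE.
apply: (le_trans (mx_norm_entry _ _ _)); apply: (le_trans (mx_norm_mulmx _ _)).
rewrite expr2 mulrA ler_wpM2r//.
apply: (le_trans (ler_wpM2l _ (lip _ _))) => //.
rewrite [x + _]addrC addrK mx_normZ gtr0_norm// mulrA.
apply: (@le_trans _ _ (d%:R * C1 * `|y - x|)).
  by rewrite ler_wpM2l// ler_piMl// ltW.
by rewrite ler_wpM2r// lerDr.
Qed.

Lemma trmx_norm (R : realType) (m n : nat) (A : 'M[R]_(m, n)) : `|A^T| = `|A|.
Proof.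
apply/eqP; rewrite eq_le; apply/andP; split; apply: mx_norm_le => // i j.
  by rewrite mxE mx_norm_entry.
by have := mx_norm_entry A^T j i; rewrite mxE.
Qed.

Lemma trmx_continuous (R : realType) (m n : nat) :
  continuous (@trmx R m n : 'M[R]_(m, n) -> 'M[R]_(n, m)).
Proof.
move=> A; apply/(@cvgrPdist_lt _ _ _ _ (nbhs_filter A)) => e e0.
apply/nbhs_ballP; exists e => // B.
by rewrite mx_norm_ball /ball_/= => h; rewrite -linearB/= trmx_norm.
Qed.

Lemma enorm_continuous (R : realType) (m n : nat) : continuous (@enorm R m n).
Proof.
have cs : continuous (fun A : 'M[R]_(m, n) => \sum_i \sum_j A i j ^+ 2).
  apply: continuous_big => [|i _]; first exact: add_continuous.
  apply: continuous_big => [|j _]; first exact: add_continuous.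
  move=> A; apply: (@continuous_comp _ _ _ (fun A : 'M[R]_(m, n) => A i j) (fun x => x ^+ 2)).
    exact: coord_continuous.
  exact: exprn_continuous.
by move=> A; apply: continuous_comp; [exact: cs|exact: sqrt_continuous].
Qed.

(** [bounded_closed_compact] concerns row vectors, hence the detour by transposition. *)
Lemma annulus_compact (R : realType) (d : nat) (a b : R) : compact (annulus a b : set 'cV[R]_d).
Proof.
pose A : set 'rV[R]_d := (@trmx R 1 d) @^-1` annulus a b.
have cA : closed A.
  have -> : A = (fun v => enorm v^T) @^-1` `[a, b].
    by apply/seteqP; split => v /=; rewrite in_itv.
  apply: closed_comp; last exact: interval_closed.
  move=> v _; apply: continuous_comp; first exact: trmx_continuous.
  exact: enorm_continuous.
have bA : bounded_set A.
  exists b; split; first exact: num_real.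
  move=> M bM v /andP[_ vb]; rewrite /= -trmx_norm.
  by rewrite (le_trans (mx_norm_le_enorm _))// (le_trans vb)// ltW.
have -> : annulus a b = (@trmx R 1 d) @` A.
  apply/seteqP; split => [x ax|_ [v Av <-]//].
  by exists x^T; rewrite ?trmxK// /A /= trmxK.
apply: continuous_compact; last exact: bounded_closed_compact.
by apply: continuous_subspaceT; exact: trmx_continuous.
Qed.

(** The class bounds only the derivative of phi'(x)^+. A bound on phi'(x)^+ itself, uniform in x and
    therefore admissible in the new bounds, comes from continuity on the compact annulus. *)
Lemma calH_right_inverse (R : realType) (d m : nat) (phi : 'cV[R]_d -> 'cV[R]_m) (a b : R) :
  calH phi a b ->
  exists (psi : 'cV[R]_d -> 'M[R]_(d, m)) (C : R), forall x, annulus a b x ->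
    jac phi x *m psi x = 1%:M /\ `|psi x| <= C.
Proof.
move=> [_ _ [M [L [psi [dpsi [[M0 _] inv dif bnd _]]]]]].
pose K : R := (M + 1) * (d * 1)%:R + 1.
have M1 : 0 <= M + 1 by rewrite addr_ge0// ltW.
have K0 : 0 < K by rewrite ltr_wpDl// mulr_ge0.
have cpsi : {within annulus a b, continuous psi}.
  apply/subspace_continuousP => x ax; apply/cvgrPdist_le => e e0.
  have := dif x ax 1 ltr01; rewrite !near_withinE.
  have : \forall y \near x, `|x - y| < e / K.
    by apply/nbhs_ballP; exists (e / K) => /=; [rewrite divr_gt0|rewrite mx_norm_ball].
  apply: filterS2 => y xy h ay; have {}h := h ay.
  rewrite distrC; have -> : psi y - psi x =
     (psi y - psi x - dpsi x (y - x)) + dpsi x (y - x) by rewrite subrK.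
  apply: (le_trans (ler_normD _ _)).
  have h1 := le_trans (mx_norm_le_enorm _) h.
  have h2 := le_trans (mx_norm_le_enorm _) (bnd x (y - x) ax).
  apply: (le_trans (lerD h1 h2)); rewrite -mulrDl addrC.
  apply: (le_trans (ler_wpM2l M1 (enorm_le_mx_norm _))); rewrite mulrA distrC.
  apply: (@le_trans _ _ (K * `|x - y|)); first by rewrite ler_wpM2r// lerDl.
  by rewrite mulrC -ler_pdivlMr// ltW.
have /compact_bounded [N [_ hN]] := continuous_compact cpsi (@annulus_compact R d a b).
exists psi, (N + 1) => x ax; split; first exact: inv.
by apply: (hN (N + 1)); [rewrite ltrDl|exists x].
Qed.

(** * Germs of paths *)

Lemma powR_le01 (R : realType) (x p q : R) :
  0 <= x <= 1 -> 0 < p -> p <= q -> x `^ q <= x `^ p.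
Proof.
move=> /andP[]; rewrite le_eqVlt => /orP[/eqP <- _ p0 pq|x0 x1 _ pq].
  by rewrite !powR0 ?gt_eqF// (lt_le_trans p0).
by rewrite ger_powR// x0.
Qed.

Definition holder_on (R : realType) (V : normedZmodType R) (f : R -> V) (a b F kap : R) :=
  forall s r, a <= s <= b -> a <= r <= b -> `|f s - f r| <= F * `|s - r| `^ kap.

(* The increments of Z over [s, r] are f0 s dr + f1 s dg up to C (r - s)^theta;
   for theta > 1 this is the infinitesimal form of Z = Z_t + int f0 dr + int f1 dg. *)
Definition germ (R : realType) (n : nat) (g : R -> R) (t e theta C : R)
    (f0 f1 Z : R -> 'cV[R]_n) :=
  forall s r, t <= s -> s <= r -> r <= e ->
    `|Z r - Z s - ((r - s) *: f0 s + (g r - g s) *: f1 s)| <= C * (r - s) `^ theta.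

(** On an interval of length at most 1 an exponent may be lowered without changing the constant;
    this is why horizons are kept below 1. *)
Lemma holder_on_le (R : realType) (V : normedZmodType R) (f : R -> V) (a b F F' kap kap' : R) :
  0 <= F' -> F <= F' -> 0 < kap' -> kap' <= kap -> b <= a + 1 ->
  holder_on f a b F kap -> holder_on f a b F' kap'.
Proof.
move=> F0 FF k0 kk ba hf s r sI rI; apply: (le_trans (hf s r sI rI)).
apply: (@le_trans _ _ (F' * `|s - r| `^ kap)); first by rewrite ler_wpM2r// powR_ge0.
rewrite ler_wpM2l// powR_le01// normr_ge0/= ler_norml.
by move: sI rI => /andP[s1 s2] /andP[r1 r2]; lra.
Qed.

Lemma holder_on_bound (R : realType) (V : normedZmodType R) (f : R -> V) (a b F kap s : R) :
  0 <= F -> 0 < kap -> b <= a + 1 -> holder_on f a b F kap -> a <= s <= b -> f a = 0 ->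
  `|f s| <= F.
Proof.
move=> F0 k0 ba hf sI fa; have /andP[s1 s2] := sI.
have := hf s a sI; rewrite lexx (le_trans s1 s2) fa subr0 => /(_ isT) /le_trans; apply.
have e1 : 1 `^ kap = 1 :> R by rewrite powR1.
rewrite ler_piMr// -[leRHS]e1 ge0_ler_powR ?nnegrE ?(ltW k0)//.
by rewrite ger0_norm; lra.
Qed.

Lemma RS_integral_pt (R : realType) (n : nat) (f : R -> 'cV[R]_n) (g : R -> R)
    (a : R) (I : 'cV[R]_n) : RS_integral f g a a I -> I = 0.
Proof.
move=> h; apply/eqP; rewrite -normr_le0; apply/ler_addgt0Pr => e e0; rewrite add0r.
have [dl dl0 hdl] := RS_integral_left h e0.
by have := hdl [::] isT erefl; rewrite /= sub0r normrN => /ltW.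
Qed.

(** The Lebesgue part has the error exponent 1 + gam, which exceeds kap + gam and is absorbed on an
    interval of length at most 1; the Young part is [young_estimate]. *)
Lemma germ_of_integral (R : realType) (n : nat) (g : R -> R) (t e gam kap D Dt : R)
    (f0 f1 I : R -> 'cV[R]_n) (z0 : 'cV[R]_n) :
    0 <= D -> 0 <= Dt -> 0 < kap -> kap <= gam -> gam < 1 -> 1 < kap + gam -> e <= t + 1 ->
    holder_on g t e 1 gam -> holder_on f0 t e D gam -> holder_on f1 t e Dt kap ->
    (forall s, t <= s <= e -> RS_integral f1 g t s (I s)) ->
  germ g t e (kap + gam) (D + Dt / (1 - 2 `^ (1 - (kap + gam)))) f0 f1
    (fun s => z0 + vintegral f0 t s + I s).
Proof.
move=> D0 Dt0 k0 kg g1 th1 et hg h0 h1 hI s r ts sr re.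
have gam0 : 0 < gam := lt_le_trans k0 kg.
have V := vintegral_germ D0 gam0 ts sr re h0.
have Y := young_estimate Dt0 ler01 (ltW k0) (ltW gam0) th1 h1 hg hI ts sr re.
rewrite mulr1 in Y.
have -> : z0 + vintegral f0 t r + I r - (z0 + vintegral f0 t s + I s) -
   ((r - s) *: f0 s + (g r - g s) *: f1 s) =
   (vintegral f0 t r - vintegral f0 t s - (r - s) *: f0 s)
   + (I r - I s - (g r - g s) *: f1 s).
  by apply/matrixP => i j; rewrite !mxE; ring.
apply: (le_trans (ler_normD _ _)); rewrite mulrDl; apply: lerD => //.
apply: (le_trans V); rewrite ler_wpM2l// powR_le01//; try lra.
Qed.

(** Once its Lebesgue integral is subtracted, Z has the increments f1 dg up to order theta, so
    [RS_integral_of_germ] identifies what is left as the integral. *)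
Lemma integral_of_germ (R : realType) (n : nat) (g : R -> R) (t e gam kap F0 F1 C : R)
    (f0 f1 Z : R -> 'cV[R]_n) (s : R) :
    0 <= F0 -> 0 <= F1 -> 0 <= C ->
    0 < kap -> kap <= gam -> gam < 1 -> 1 < kap + gam -> e <= t + 1 ->
    holder_on g t e 1 gam -> holder_on f0 t e F0 gam -> holder_on f1 t e F1 kap ->
    germ g t e (kap + gam) C f0 f1 Z -> t <= s <= e ->
  RS_integral f1 g t s (Z s - Z t - vintegral f0 t s).
Proof.
move=> F00 F10 C0 k0 kg g1 th1 et hg h0 h1 hZ /andP[ts se].
have gam0 : 0 < gam := lt_le_trans k0 kg.
have sub x : t <= x <= s -> t <= x <= e by move=> /andP[-> /le_trans ->].
have := @RS_integral_of_germ _ _ f1 g t s F1 1 (C + F0) kap gam (fun s => Z s - vintegral f0 t s).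
rewrite vintegral_pt subr0.
have -> : Z s - vintegral f0 t s - Z t = Z s - Z t - vintegral f0 t s.
  by rewrite addrAC.
apply=> //.
- exact: addr_ge0.
- exact: ltW.
- exact: ltW.
- by move=> x y xI yI; apply: h1; apply: sub.
- by move=> x y xI yI; apply: hg; apply: sub.
move=> x y tx xy ys.
have V := vintegral_germ F00 gam0 tx xy (le_trans ys se) h0.
have Y := hZ x y tx xy (le_trans ys se).
have -> : Z y - vintegral f0 t y - (Z x - vintegral f0 t x) - (g y - g x) *: f1 x =
   (Z y - Z x - ((y - x) *: f0 x + (g y - g x) *: f1 x))
   - (vintegral f0 t y - vintegral f0 t x - (y - x) *: f0 x).
  by apply/matrixP => i j; rewrite !mxE; ring.
apply: (le_trans (ler_normB _ _)); rewrite mulrDl; apply: lerD => //.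
apply: (le_trans V); rewrite ler_wpM2l// powR_le01//; try lra.
Qed.

Lemma holder_of_increments (R : realType) (V : normedZmodType R) (f : R -> V) (a b F kap : R) :
  (forall s r, a <= s -> s <= r -> r <= b -> `|f r - f s| <= F * (r - s) `^ kap) ->
  holder_on f a b F kap.
Proof.
move=> h s r /andP[as_ sb] /andP[ar rb]; have [sr|/ltW rs] := leP s r.
  by rewrite distrC [`|s - r|]distrC [`|r - s|]ger0_norm ?subr_ge0// h.
by rewrite [`|s - r|]ger0_norm ?subr_ge0// h.
Qed.

Lemma germ_holder (R : realType) (n : nat) (g : R -> R) (t e gam kap B0 B1 C : R)
    (f0 f1 Z : R -> 'cV[R]_n) :
    0 <= B0 -> 0 <= B1 -> 0 <= C ->
    0 < kap -> kap <= gam -> gam < 1 -> e <= t + 1 ->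
    holder_on g t e 1 gam -> (forall s, t <= s <= e -> `|f0 s| <= B0) ->
    (forall s, t <= s <= e -> `|f1 s| <= B1) ->
    germ g t e (kap + gam) C f0 f1 Z ->
  holder_on Z t e (B0 + B1 + C) gam.
Proof.
move=> B00 B10 C0 k0 kg g1 et hg h0 h1 hZ; apply: holder_of_increments => s r ts sr re.
have sI : t <= s <= e by rewrite ts (le_trans sr).
have rI : t <= r <= e by rewrite re (le_trans ts).
have rs0 : 0 <= r - s by rewrite subr_ge0.
have p x : gam <= x -> (r - s) `^ x <= (r - s) `^ gam.
  by move=> gx; apply: powR_le01 => //; lra.
have -> : Z r - Z s = (Z r - Z s - ((r - s) *: f0 s + (g r - g s) *: f1 s))
   + ((r - s) *: f0 s + (g r - g s) *: f1 s) by rewrite subrK.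
apply: (le_trans (ler_normD _ _)).
apply: (le_trans (lerD (hZ s r ts sr re) (ler_normD _ _))).
rewrite !mx_normZ (ger0_norm rs0) [leRHS]mulrDl [X in _ <= X + _]mulrDl addrC; apply: lerD.
  apply: lerD; rewrite mulrC.
    rewrite ler_pM ?h0//; have := p 1 (ltW g1).
    by rewrite powRr1.
  rewrite ler_pM ?h1//; have := hg r s rI sI.
  by rewrite mul1r (ger0_norm rs0).
by rewrite ler_wpM2l// p//; lra.
Qed.

(** Z is gam-Hölder, so the quadratic Taylor remainder is of order (r - s)^(2 gam), and 2 gam >= kap
    + gam: no second-order correction appears. *)
Lemma chain_rule_germ (R : realType) (d m : nat) (g : R -> R) (t e gam kap C Lz J Cphi : R)
    (phi : 'cV[R]_d -> 'cV[R]_m) (jf : 'cV[R]_d -> 'M[R]_(m, d)) (f0 f1 Z : R -> 'cV[R]_d) :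
    0 <= C -> 0 <= Lz -> 0 <= Cphi -> 0 <= J -> 0 < kap -> kap <= gam -> gam < 1 -> e <= t + 1 ->
    (forall x y, `|phi y - phi x - jf x *m (y - x)| <= Cphi * `|y - x| ^+ 2) ->
    (forall s, t <= s <= e -> `|jf (Z s)| <= J) ->
    holder_on Z t e Lz gam -> germ g t e (kap + gam) C f0 f1 Z ->
  germ g t e (kap + gam) (Cphi * Lz ^+ 2 + d%:R * J * C)
    (fun s => jf (Z s) *m f0 s) (fun s => jf (Z s) *m f1 s) (fun s => phi (Z s)).
Proof.
move=> C0 L0 Cp0 J0 k0 kg g1 et tay hJ hZ gZ s r ts sr re.
have sI : t <= s <= e by rewrite ts (le_trans sr).
have rI : t <= r <= e by rewrite re (le_trans ts).
have rs0 : 0 <= r - s by rewrite subr_ge0.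
have -> : phi (Z r) - phi (Z s) - ((r - s) *: (jf (Z s) *m f0 s) +
    (g r - g s) *: (jf (Z s) *m f1 s)) =
  (phi (Z r) - phi (Z s) - jf (Z s) *m (Z r - Z s)) +
  jf (Z s) *m (Z r - Z s - ((r - s) *: f0 s + (g r - g s) *: f1 s)).
  by rewrite !scalemxAr -mulmxDr [X in _ = _ + X]mulmxBr addrA subrK.
apply: (le_trans (ler_normD _ _)); rewrite mulrDl; apply: lerD.
  apply: (le_trans (tay _ _)); rewrite -mulrA ler_wpM2l//.
  have h := hZ r s rI sI; rewrite (ger0_norm rs0) in h.
  apply: (@le_trans _ _ ((Lz * (r - s) `^ gam) ^+ 2)).
    by rewrite lerXn2r ?nnegrE// mulr_ge0// powR_ge0.
  rewrite exprMn ler_wpM2l ?sqr_ge0// -powR_mulrn ?powR_ge0// -powRrM powR_le01//; try lra.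
apply: (le_trans (mx_norm_mulmx _ _)); rewrite -!mulrA ler_wpM2l//.
by rewrite ler_pM// ?hJ// gZ.
Qed.

Lemma holder_mulmx (R : realType) (m n : nat) (t e kap F1 F2 B1 B2 : R)
    (A : R -> 'M[R]_(m, n)) (f : R -> 'cV[R]_n) :
    0 <= B1 -> 0 <= F1 ->
    holder_on A t e F1 kap -> holder_on f t e F2 kap ->
    (forall s, t <= s <= e -> `|A s| <= B1) -> (forall s, t <= s <= e -> `|f s| <= B2) ->
  holder_on (fun s => A s *m f s) t e (n%:R * (F1 * B2 + B1 * F2)) kap.
Proof.
move=> B10 F10 hA hf bA bf s r sI rI.
have -> : A s *m f s - A r *m f r = (A s - A r) *m f s + A r *m (f s - f r).
  by rewrite mulmxBl mulmxBr addrA subrK.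
apply: (le_trans (ler_normD _ _)).
apply: (le_trans (lerD (mx_norm_mulmx _ _) (mx_norm_mulmx _ _))).
rewrite -!mulrA -mulrDr ler_wpM2l// mulrDl; apply: lerD.
  by rewrite mulrAC ler_pM ?bf ?hA.
by rewrite -mulrA ler_pM ?bA ?hf.
Qed.

Lemma holder_comp (R : realType) (V W : normedZmodType R) (F : V -> W) (f : R -> V)
   (a b L C kap : R) : 0 <= C ->
   (forall x y, `|F x - F y| <= C * `|x - y|) -> holder_on f a b L kap ->
   holder_on (fun s => F (f s)) a b (C * L) kap.
Proof.
move=> C0 hF hf s r sI rI; apply: (le_trans (hF _ _)).
by rewrite -mulrA ler_wpM2l// hf.
Qed.

(** * Simplified Newton iteration *)

(** Banach's fixed point theorem on a ball, stated for the iterates from 0, because their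
    convergence is what later yields measurability. *)
Lemma iter_contraction_cvg (R : realType) (m : nat) (T : 'cV[R]_m -> 'cV[R]_m) (r : R) :
    0 <= r -> `|T 0| <= r / 2 ->
    (forall a b, `|a| <= r -> `|b| <= r -> `|T a - T b| <= `|a - b| / 2) ->
  exists c, [/\ (fun k => iter k T 0) @ \oo --> c, `|c| <= r & T c = c].
Proof.
move=> r0 T0 hT; pose c k := iter k T 0.
have cS k : c k.+1 = T (c k) by [].
have cr k : `|c k| <= r.
  elim: k => [|k IH]; first by rewrite /c/= normr0.
  rewrite cS -[T (c k)](subrK (T 0)) (le_trans (ler_normD _ _))//.
  have := hT (c k) 0 IH; rewrite normr0 subr0 => /(_ r0) h; lra.
have cd k i : `|c (k + i)%N - c k| <= r / 2 ^+ k.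
  elim: k => [|k IH]; first by rewrite add0n {2}/c/= subr0 expr0 divr1.
  rewrite addSn !cS (le_trans (hT _ _ (cr _) (cr _)))//.
  by rewrite exprSr invfM mulrA ler_wpM2r.
have /cauchy_cvgP/cvg_ex[l cl] : cauchy (c @ \oo).
  apply: cauchy_exP => e /(pow2_div_lt r)[k hk]; exists (c k); exists k => // n /= kn.
  rewrite mx_norm_ball /ball_ /= distrC -(subnKC kn).
  exact: le_lt_trans (cd _ _) hk.
exists l; split => //.
  apply/ler_addgt0Pr => e e0.
  have /cvgrPdist_le/(_ e e0)[k _ hk] := cl.
  have := hk k (leqnn k); have := ler_normD (l - c k) (c k); rewrite subrK.
  have := cr k; lra.
have lr : `|l| <= r.
  apply/ler_addgt0Pr => e e0.
  have /cvgrPdist_le/(_ e e0)[k _ hk] := cl.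
  have := hk k (leqnn k); have := ler_normD (l - c k) (c k); rewrite subrK.
  have := cr k; lra.
apply/eqP; rewrite -subr_eq0 -normr_le0; apply/ler_addgt0Pr => e e0; rewrite add0r.
have e2 : 0 < e / 2 by rewrite divr_gt0.
have /cvgrPdist_le/(_ _ e2)[k _ hk] := cl.
have h1 := hk k (leqnn k); have h2 := hk k.+1 (leqnSn k).
have h3 := hT _ _ lr (cr k).
have -> : T l - l = (T l - T (c k)) - (l - c k.+1) by rewrite cS opprB addrA subrK.
apply: (le_trans (ler_normB _ _)); move: h1 h2 h3 => /=; lra.
Qed.

(** The bound makes A injective, so every column of the transposed kernel of A^T vanishes. *)
Lemma unitmx_of_lower_bound (R : realType) (m : nat) (A : 'M[R]_m) (K : R) :
  (forall c : 'cV[R]_m, `|c| <= K * `|A *m c|) -> A \in unitmx.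
Proof.
move=> h; rewrite -unitmx_tr -row_free_unit -kermx_eq0; apply/eqP.
have E : A *m (kermx A^T)^T = 0.
  by apply: trmx_inj; rewrite trmx_mul trmxK mulmx_ker trmx0.
apply: trmx_inj; rewrite trmx0; apply/matrixP => i j.
have : A *m col j (kermx A^T)^T = 0 by rewrite colE mulmxA E mul0mx.
move=> E1; have := h (col j (kermx A^T)^T); rewrite E1 normr0 mulr0 normr_le0.
by move=> /eqP/matrixP/(_ i 0); rewrite !mxE.
Qed.

(** As phi'(x) P = 1, the derivative in c frozen at x is the identity, so the simplified Newton step
    involves no inverse matrix. *)
Definition newton_step (R : realType) (d m : nat) (phi : 'cV[R]_d -> 'cV[R]_m)
    (P : 'M[R]_(d, m)) (z : 'cV[R]_d) (y : 'cV[R]_m) (c : 'cV[R]_m) : 'cV[R]_m :=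
  c - (phi (z + P *m c) - y).

(* P being a right inverse of phi'(x), the equation phi (z + P c) = y is solved
   for c by the simplified Newton iteration when z is near x and y near phi(x). *)
Lemma local_right_inverse (R : realType) (d m : nat) (phi : 'cV[R]_d -> 'cV[R]_m)
    (jf : 'cV[R]_d -> 'M[R]_(m, d))
    (P : 'M[R]_(d, m)) (x : 'cV[R]_d) (Cphi : R) :
    0 <= Cphi -> jf x *m P = 1%:M ->
    (forall x y, `|jf x - jf y| <= Cphi * `|x - y|) ->
    (forall x y, `|phi y - phi x - jf x *m (y - x)| <= Cphi * `|y - x| ^+ 2) ->
  exists (r0 r1 : R) (cc : 'cV[R]_d -> 'cV[R]_m -> 'cV[R]_m), 0 < r1 /\
    [/\ forall z y, `|z - x| <= r1 -> `|y - phi x| <= r1 ->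
          [/\ (fun k => iter k (newton_step phi P z y) 0) @ \oo --> cc z y,
              phi (z + P *m cc z y) = y & `|z + P *m cc z y - x| <= r0],
        forall z1 y1 z2 y2, `|z1 - x| <= r1 -> `|y1 - phi x| <= r1 ->
          `|z2 - x| <= r1 -> `|y2 - phi x| <= r1 ->
          `|cc z1 y1 - cc z2 y2| <=
            2 * (`|y1 - y2| + (d%:R * `|jf x| + 1) * `|z1 - z2|),
        cc x (phi x) = 0
      & forall X (c : 'cV[R]_m), `|X - x| <= r0 -> `|c| <= 2 * `|jf X *m P *m c| ].
Proof.
move=> C0 JP lip tay; set J := jf x.
set p := m%:R * `|P|; have p0 : 0 <= p by rewrite mulr_ge0.
set j := d%:R * `|J|; have j0 : 0 <= j by rewrite mulr_ge0.
(* Admissible deviation of phi from its linearisation at x: q p <= 1/2 makes the Newton map halve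
   distances. *)
pose q := (2 * (p + 1))^-1.
have q0 : 0 < q by rewrite invr_gt0; lra.
have qE : q * (2 * (p + 1)) = 1 by rewrite /q mulVf//; apply: lt0r_neq0; lra.
have qp : q * p <= 2^-1 by lra.
have q1 : q <= 1 by have := mulr_ge0 (ltW q0) p0; lra.
have d2 : 0 < (d%:R + 2) * (Cphi + 1).
  by apply: mulr_gt0; [rewrite ltr_wpDl|lra].
(* On this ball the nonlinear part of phi is q-Lipschitz, as (2 + d) Cphi r0 <= q (see [near]
   below). *)
pose r0 := q / ((d%:R + 2) * (Cphi + 1)).
have r00 : 0 < r0 by rewrite divr_gt0.
have r0E : (d%:R + 2) * Cphi * r0 <= q.
  rewrite /r0 mulrCA ler_piMr ?(ltW q0)// ler_pdivrMr// mul1r.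
  by rewrite ler_wpM2l ?addr_ge0// lerDl.
have d0 : 0 <= d%:R :> R by [].
have r0d : d%:R * Cphi * r0 <= q.
  apply: le_trans r0E; rewrite -!mulrA ler_wpM2r ?lerDl// mulr_ge0// ltW//.
have near (a b : 'cV[R]_d) : `|a - x| <= r0 -> `|b - x| <= r0 ->
    `|phi a - phi b - J *m (a - b)| <= q * `|a - b|.
  move=> ax bx.
  have -> : phi a - phi b - J *m (a - b) = (phi a - phi b - jf b *m (a - b))
     + (jf b - J) *m (a - b) by rewrite mulmxBl addrA subrK.
  apply: (le_trans (ler_normD _ _)); apply: (le_trans (lerD (tay _ _) (mx_norm_mulmx _ _))).
  rewrite expr2 mulrA -mulrDl ler_wpM2r//; apply: le_trans r0E.
  have ab : `|a - b| <= 2 * r0.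
    have := ler_normB (a - x) (b - x); rewrite opprB addrA subrK; lra.
  have := ler_wpM2l C0 ab; have := ler_wpM2l d0 (le_trans (lip b x) (ler_wpM2l C0 bx)).
  lra.
have PcE (c : 'cV[R]_m) : `|P *m c| <= p * `|c| by exact: mx_norm_mulmx.
(* Radius for c: it keeps P c within r0 / 2. *)
pose r2 := r0 * q.
have r20 : 0 < r2 by rewrite mulr_gt0.
have ball2 (c : 'cV[R]_m) : `|c| <= r2 -> `|P *m c| <= r0 / 2.
  move=> h; apply: (le_trans (PcE _)); apply: (le_trans (ler_wpM2l p0 h)).
  rewrite /r2; have := ler_wpM2l (ltW r00) qp; lra.
(* Radius for the data (z, y): the first iterate is at most q r1 + j r1 + r1 <= (j + 2) r1 = r2 /
   2. *)
pose r1 := r2 / (2 * (j + 2)).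
have j2 : 0 < 2 * (j + 2) by lra.
have r10 : 0 < r1 by rewrite divr_gt0.
have r1E : (j + 2) * r1 = r2 / 2.
  by rewrite /r1; field; apply: lt0r_neq0; lra.
have r12 : r1 <= r0 / 2.
  have h1 : 2 * r1 <= (j + 2) * r1 by rewrite ler_wpM2r ?(ltW r10)//; lra.
  have h2 : r2 <= r0 by rewrite /r2 ler_piMr ?(ltW r00).
  lra.
pose T := newton_step phi P.
have inball z (c : 'cV[R]_m) : `|z - x| <= r1 -> `|c| <= r2 -> `|z + P *m c - x| <= r0.
  move=> hz /ball2 hc; rewrite addrAC; apply: (le_trans (ler_normD _ _)); lra.
(* Since J P = 1, the difference a - b cancels and only the nonlinear part of phi remains. *)
have TE z y (a b : 'cV[R]_m) : T z y a - T z y b =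
   - (phi (z + P *m a) - phi (z + P *m b) - J *m ((z + P *m a) - (z + P *m b))).
  have -> : J *m ((z + P *m a) - (z + P *m b)) = a - b.
    have -> : (z + P *m a) - (z + P *m b) = P *m (a - b).
      by rewrite mulmxBr opprD addrACA subrr add0r.
    by rewrite mulmxA JP mul1mx.
  rewrite /T /newton_step; move: (phi _) (phi _) => A B.
  by apply/matrixP => i k; rewrite !mxE; ring.
have Tcon z y : `|z - x| <= r1 ->
    forall a b, `|a| <= r2 -> `|b| <= r2 -> `|T z y a - T z y b| <= `|a - b| / 2.
  move=> hz a b ha hb; rewrite TE normrN.
  apply: (le_trans (near _ _ (inball _ _ hz ha) (inball _ _ hz hb))).
  have -> : (z + P *m a) - (z + P *m b) = P *m (a - b).
    by rewrite mulmxBr opprD addrACA subrr add0r.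
  apply: (le_trans (ler_wpM2l (ltW q0) (PcE _))).
  by rewrite mulrA [leRHS]mulrC ler_wpM2r.
have T0 z y : `|z - x| <= r1 -> `|y - phi x| <= r1 -> `|T z y 0| <= r2 / 2.
  move=> hz hy.
  have -> : T z y 0 = - ((phi z - phi x - J *m (z - x)) + J *m (z - x) - (y - phi x)).
    rewrite /T /newton_step mulmx0 addr0; move: (phi z) (phi x) (J *m _) => A1 A2 A3.
    by apply/matrixP => i k; rewrite !mxE; ring.
  rewrite normrN; apply: (le_trans (ler_normB _ _)).
  apply: (le_trans (lerD (ler_normD _ _) (lexx _))).
  have hx : `|x - x| <= r0 by rewrite subrr normr0 ltW.
  have hz0 : `|z - x| <= r0 by lra.
  have n1 := near z x hz0 hx.
  have n2 : `|J *m (z - x)| <= j * `|z - x| by exact: mx_norm_mulmx.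
  have n3 := ler_wpM2l j0 hz.
  have n4 : q * `|z - x| <= r1.
    by apply: le_trans hz; rewrite ler_piMl.
  rewrite -r1E; lra.
pose cc z y : 'cV[R]_m := lim ((fun k => iter k (T z y) 0) @ \oo).
have ccP z y : `|z - x| <= r1 -> `|y - phi x| <= r1 ->
   [/\ (fun k => iter k (T z y) 0) @ \oo --> cc z y, `|cc z y| <= r2
     & phi (z + P *m cc z y) = y].
  move=> hz hy; have [c [c1 c2 c3]] := iter_contraction_cvg (ltW r20) (T0 z y hz hy) (Tcon z y hz).
  have -> : cc z y = c by apply: cvg_lim.
  split => //; apply/eqP; rewrite -subr_eq0; apply/eqP.
  move: c3; rewrite /T /newton_step => /eqP; rewrite -subr_eq0 opprB addrAC subrr add0r.
  by rewrite subr_eq0 => /eqP ->; rewrite subrr.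
(* Comparing two solutions, the nonlinear part contributes at most |c1 - c2| / 2; moving it to the
   left produces the factor 2. *)
have stab z1 y1 z2 y2 (c1 c2 : 'cV[R]_m) : `|z1 - x| <= r1 -> `|z2 - x| <= r1 ->
    `|c1| <= r2 -> `|c2| <= r2 -> phi (z1 + P *m c1) = y1 -> phi (z2 + P *m c2) = y2 ->
    `|c1 - c2| <= 2 * (`|y1 - y2| + (j + 1) * `|z1 - z2|).
  move=> hz1 hz2 hc1 hc2 e1 e2.
  have := near _ _ (inball _ _ hz1 hc1) (inball _ _ hz2 hc2); rewrite e1 e2.
  have -> : (z1 + P *m c1) - (z2 + P *m c2) = (z1 - z2) + P *m (c1 - c2).
    by rewrite mulmxBr opprD addrACA.
  rewrite mulmxDr mulmxA JP mul1mx => n1.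
  have n2 : `|J *m (z1 - z2)| <= j * `|z1 - z2| by exact: mx_norm_mulmx.
  have n3 : q * `|(z1 - z2) + P *m (c1 - c2)| <= `|z1 - z2| + `|c1 - c2| / 2.
    apply: (le_trans (ler_wpM2l (ltW q0) (ler_normD _ _))); rewrite mulrDr lerD//.
      by rewrite ler_piMl.
    apply: (le_trans (ler_wpM2l (ltW q0) (PcE _))).
    by rewrite mulrA [leRHS]mulrC ler_wpM2r.
  have E : (y1 - y2) - J *m (z1 - z2) - (y1 - y2 - (J *m (z1 - z2) + (c1 - c2))) = c1 - c2.
    by move: (J *m _) => A; apply/matrixP => i k; rewrite !mxE; ring.
  have n4 := ler_normB ((y1 - y2) - J *m (z1 - z2)) (y1 - y2 - (J *m (z1 - z2) + (c1 - c2))).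
  rewrite E in n4; have n5 := ler_normB (y1 - y2) (J *m (z1 - z2)); lra.
have hx1 : `|x - x| <= r1 by rewrite subrr normr0 ltW.
have hp1 : `|phi x - phi x| <= r1 by rewrite subrr normr0 ltW.
exists r0, r1, cc; split=> //; split.
- move=> z y hz hy; have [c1 c2 c3] := ccP z y hz hy.
  by split => //; exact: inball.
- move=> z1 y1 z2 y2 hz1 hy1 hz2 hy2.
  have [_ b1 e1] := ccP z1 y1 hz1 hy1; have [_ b2 e2] := ccP z2 y2 hz2 hy2.
  exact: stab.
- have [_ b1 e1] := ccP x (phi x) hx1 hp1.
  have := @stab x (phi x) x (phi x) (cc x (phi x)) 0 hx1 hx1 b1.
  rewrite normr0 mulmx0 addr0 !subrr !normr0 mulr0 addr0 mulr0 subr0 => /(_ (ltW r20) e1 erefl).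
  by rewrite normr_le0 => /eqP.
- move=> X c hX.
  (* phi'(X) P is the identity plus a perturbation of norm at most 1/2. *)
  have -> : jf X *m P *m c = c + (jf X - J) *m (P *m c).
    have alg (A J1 : 'M[R]_(m, d)) : J1 *m P = 1%:M ->
        A *m P *m c = c + (A - J1) *m (P *m c).
      by move=> JP1; rewrite mulmxBl !mulmxA JP1 mul1mx addrC subrK.
    exact: alg.
  have n1 : `|(jf X - J) *m (P *m c)| <= `|c| / 2.
    apply: (le_trans (mx_norm_mulmx _ _)).
    have n2 := ler_wpM2l d0 (le_trans (lip X x) (ler_wpM2l C0 hX)).
    have n3 : d%:R * `|jf X - J| <= q by rewrite mulrA in n2; lra.
    apply: (le_trans (ler_wpM2r (normr_ge0 _) n3)).
    apply: (le_trans (ler_wpM2l (ltW q0) (PcE _))).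
    by rewrite mulrA [leRHS]mulrC ler_wpM2r.
  have := ler_normB (c + (jf X - J) *m (P *m c)) ((jf X - J) *m (P *m c)).
  rewrite addrK; lra.
Qed.

(** * Images and lifts of paths *)

(** S dominates the constant of Young's estimate; 4 <= S allows a sum of up to four terms bounded by
    S^a to be replaced by S^(a+1). *)
Definition young_setting (R : realType) (g : R -> R) (t e gam kap S : R) : Prop :=
  [/\ [/\ 0 < kap, kap <= gam, gam < 1 & 1 < kap + gam], t <= e <= t + 1,
      holder_on g t e 1 gam & 4 <= S /\ (1 - 2 `^ (1 - (kap + gam)))^-1 <= S].

Lemma expS_le (R : realType) (S x : R) (a b : nat) :
  4 <= S -> x <= S ^+ a -> (a <= b)%N -> x <= S ^+ b.
Proof. by move=> S4 xa ab; apply: (le_trans xa); rewrite ler_weXn2l//; lra. Qed.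

Lemma expS_add (R : realType) (S x y : R) (a : nat) :
  4 <= S -> x <= S ^+ a -> y <= S ^+ a -> x + y <= S ^+ a.+1.
Proof.
move=> S4 xa ya; rewrite exprS.
have : 0 <= S ^+ a by rewrite exprn_ge0//; lra.
by nra.
Qed.

Lemma expS_add4 (R : realType) (S x y z w : R) (a : nat) :
  4 <= S -> x <= S ^+ a -> y <= S ^+ a -> z <= S ^+ a -> w <= S ^+ a ->
  x + y + z + w <= S ^+ a.+1.
Proof.
move=> S4 xa ya za wa; rewrite exprS.
have : 0 <= S ^+ a by rewrite exprn_ge0//; lra.
by nra.
Qed.

Lemma expS_mul (R : realType) (S x y : R) (a b : nat) :
  0 <= x -> 0 <= y -> x <= S ^+ a -> y <= S ^+ b -> x * y <= S ^+ (a + b).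
Proof. by move=> x0 y0 xa yb; rewrite exprD ler_pM. Qed.

Lemma holder_onD (R : realType) (V : normedZmodType R) (f h : R -> V) (a b F G k : R) :
  holder_on f a b F k -> holder_on h a b G k -> holder_on (fun s => f s + h s) a b (F + G) k.
Proof.
move=> hf hh s r sI rI; rewrite opprD addrACA (le_trans (ler_normD _ _))//.
by rewrite mulrDl lerD ?hf ?hh.
Qed.

Lemma holder_on_cst (R : realType) (V : normedZmodType R) (c : V) (a b k : R) :
  holder_on (fun=> c) a b 0 k.
Proof. by move=> s r _ _; rewrite subrr normr0 mul0r. Qed.

Lemma holder_onN (R : realType) (V : normedZmodType R) (f : R -> V) (a b F k : R) :
  holder_on f a b F k -> holder_on (fun s => - f s) a b F k.
Proof. by move=> hf s r sI rI; rewrite -opprD normrN hf. Qed.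

(** The exponent a measures the velocities: it is 1 for (u, v) in the image direction and 3 for
    (phi'(x) u, phi'(x) v) in the lift. *)
Lemma path_of_integral (R : realType) (n : nat) (g : R -> R) (t e gam kap S D Dt : R)
    (a : nat) (u v z0 : 'cV[R]_n) (U V I : R -> 'cV[R]_n) :
    young_setting g t e gam kap S -> (0 < a)%N -> `|u| <= S ^+ a -> `|v| <= S ^+ a ->
    0 <= D <= S -> 0 <= Dt <= S -> U t = 0 -> V t = 0 ->
    holder_on U t e D gam -> holder_on V t e Dt kap ->
    (forall s, t <= s <= e -> RS_integral (fun r => v + V r) g t s (I s)) ->
  let Z := fun s => z0 + vintegral (fun r => u + U r) t s + I s in
  [/\ germ g t e (kap + gam) (S ^+ 3) (fun r => u + U r) (fun r => v + V r) Z,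
      holder_on Z t e (S ^+ (a + 3)) gam, Z t = z0,
      forall s, t <= s <= e -> `|U s| <= S & forall s, t <= s <= e -> `|V s| <= S].
Proof.
move=> [[k0 kg g1 th1] /andP[te et] hg [S4 cS]] a0 uS vS /andP[D0 DS] /andP[Dt0 DtS].
move=> Ut Vt hU hV hI Z; have gam0 : 0 < gam := lt_le_trans k0 kg.
have S0 : 0 <= S by lra.
have bU s : t <= s <= e -> `|U s| <= S.
  by move=> sI; apply: le_trans DS; exact: (holder_on_bound D0 gam0 et hU).
have bV s : t <= s <= e -> `|V s| <= S.
  by move=> sI; apply: le_trans DtS; exact: (holder_on_bound Dt0 k0 et hV).
have hcU : holder_on (fun r => u + U r) t e D gam.
  by have := holder_onD (@holder_on_cst _ _ u t e gam) hU; rewrite add0r.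
have hcV : holder_on (fun r => v + V r) t e Dt kap.
  by have := holder_onD (@holder_on_cst _ _ v t e kap) hV; rewrite add0r.
have S1 : S <= S ^+ 1 by rewrite expr1.
have cth0 : 0 <= (1 - 2 `^ (1 - (kap + gam)))^-1.
  have e1 : 1 `^ (kap + gam - 1) = 1 :> R by rewrite powR1.
  rewrite invr_ge0 subr_ge0 -opprB powRN invf_le1 ?powR_gt0// -[leLHS]e1.
  by rewrite ge0_ler_powR ?nnegrE ?ler1n ?subr_ge0 ?(ltW th1).
have CS : D + Dt / (1 - 2 `^ (1 - (kap + gam))) <= S ^+ 3.
  apply: expS_add => //; first exact: (expS_le (a := 1)).
  by apply: (expS_mul (a := 1) (b := 1)) => //; rewrite expr1.
have gZ : germ g t e (kap + gam) (S ^+ 3) (fun r => u + U r) (fun r => v + V r) Z.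
  have G := germ_of_integral z0 D0 Dt0 k0 kg g1 th1 et hg hcU hcV hI.
  move=> s r ts sr re; apply: (le_trans (G s r ts sr re)).
  by rewrite ler_wpM2r// powR_ge0.
have aS x : x <= S -> x <= S ^+ a by move=> xS; apply: (expS_le (a := 1)) => //; lra.
have buU s : t <= s <= e -> `|u + U s| <= S ^+ a.+1.
  move=> sI; apply: (le_trans (ler_normD _ _)); apply: expS_add => //.
  exact/aS/bU.
have bvV s : t <= s <= e -> `|v + V s| <= S ^+ a.+1.
  move=> sI; apply: (le_trans (ler_normD _ _)); apply: expS_add => //.
  exact/aS/bV.
have pS k : 0 <= S ^+ k by rewrite exprn_ge0.
split => //.
- have G := germ_holder (pS a.+1) (pS a.+1) (pS 3) k0 kg g1 et hg buU bvV gZ.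
  apply: holder_on_le G => //.
  rewrite addn3 -[leLHS]addr0; apply: expS_add4 => //.
  + exact: (expS_le (a := a.+1)).
  + exact: (expS_le (a := a.+1)).
  + exact: (expS_le (a := 3)).
- rewrite /Z vintegral_pt addr0; have tI : t <= t <= e by rewrite lexx.
  by rewrite (RS_integral_pt (hI t tI)) addr0.
Qed.

(** U' and V' are the integrands of the chain rule minus their values at t. The factor phi'(Z) is
    gam-Hölder, so U' keeps the exponent gam, while V' inherits the exponent kap of V. *)
Lemma image_path (R : realType) (d m : nat) (g : R -> R) (t e gam kap S Cphi : R)
    (phi : 'cV[R]_d -> 'cV[R]_m) (jf : 'cV[R]_d -> 'M[R]_(m, d))
    (x u v : 'cV[R]_d) (U V Z : R -> 'cV[R]_d) :
    young_setting g t e gam kap S -> d%:R <= S -> 0 <= Cphi <= S ->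
    (forall x y, `|jf x - jf y| <= Cphi * `|x - y|) ->
    (forall x y, `|phi y - phi x - jf x *m (y - x)| <= Cphi * `|y - x| ^+ 2) ->
    `|u| <= S -> `|v| <= S -> `|jf x| <= S ->
    (forall s, t <= s <= e -> `|U s| <= S) -> (forall s, t <= s <= e -> `|V s| <= S) ->
    holder_on U t e S gam -> holder_on V t e S kap ->
    germ g t e (kap + gam) (S ^+ 3) (fun r => u + U r) (fun r => v + V r) Z ->
    holder_on Z t e (S ^+ 4) gam -> Z t = x ->
  let U' := fun s => jf (Z s) *m (u + U s) - jf x *m u in
  let V' := fun s => jf (Z s) *m (v + V s) - jf x *m v in
  [/\ holder_on U' t e (S ^+ 9) gam, holder_on V' t e (S ^+ 9) kap
    & exists2 C, 0 <= C & germ g t e (kap + gam) C (fun r => jf x *m u + U' r)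
        (fun r => jf x *m v + V' r) (fun s => phi (Z s))].
Proof.
move=> [[k0 kg g1 th1] /andP[te et] hg [S4 cS]] dS /andP[Cp0 CpS] lip tay uS vS JS.
move=> bU bV hU hV gZ hZ Zt U' V'; have gam0 : 0 < gam := lt_le_trans k0 kg.
have S0 : 0 <= S by lra.
have S1 : S <= S ^+ 1 by rewrite expr1.
have pS k : 0 <= S ^+ k by rewrite exprn_ge0.
have hJ : holder_on (fun s => jf (Z s)) t e (S ^+ 5) gam.
  apply: holder_on_le (holder_comp Cp0 lip hZ) => //.
  by apply: (expS_mul (a := 1) (b := 4)) => //; rewrite expr1.
have hJk : holder_on (fun s => jf (Z s)) t e (S ^+ 5) kap.
  exact: holder_on_le hJ.
have bJ s : t <= s <= e -> `|jf (Z s)| <= S ^+ 6.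
  move=> sI; have h0 : holder_on (fun s => jf (Z s) - jf x) t e (S ^+ 5) gam.
    have := holder_onD hJ (@holder_on_cst _ _ (- jf x) t e gam); rewrite addr0; exact.
  have := @holder_on_bound _ _ _ _ _ _ _ s (pS 5) gam0 et h0 sI.
  rewrite Zt subrr => /(_ erefl) h1.
  rewrite -[jf (Z s)](subrK (jf x)) (le_trans (ler_normD _ _))//.
  by apply: expS_add => //; apply: (expS_le (a := 1)); rewrite ?expr1.
have bu s : t <= s <= e -> `|u + U s| <= S ^+ 2.
  by move=> sI; apply: (le_trans (ler_normD _ _)); apply: expS_add; rewrite ?expr1 ?bU.
have bv s : t <= s <= e -> `|v + V s| <= S ^+ 2.
  by move=> sI; apply: (le_trans (ler_normD _ _)); apply: expS_add; rewrite ?expr1 ?bV.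
have hu : holder_on (fun s => u + U s) t e S gam.
  by have := holder_onD (@holder_on_cst _ _ u t e gam) hU; rewrite add0r.
have hv : holder_on (fun s => v + V s) t e S kap.
  by have := holder_onD (@holder_on_cst _ _ v t e kap) hV; rewrite add0r.
have KS : d%:R * (S ^+ 5 * S ^+ 2 + S ^+ 6 * S) <= S ^+ 9.
  apply: (expS_mul (a := 1) (b := 8)); rewrite ?expr1//.
    by rewrite addr_ge0// mulr_ge0.
  by apply: expS_add => //; rewrite -?exprD -?exprSr.
have E (w : 'cV[R]_m) (f : R -> 'cV[R]_m) : (fun r => w + (f r - w)) = f.
  by apply/funext => r; rewrite addrC subrK.
split.
- have h := holder_mulmx (pS 6) (pS 5) hJ hu bJ bu.
  have := holder_onD h (@holder_on_cst _ _ (- (jf x *m u)) t e gam); rewrite addr0.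
  by apply: holder_on_le.
- have h := holder_mulmx (pS 6) (pS 5) hJk hv bJ bv.
  have := holder_onD h (@holder_on_cst _ _ (- (jf x *m v)) t e kap); rewrite addr0.
  by apply: holder_on_le.
exists (Cphi * (S ^+ 4) ^+ 2 + d%:R * S ^+ 6 * S ^+ 3).
  by rewrite addr_ge0// !mulr_ge0// exprn_ge0.
by rewrite /U' /V' !E; exact: chain_rule_germ.
Qed.

(* Differentiating phi (z + P c) = Y gives phi'(X) P c' = Y' - phi'(X) z', and
   X' = z' + P c'; with z' = (u, v) the corrections U', V' of X' vanish at t. *)
Lemma lift_path (R : realType) (d m : nat) (g : R -> R) (t e gam kap S Cphi r0 r1 : R)
    (phi : 'cV[R]_d -> 'cV[R]_m) (jf : 'cV[R]_d -> 'M[R]_(m, d)) (P : 'M[R]_(d, m))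
    (x u v : 'cV[R]_d) (cc : 'cV[R]_d -> 'cV[R]_m -> 'cV[R]_m) (U V Y : R -> 'cV[R]_m) :
    young_setting g t e gam kap S -> d%:R <= S -> m%:R <= S -> 0 <= Cphi <= S ->
    (forall x y, `|jf x - jf y| <= Cphi * `|x - y|) ->
    (forall x y, `|phi y - phi x - jf x *m (y - x)| <= Cphi * `|y - x| ^+ 2) ->
    (forall z y, `|z - x| <= r1 -> `|y - phi x| <= r1 -> `|z + P *m cc z y - x| <= r0) ->
    (forall z y, `|z - x| <= r1 -> `|y - phi x| <= r1 -> phi (z + P *m cc z y) = y) ->
    (forall z1 y1 z2 y2, `|z1 - x| <= r1 -> `|y1 - phi x| <= r1 ->
      `|z2 - x| <= r1 -> `|y2 - phi x| <= r1 ->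
      `|cc z1 y1 - cc z2 y2| <=
        2 * (`|y1 - y2| + (d%:R * `|jf x| + 1) * `|z1 - z2|)) ->
    cc x (phi x) = 0 ->
    (forall X (c : 'cV[R]_m), `|X - x| <= r0 -> `|c| <= 2 * `|jf X *m P *m c|) ->
    `|u| <= S -> `|v| <= S -> `|jf x| <= S -> `|P| <= S -> U t = 0 -> V t = 0 ->
    holder_on U t e S gam -> holder_on V t e S kap ->
    germ g t e (kap + gam) (S ^+ 3)
      (fun r => jf x *m u + U r) (fun r => jf x *m v + V r) Y ->
    holder_on Y t e (S ^+ 6) gam -> Y t = phi x ->
  let z := fun s => x + (s - t) *: u + (g s - g t) *: v in
    (forall s, t <= s <= e -> `|z s - x| <= r1) ->
    (forall s, t <= s <= e -> `|Y s - phi x| <= r1) ->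
  let X := fun s => z s + P *m cc (z s) (Y s) in
  let U' := fun s => P *m (invmx (jf (X s) *m P) *m
                       (jf x *m u + U s - jf (X s) *m u)) in
  let V' := fun s => P *m (invmx (jf (X s) *m P) *m
                       (jf x *m v + V s - jf (X s) *m v)) in
  [/\ holder_on U' t e (S ^+ 32) gam, holder_on V' t e (S ^+ 32) kap,
      U' t = 0 /\ V' t = 0, X t = x
    & exists2 C, 0 <= C & germ g t e (kap + gam) C (fun r => u + U' r)
        (fun r => v + V' r) X].
Proof.
move=> [[k0 kg g1 th1] /andP[te et] hg [S4 cS]] dS mS /andP[Cp0 CpS] lip tay.
move=> ccr ccphi ccL cc0 low uS vS JS PS Ut Vt hU hV gY hY Yt z zr1 Yr1 X U' V'.
have gam0 : 0 < gam := lt_le_trans k0 kg.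
have S0 : 0 <= S by lra.
have pS k : 0 <= S ^+ k by rewrite exprn_ge0.
have S1 : S <= S ^+ 1 by rewrite expr1.
have nS x1 : `|x1 : R| <= S -> `|x1| <= S ^+ 1 by rewrite expr1.
have tI : t <= t <= e by rewrite lexx.
set J := jf x in JS *.
have zt : z t = x by rewrite /z !subrr !scale0r !addr0.
have Xt : X t = x by rewrite /X zt Yt cc0 mulmx0 addr0.
have pD s r q : t <= s -> s <= r -> r <= e -> gam <= q -> (r - s) `^ q <= (r - s) `^ gam.
  by move=> ts sr re gq; apply: powR_le01 => //; lra.
have hz : holder_on z t e (S ^+ 2) gam.
  apply: holder_of_increments => s r ts sr re.
  have sI : t <= s <= e by rewrite ts (le_trans sr).
  have rI : t <= r <= e by rewrite re (le_trans ts).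
  have rs0 : 0 <= r - s by rewrite subr_ge0.
  have -> : z r - z s = (r - s) *: u + (g r - g s) *: v.
    by rewrite /z; apply/matrixP => i j; rewrite !mxE; ring.
  apply: (le_trans (ler_normD _ _)); rewrite !mx_normZ (ger0_norm rs0).
  apply: (@le_trans _ _ ((S + S) * (r - s) `^ gam)); last first.
    by rewrite ler_wpM2r ?powR_ge0// expS_add.
  rewrite [leRHS]mulrDl; apply: lerD; rewrite mulrC ler_pM//.
    by have := pD s r 1 ts sr re (ltW g1); rewrite powRr1.
  by have := hg r s rI sI; rewrite mul1r (ger0_norm rs0).
have hc : holder_on (fun s => cc (z s) (Y s)) t e (S ^+ 7) gam.
  move=> s r sI rI; apply: (le_trans (ccL _ _ _ _ (zr1 s sI) (Yr1 s sI) (zr1 r rI) (Yr1 r rI))).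
  have h1 : d%:R * `|J| + 1 <= S ^+ 3.
    apply: expS_add => //; last by rewrite expr2; nra.
    by apply: (expS_mul (a := 1) (b := 1)); rewrite ?expr1.
  have h2 : (d%:R * `|J| + 1) * `|z s - z r| <= S ^+ 5 * `|s - r| `^ gam.
    rewrite (exprD S 3 2) -mulrA ler_pM ?hz// addr_ge0// mulr_ge0//.
  have h3 := hY s r sI rI.
  have h4 : S ^+ 5 * `|s - r| `^ gam <= S ^+ 6 * `|s - r| `^ gam.
    by rewrite ler_wpM2r ?powR_ge0//; apply: (expS_le (a := 5)).
  have h5 : 4 * (S ^+ 6 * `|s - r| `^ gam) <= S ^+ 7 * `|s - r| `^ gam.
    by rewrite (exprS S 6) mulrA ler_wpM2r ?powR_ge0// ler_wpM2r.
  lra.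
have hPc k (f : R -> 'cV[R]_m) L : holder_on f t e L k ->
    holder_on (fun s => P *m f s) t e (S ^+ 2 * L) k.
  move=> hf s r sI rI; rewrite -mulmxBr (le_trans (mx_norm_mulmx _ _))//.
  rewrite -[leRHS]mulrA ler_pM ?hf ?mulr_ge0//.
  by apply: (expS_mul (a := 1) (b := 1)); rewrite ?expr1.
have hX : holder_on X t e (S ^+ 10) gam.
  have h := holder_onD hz (hPc _ _ _ hc).
  apply: holder_on_le h => //; apply: expS_add => //; first exact: (expS_le (a := 2)).
  by rewrite -exprD.
have hJX : holder_on (fun s => jf (X s)) t e (S ^+ 11) gam.
  apply: holder_on_le (holder_comp Cp0 lip hX) => //.
  by apply: (expS_mul (a := 1) (b := 10)) => //; rewrite expr1.
have Xr0 s : t <= s <= e -> `|X s - x| <= r0 by move=> sI; apply: ccr; [exact: zr1|exact: Yr1].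
pose A s := jf (X s) *m P.
have Alow s (c : 'cV[R]_m) : t <= s <= e -> `|c| <= 2 * `|A s *m c|.
  by move=> sI; apply: low; exact: Xr0.
have Aunit s : t <= s <= e -> A s \in unitmx.
  by move=> sI; apply: unitmx_of_lower_bound => c; exact: Alow.
have hA k : 0 < k -> k <= gam -> holder_on A t e (S ^+ 13) k.
  move=> kk kg' s r sI rI; rewrite -mulmxBl (le_trans (mx_norm_mulmx _ _))//.
  have h := holder_on_le (pS 11) (lexx _) kk kg' et hJX.
  rewrite (exprD S 11 2) mulrAC.
  apply: (@le_trans _ _ (S ^+ 2 * (S ^+ 11 * `|s - r| `^ k)));
    last by rewrite mulrA [S ^+ 2 * _]mulrC.
  rewrite ler_pM ?h ?mulr_ge0//.
  by apply: (expS_mul (a := 1) (b := 1)); rewrite ?expr1.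
(* Treats U' (with W = U, k = gam) and V' (with W = V, k = kap) at once. *)
have core (w : 'cV[R]_d) (W : R -> 'cV[R]_m) k : 0 < k -> k <= gam -> `|w| <= S ->
    W t = 0 -> holder_on W t e S k ->
    let p := fun s => J *m w + W s - jf (X s) *m w in
    let f := fun s => P *m (invmx (A s) *m p s) in
    [/\ holder_on f t e (S ^+ 32) k, f t = 0 &
        forall s, t <= s <= e -> A s *m (invmx (A s) *m p s) = p s].
  move=> kk kg' wS Wt hW p f.
  have pt0 : p t = 0 by rewrite /p Wt addr0 Xt subrr.
  have hp : holder_on p t e (S ^+ 14) k.
    have hJk := holder_on_le (pS 11) (lexx _) kk kg' et hJX.
    have h1 : holder_on (fun s => jf (X s) *m w) t e (S ^+ 13) k.
      move=> s r sI rI; rewrite -mulmxBl (le_trans (mx_norm_mulmx _ _))//.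
      rewrite (exprD S 11 2) mulrAC.
      apply: (@le_trans _ _ (S ^+ 2 * (S ^+ 11 * `|s - r| `^ k)));
        last by rewrite mulrA [S ^+ 2 * _]mulrC.
      rewrite ler_pM ?hJk ?mulr_ge0//.
      by apply: (expS_mul (a := 1) (b := 1)); rewrite ?expr1.
    have h2 := holder_onD (holder_onD (@holder_on_cst _ _ (J *m w) t e k) hW) (holder_onN h1).
    apply: holder_on_le h2 => //; rewrite add0r; apply: expS_add => //.
    by apply: (expS_le (a := 1)).
  have AE s : t <= s <= e -> A s *m (invmx (A s) *m p s) = p s.
    by move=> sI; rewrite mulmxA mulmxV ?mul1mx ?Aunit.
  have bp s : t <= s <= e -> `|p s| <= S ^+ 14.
    by move=> sI; exact: (holder_on_bound (pS 14) kk et hp).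
  have be s : t <= s <= e -> `|invmx (A s) *m p s| <= S ^+ 15.
    move=> sI; apply: (le_trans (Alow s _ sI)); rewrite AE// mulrC exprSr.
    by rewrite ler_pM ?bp//; lra.
  (* The regularity of the inverse matrix is not estimated separately: A_r (e_r - e_s) = (p_r - p_s)
     - (A_r - A_s) e_s, and the lower bound for A_r concludes. *)
  have he : holder_on (fun s => invmx (A s) *m p s) t e (S ^+ 30) k.
    move=> s r sI rI; set es := invmx (A s) *m p s; set er := invmx (A r) *m p r.
    have -> : es - er = - (er - es) by rewrite opprB.
    rewrite normrN; apply: (le_trans (Alow r _ rI)).
    have -> : A r *m (er - es) = - (p s - p r) - (A r - A s) *m es.
      have E1 : A r *m er = p r := AE r rI; have E2 : A s *m es = p s := AE s sI.
      rewrite mulmxBr mulmxBl E1 E2; move: (A r *m es) (p r) (p s) => Q1 Q2 Q3.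
      by apply/matrixP => i j; rewrite !mxE; ring.
    have h1 := ler_normB (- (p s - p r)) ((A r - A s) *m es); rewrite normrN in h1.
    have h2 := hp s r sI rI.
    have h3 : `|(A r - A s) *m es| <= S ^+ 29 * `|s - r| `^ k.
      apply: (le_trans (mx_norm_mulmx _ _)); rewrite distrC.
      apply: (@le_trans _ _ (S ^+ 14 * `|s - r| `^ k * S ^+ 15)).
        rewrite ler_pM ?be ?mulr_ge0// exprS -mulrA ler_pM//; exact: hA.
      by rewrite mulrAC -exprD.
    have h4 : S ^+ 14 * `|s - r| `^ k <= S ^+ 29 * `|s - r| `^ k.
      by rewrite ler_wpM2r ?powR_ge0//; apply: (expS_le (a := 14)).
    have h5 : 4 * (S ^+ 29 * `|s - r| `^ k) <= S ^+ 30 * `|s - r| `^ k.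
      by rewrite (exprS S 29) mulrA ler_wpM2r ?powR_ge0// ler_wpM2r.
    lra.
  split => //.
    by have := hPc _ _ _ he; rewrite -exprD.
  by rewrite /f pt0 !mulmx0.
have [hU' Ut' AU] := core u U gam gam0 (lexx _) uS Ut hU.
have [hV' Vt' AV] := core v V kap k0 kg vS Vt hV.
split => //.
pose C := S ^+ 2 * (2 * (Cphi * (S ^+ 10) ^+ 2 + S ^+ 3)).
have C0 : 0 <= Cphi * (S ^+ 10) ^+ 2 + S ^+ 3.
  by rewrite addr_ge0// mulr_ge0// exprn_ge0.
exists C; first by rewrite /C mulr_ge0// mulr_ge0.
move=> s r ts sr re.
have sI : t <= s <= e by rewrite ts (le_trans sr).
have rI : t <= r <= e by rewrite re (le_trans ts).
have rs0 : 0 <= r - s by rewrite subr_ge0.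
set e0 := invmx (A s) *m (J *m u + U s - jf (X s) *m u).
set e1 := invmx (A s) *m (J *m v + V s - jf (X s) *m v).
have AU' : A s *m e0 = J *m u + U s - jf (X s) *m u by exact: AU.
have AV' : A s *m e1 = J *m v + V s - jf (X s) *m v by exact: AV.
have UE : U' s = P *m e0 by [].
have VE : V' s = P *m e1 by [].
set dc := cc (z r) (Y r) - cc (z s) (Y s).
have XE : X r - X s = (r - s) *: u + (g r - g s) *: v + P *m dc.
  rewrite /X /dc mulmxBr /z; move: (P *m _) (P *m _) => Q1 Q2.
  by apply/matrixP => i j; rewrite !mxE; ring.
clearbody dc e0 e1.
(* The defect of c against its expected increment. A_s maps it to the germ error of Y minus the
   Taylor remainder of phi, both of order theta, and the lower bound for A_s transfers this order to
   w. *)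
pose w := dc - ((r - s) *: e0 + (g r - g s) *: e1).
have -> : X r - X s - ((r - s) *: (u + U' s) + (g r - g s) *: (v + V' s)) = P *m w.
  rewrite XE UE VE /w mulmxBr mulmxDr -!scalemxAr.
  move: (P *m e0) (P *m e1) (P *m dc) => Q0 Q1 Q2.
  by apply/matrixP => i j; rewrite !mxE; ring.
have Aw : A s *m w = - (Y r - Y s - jf (X s) *m (X r - X s))
    + (Y r - Y s - ((r - s) *: (J *m u + U s) + (g r - g s) *: (J *m v + V s))).
  rewrite /w mulmxBr mulmxDr -!scalemxAr AU' AV' XE !mulmxDr -!scalemxAr mulmxA -/(A s).
  move: (A s *m dc) (jf (X s) *m u) (jf (X s) *m v) (J *m u) (J *m v).
  move=> Q0 Q1 Q2 Q3 Q4.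
  by apply/matrixP => i j; rewrite !mxE; ring.
have YX q : t <= q <= e -> phi (X q) = Y q.
  by move=> qI; apply: ccphi; [exact: zr1|exact: Yr1].
have n1 : `|Y r - Y s - jf (X s) *m (X r - X s)|
    <= Cphi * (S ^+ 10) ^+ 2 * (r - s) `^ (kap + gam).
  rewrite -(YX r rI) -(YX s sI); apply: (le_trans (tay _ _)); rewrite -mulrA ler_wpM2l//.
  have h := hX r s rI sI; rewrite (ger0_norm rs0) in h.
  apply: (@le_trans _ _ ((S ^+ 10 * (r - s) `^ gam) ^+ 2)).
    by rewrite lerXn2r ?nnegrE// mulr_ge0// powR_ge0.
  rewrite exprMn ler_wpM2l ?exprn_ge0// -powR_mulrn ?powR_ge0// -powRrM powR_le01//; lra.
have n2 := gY s r ts sr re.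
apply: (le_trans (mx_norm_mulmx _ _)); rewrite -mulrA.
apply: (@le_trans _ _ (S ^+ 2 * `|w|)).
  rewrite mulrA ler_wpM2r//.
  by apply: (expS_mul (a := 1) (b := 1)); rewrite ?expr1.
rewrite /C -[leRHS]mulrA ler_wpM2l// -[leRHS]mulrA; apply: (le_trans (Alow s w sI)).
rewrite ler_wpM2l//.
rewrite Aw; apply: (le_trans (ler_normD _ _)); rewrite normrN mulrDl.
exact: lerD.
Qed.

(** * Measurability *)

Definition grid_pt (R : realType) (n : nat) (k : nat) (z : {ffun 'I_n -> int}) : 'cV[R]_n :=
  \col_i ((z i)%:~R / 2 ^+ k).

(* Round X to the grid 2^-k Z^n: the composition then has countably many values. *)
Lemma measurable_continuous_comp d (Omega : measurableType d) (R : realType) (n : nat)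
    (D : set Omega) (X : Omega -> 'cV[R]_n) (F : 'cV[R]_n -> R) :
    measurable D -> (forall i, measurable_fun D (fun w => X w i 0)) -> continuous F ->
  measurable_fun D (fun w => F (X w)).
Proof.
move=> mD mX cF.
pose z k w : {ffun 'I_n -> int} := [ffun i => Num.floor (X w i 0 * 2 ^+ k)].
have p2 k : 0 < 2 ^+ k :> R by rewrite exprn_gt0.
apply: (@measurable_fun_cvg _ _ _ _ (fun k w => F (grid_pt R k (z k w)))); last first.
  move=> w Dw; apply: (cvg_comp (fun k => grid_pt R k (z k w)) F); last exact: cF.
  apply/cvgrPdist_le => e e0; have [k hk] := pow2_inv_lt e0.
  exists k => // l /= kl; apply: mx_norm_le => [|i j]; first exact: ltW.
  rewrite !mxE ord1 ffunE.
  have /andP[f1 f2] := real_floor_itv (num_real (X w i 0 * 2 ^+ l)).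
  apply: (@le_trans _ _ (2 ^+ l)^-1); last first.
    apply: ltW; apply: le_lt_trans hk.
    by rewrite lef_pV2 ?posrE// ler_eXn2l ?ltr1n.
  rewrite -[X in `|X - _|](mulfK (lt0r_neq0 (p2 l))) -mulrBl normrM.
  rewrite [X in _ * X]ger0_norm ?invr_ge0 ?(ltW (p2 l))//.
  rewrite ger0_norm ?subr_ge0// ler_piMl ?invr_ge0 ?(ltW (p2 l))//.
  by move: f2; rewrite intrD; lra.
move=> k.
pose E i := D `&` [set w | pickle (z k w) = i].
have DE : D = \bigcup_i E i.
  by apply/seteqP; split => [w Dw|w [i _ []//]]; exists (pickle (z k w)).
have mE i : measurable (E i).
  (* An index that codes no grid vector, or is not the canonical code of one, gives an empty
     cell. *)
  case Ei : (unpickle i : option {ffun 'I_n -> int}) => [y|]; last first.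
    rewrite [X in measurable X](_ : _ = set0)//.
    apply/seteqP; split => w // -[_ /= h].
    by move: Ei; rewrite -h pickleK.
  have [iy|iy] := eqVneq (pickle y) i; last first.
    rewrite [X in measurable X](_ : _ = set0)//.
    apply/seteqP; split => w // -[_ /= h].
    by move: iy Ei; rewrite -h pickleK => /eqP h1 [h2]; apply: h1; rewrite h2.
  rewrite [X in measurable X](_ : _ = D `&` \big[setI/setT]_(j < n)
      (D `&` (fun w => X w j 0 * 2 ^+ k) @^-1` `[(y j)%:~R, (y j + 1)%:~R[)).
    apply: measurableI => //; apply: bigsetI_measurable => j _.
    by apply: measurable_funM.
  rewrite -bigcap_seq -iy; apply/seteqP; split => w /=.
  - move=> [Dw /= h]; split => // j _ /=; have {h} <- : z k w = y.
      by apply: (pcan_inj pickleK).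
    split => //=; rewrite in_itv/= ffunE.
    by have /andP[-> ->] := real_floor_itv (num_real (X w j 0 * 2 ^+ k)).
  - move=> [Dw h]; split => //=; congr pickle; apply/ffunP => j; rewrite ffunE.
    have /= [|_] := h j; first exact: mem_index_enum.
    by rewrite in_itv/= => hj; apply: floor_def.
rewrite [X in measurable_fun X](_ : _ = \bigcup_i E i)//.
apply/measurable_fun_bigcup => // i.
have [[w0 [Dw0 h0]]|/set0P/negP/negPn/eqP ->] := pselect (E i !=set0); last first.
  exact: measurable_fun_set0.
apply: (eq_measurable_fun (fun _ : Omega => F (grid_pt R k (z k w0)))).
  move=> w; rewrite inE => -[_ /= h]; congr (F (grid_pt R k _)).
  by apply: (pcan_inj pickleK); rewrite h h0.
exact: measurable_cst.
Qed.

Definition mx_measurable d (Omega : measurableType d) (R : realType) (m n : nat)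
    (D : set Omega) (A : Omega -> 'M[R]_(m, n)) : Prop :=
  forall i j, measurable_fun D (fun w => A w i j).

(** Real powers are measurable, so 1 / f is written as f times the power -1 of f^2, the base being
    nonnegative; where f = 0 both sides are 0. *)
Lemma measurable_fun_invr d (Omega : measurableType d) (R : realType) (D : set Omega)
    (f : Omega -> R) : measurable_fun D f -> measurable_fun D (fun w => (f w)^-1).
Proof.
move=> mf; rewrite (_ : (fun w => _) = (fun w => f w * (f w ^+ 2) `^ (-1))).
  apply: measurable_funM => //.
  have mf2 : measurable_fun D (fun w => f w ^+ 2) by exact: measurable_funX.
  exact: (measurableT_comp (@measurable_powR R (-1)) mf2).
apply/funext => w; rewrite powR_inv1 ?sqr_ge0//.
have [->|f0] := eqVneq (f w) 0; first by rewrite invr0 mul0r.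
by field.
Qed.

Lemma mx_measurableS d (Omega : measurableType d) (R : realType) (m n : nat)
    (D E : set Omega) (A : Omega -> 'M[R]_(m, n)) :
  measurable E -> D `<=` E -> mx_measurable E A -> mx_measurable D A.
Proof. by move=> mE DE mA i j; apply: measurable_funS (mA i j). Qed.

Lemma mx_measurable_eq d (Omega : measurableType d) (R : realType) (m n : nat)
    (D : set Omega) (A B : Omega -> 'M[R]_(m, n)) :
  (forall w, D w -> A w = B w) -> mx_measurable D A -> mx_measurable D B.
Proof.
move=> AB mA i j; apply: eq_measurable_fun (mA i j) => w; rewrite inE => Dw.
by rewrite AB.
Qed.

Lemma mx_measurable_cst d (Omega : measurableType d) (R : realType) (m n : nat)
    (D : set Omega) (A : 'M[R]_(m, n)) : mx_measurable D (fun=> A).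
Proof. by move=> i j; exact: measurable_cst. Qed.

Lemma mx_measurableD d (Omega : measurableType d) (R : realType) (m n : nat)
    (D : set Omega) (A B : Omega -> 'M[R]_(m, n)) :
  mx_measurable D A -> mx_measurable D B -> mx_measurable D (fun w => A w + B w).
Proof.
move=> mA mB i j; under eq_fun do rewrite mxE.
by apply: measurable_funD; [exact: mA|exact: mB].
Qed.

Lemma mx_measurableB d (Omega : measurableType d) (R : realType) (m n : nat)
    (D : set Omega) (A B : Omega -> 'M[R]_(m, n)) :
  mx_measurable D A -> mx_measurable D B -> mx_measurable D (fun w => A w - B w).
Proof.
move=> mA mB i j; under eq_fun do rewrite mxBE.
by apply: measurable_funB; [exact: mA|exact: mB].
Qed.

Lemma mx_measurableZ d (Omega : measurableType d) (R : realType) (m n : nat)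
    (D : set Omega) (f : Omega -> R) (A : Omega -> 'M[R]_(m, n)) :
  measurable_fun D f -> mx_measurable D A -> mx_measurable D (fun w => f w *: A w).
Proof.
move=> mf mA i j; under eq_fun do rewrite mxE.
by apply: measurable_funM; [exact: mf|exact: mA].
Qed.

Lemma mx_measurable_mulmx d (Omega : measurableType d) (R : realType) (m n p : nat)
    (D : set Omega) (A : Omega -> 'M[R]_(m, n)) (B : Omega -> 'M[R]_(n, p)) :
  mx_measurable D A -> mx_measurable D B -> mx_measurable D (fun w => A w *m B w).
Proof.
move=> mA mB i j; under eq_fun do rewrite mxE.
apply: measurable_sum => k.
by apply: measurable_funM; [exact: mA|exact: mB].
Qed.

Lemma measurable_det d (Omega : measurableType d) (R : realType) (n : nat)
    (D : set Omega) (A : Omega -> 'M[R]_n) :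
  mx_measurable D A -> measurable_fun D (fun w => \det (A w)).
Proof.
move=> mA; rewrite /determinant; apply: measurable_sum => s.
apply: measurable_funM; first exact: measurable_cst.
by apply: measurable_prod => i _; exact: mA.
Qed.

(** Cramer's rule: entries of the inverse are rational functions of the entries of A. *)
Lemma mx_measurable_invmx d (Omega : measurableType d) (R : realType) (n : nat)
    (D : set Omega) (A : Omega -> 'M[R]_n) :
  (forall w, D w -> A w \in unitmx) -> mx_measurable D A ->
  mx_measurable D (fun w => invmx (A w)).
Proof.
move=> uA mA; apply: (mx_measurable_eq (A := fun w => (\det (A w))^-1 *: \adj (A w))).
  by move=> w Dw; rewrite /invmx uA.
apply: mx_measurableZ; first by apply: measurable_fun_invr; exact: measurable_det.
move=> i j; under eq_fun do rewrite mxE.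
rewrite /cofactor; apply: measurable_funM; first exact: measurable_cst.
apply: measurable_det => k l; under eq_fun do rewrite !mxE.
exact: mA.
Qed.

Lemma mx_measurable_comp d (Omega : measurableType d) (R : realType) (n p q : nat)
    (D : set Omega) (X : Omega -> 'cV[R]_n) (F : 'cV[R]_n -> 'M[R]_(p, q)) :
  measurable D -> mx_measurable D X -> continuous F -> mx_measurable D (fun w => F (X w)).
Proof.
move=> mD mX cF i j.
apply: (@measurable_continuous_comp _ _ _ _ D X (fun y => F y i j)) => //.
by move=> y; apply: (@continuous_comp _ _ _ F (fun M : 'M[R]_(p, q) => M i j));
  [exact: cF|exact: coord_continuous].
Qed.

Lemma mx_measurable_cvg d (Omega : measurableType d) (R : realType) (m n : nat)
    (D : set Omega) (A : nat -> Omega -> 'M[R]_(m, n)) (B : Omega -> 'M[R]_(m, n)) :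
  (forall k, mx_measurable D (A k)) ->
  (forall w, D w -> (fun k => A k w) @ \oo --> B w) -> mx_measurable D B.
Proof.
move=> mA cA i j; apply: (@measurable_fun_cvg _ _ _ _ (fun k w => A k w i j)).
  by move=> k; exact: mA.
move=> w /cA cw.
exact: (cvg_comp _ _ cw (@coord_continuous _ _ _ i j _)).
Qed.

Lemma mx_measurable_left_sum d (Omega : measurableType d) (R : realType) (n : nat)
    (D : set Omega) (f : R -> Omega -> 'cV[R]_n) (g : R -> Omega -> R) (s r : R) :
    (forall q, s <= q <= r -> mx_measurable D (f q)) ->
    (forall q, s <= q <= r -> measurable_fun D (g q)) ->
  forall p a, s <= a -> path <%R a p -> last a p <= r ->
    mx_measurable D (fun w => left_sum (f ^~ w) (g ^~ w) a p).
Proof.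
move=> mf mg; elim => [|x p IH] a sa /=; first by move=> _ _; exact: mx_measurable_cst.
move=> /andP[ax xp] lr.
have xr : x <= r.
  by apply: le_trans lr; move: xp; rewrite lt_path_sortedE => /andP[/allP h _];
    have := mem_last x p; rewrite inE => /orP[/eqP ->//|/h/ltW].
have sx : s <= x := le_trans sa (ltW ax).
apply: mx_measurableD; last exact: IH.
apply: mx_measurableZ.
  apply: measurable_funB; apply: mg; rewrite ?sx ?xr ?sa//= (le_trans (ltW ax))//.
by apply: mf; rewrite sa (le_trans (ltW ax)).
Qed.

(** The integral is the pointwise limit of left sums along one deterministic sequence of dyadic
    partitions; only the speed of convergence depends on omega. *)
Lemma mx_measurable_RS_integral d (Omega : measurableType d) (R : realType) (n : nat)
    (D : set Omega) (f : R -> Omega -> 'cV[R]_n) (g : R -> Omega -> R) (s r : R)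
    (I : Omega -> 'cV[R]_n) : s <= r ->
    (forall q, s <= q <= r -> mx_measurable D (f q)) ->
    (forall q, s <= q <= r -> measurable_fun D (g q)) ->
    (forall w, D w -> RS_integral (f ^~ w) (g ^~ w) s r (I w)) ->
  mx_measurable D I.
Proof.
rewrite le_eqVlt => /orP[/eqP <- _ _ hI|sr mf mg hI].
  apply: (mx_measurable_eq (A := fun=> 0)); last exact: mx_measurable_cst.
  by move=> w /hI/RS_integral_pt.
have rs0 : 0 < r - s by rewrite subr_gt0.
pose p k := dyadic_part s (r - s) k.
have pl k : last s (p k) = r by rewrite last_dyadic_part addrC subrK.
apply: (mx_measurable_cvg (A := fun k w => left_sum (f ^~ w) (g ^~ w) s (p k))).
  move=> k; apply: (mx_measurable_left_sum mf mg) => //; last by rewrite pl.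
  have : path (mesh_lt ((r - s) / 2 ^+ k + 1)) s (p k).
    by apply: path_dyadic_part => //; lra.
  by apply: sub_path => x y /andP[].
move=> w Dw; apply/cvgrPdist_lt => e e0.
have [dl dl0 hdl] := RS_integral_left (hI w Dw) e0.
have [k hk] := pow2_inv_lt (divr_gt0 dl0 rs0).
exists k => // l /= kl; rewrite distrC; apply: hdl; last exact: pl.
apply: path_dyadic_part => //; rewrite mulrC -ltr_pdivlMr//.
by apply: le_lt_trans hk; rewrite lef_pV2 ?posrE ?exprn_gt0// ler_eXn2l ?ltr1n.
Qed.

(** With a Hölder integrand the Lebesgue integral is a Riemann-Stieltjes integral against the
    identity, so measurability at each time suffices and no joint measurability in (r, omega) is
    involved. *)
Lemma mx_measurable_vintegral d (Omega : measurableType d) (R : realType) (n : nat)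
    (D : set Omega) (f : R -> Omega -> 'cV[R]_n) (s r kap : R) (F : Omega -> R) :
    s <= r -> 0 < kap ->
    (forall q, s <= q <= r -> mx_measurable D (f q)) ->
    (forall w, D w -> 0 <= F w /\ holder_on (f ^~ w) s r (F w) kap) ->
  mx_measurable D (fun w => vintegral (f ^~ w) s r).
Proof.
move=> sr k0 mf hf.
apply: (mx_measurable_RS_integral (f := f) (g := fun q _ => q) sr mf).
  by move=> q _; exact: measurable_cst.
move=> w /hf[F0 hfw].
have := @RS_integral_of_germ _ _ (f ^~ w) id s r (F w) 1 (F w) kap 1 (vintegral (f ^~ w) s).
rewrite vintegral_pt subr0; apply => //; first exact: ltW.
- by rewrite ltrDr.
- by move=> x y _ _; rewrite powRr1// mul1r.
- move=> x y sx xy yr; by have := vintegral_germ F0 k0 sx xy yr hfw; rewrite [1 + kap]addrC.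
Qed.

(** * Tangent sets *)

Lemma measurable_set_le_shift d (Omega : measurableType d) (R : realType) (t s : R)
    (h : Omega -> R) : measurable_fun setT h -> measurable [set w | s <= t + h w].
Proof.
move=> mh; have mth : measurable_fun setT (fun w => t + h w) by exact: measurable_funD.
rewrite [X in measurable X](_ : _ = setT `&` (fun w => t + h w) @^-1` `[s, +oo[).
  exact: mth.
by apply/seteqP; split => w /=; rewrite in_itv/= andbT //; case.
Qed.

Lemma process_on_le d (Omega : measurableType d) (R : realType) (n : nat) (T t : R)
    (h h' : Omega -> R) (U : R -> Omega -> 'cV[R]_n) :
  measurable_fun setT h -> (forall w, h' w <= h w) ->
  process_on T t h U -> process_on T t h' U.
Proof.
move=> mh h'h pU s sI i; apply: measurable_funS (pU s sI i).
  exact: measurable_set_le_shift.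
by move=> w /= /le_trans; apply; rewrite lerD2l.
Qed.

Lemma ae_null_set d (Omega : measurableType d) (R : realType) (P : probability Omega R)
    (Q : Omega -> Prop) : {ae P, forall w, Q w} ->
  exists N, [/\ measurable N, P N = 0 & forall w, ~ N w -> Q w].
Proof.
move=> [N [mN N0 QN]]; exists N; split => // w nw.
by apply: contrapT => nq; apply: nw; exact: (QN w).
Qed.

(* The horizon is shrunk below 1 and below the Hölder scale of B, and all
   exceptional null sets of the path conditions are merged into N. *)
Lemma tangent_data d (Omega : measurableType d) (R : realType)
    (P : probability Omega R) (B : R -> Omega -> R) (T alpha beta : R)
    (D Dt : R -> \bar R -> R) (n : nat) (K : R -> set 'cV[R]_n)
    (t rx : R) (y u v : 'cV[R]_n) (eta : Omega -> R) :
    measurable_fun setT eta -> (forall w, 0 < eta w) ->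
    {ae P, forall w, forall s r, 0 <= s <= T -> 0 <= r <= T ->
          `|s - r| <= eta w -> `|B s w - B r w| <= `|s - r| `^ (1 - alpha)} ->
    0 <= t <= T ->
    tangent_set_with P B T alpha beta D Dt K t rx y (u, v) ->
  exists (h : Omega -> R) (U V I : R -> Omega -> 'cV[R]_n) (N : set Omega),
  let hor w := Num.min (t + h w) T in
  let holder_UV rho w :=
    holder_on (U ^~ w) t (hor w) (bound_rv T alpha B D rho w) (1 - alpha) /\
    holder_on (V ^~ w) t (hor w) (bound_rv T alpha B Dt rho w) (Num.min beta (1 - alpha)) in
  [/\ measurable_fun setT h /\ forall w, 0 < h w <= 1,
      process_on T t h U /\ process_on T t h V,
      forall w, U t w = 0 /\ V t w = 0,
      [/\ measurable N, P N = 0 &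
        forall w, ~ N w -> [/\ holder_on (B ^~ w) t (hor w) 1 (1 - alpha),
           holder_UV (Num.max rx 1) w &
           forall s, t <= s <= hor w ->
             RS_integral (fun r => v + V r w) (B ^~ w) t s (I s w) /\
             K s (y + vintegral (fun r => u + U r w) t s + I s w)]] &
      forall rho, 0 < rho -> rx <= rho ->
         [/\ measurable_fun setT (bound_rv T alpha B D rho),
              measurable_fun setT (bound_rv T alpha B Dt rho),
              forall w, 0 < bound_rv T alpha B D rho w,
              forall w, 0 < bound_rv T alpha B Dt rho w
            & {ae P, forall w, holder_UV rho w}] ].
Proof.
move=> meta eta0 aeB /andP[t0 tT] [h0 [U [V [[mh0 h00] [pU pV] UV0 bnd aeI]]]].
pose h w := Num.min (h0 w) (Num.min (eta w) 1).
have mh : measurable_fun setT h.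
  by apply: measurable_minr => //; apply: measurable_minr => //; exact: measurable_cst.
have hh0 w : h w <= h0 w by rewrite ge_min lexx.
have heta w : h w <= eta w by rewrite /h !ge_min lexx orbT.
have h1 w : h w <= 1 by rewrite /h !ge_min lexx !orbT.
have hor_le w s : t <= s <= Num.min (t + h w) T -> t <= s <= Num.min (t + h0 w) T.
  move=> /andP[-> /=]; rewrite !le_min => /andP[sh ->]; rewrite andbT.
  by apply: (le_trans sh); rewrite lerD2l.
have aeH rho : 0 < rho -> rx <= rho -> {ae P, forall w,
    holder_on (U ^~ w) t (Num.min (t + h w) T) (bound_rv T alpha B D rho w) (1 - alpha) /\
    holder_on (V ^~ w) t (Num.min (t + h w) T) (bound_rv T alpha B Dt rho w)
      (Num.min beta (1 - alpha))}.
  move=> rho0 rrho; have [_ _ _ _] := bnd rho rho0 rrho.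
  apply: filterS => w hw; split => s r /hor_le sI /hor_le rI.
    by apply: (le_trans (mx_norm_le_enorm _)); have [] := hw s r sI rI.
  by apply: (le_trans (mx_norm_le_enorm _)); have [] := hw s r sI rI.
(* One admissible index is fixed for constructing paths off N; the estimates for the other rho keep
   their own exceptional sets. *)
have rho00 : 0 < Num.max rx 1 by rewrite lt_max ltr01 orbT.
have rho01 : rx <= Num.max rx 1 by rewrite le_max lexx.
have [N [mN PN hN]] := ae_null_set (filterI (filterI aeB aeI) (aeH _ rho00 rho01)).
have hI0 (sw : R * Omega) : exists I : 'cV[R]_n, ~ N sw.2 ->
    t <= sw.1 <= Num.min (t + h sw.2) T ->
    RS_integral (fun r => v + V r sw.2) (B ^~ sw.2) t sw.1 I /\
    K sw.1 (y + vintegral (fun r => u + U r sw.2) t sw.1 + I).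
  case: sw => s w /=.
  have [nw|nw] := pselect (N w); first by exists 0.
  have [sI|sI] := boolP (t <= s <= Num.min (t + h w) T); last by exists 0.
  have [[_ hI] _] := hN w nw.
  by have [I0 I1 I2] := hI s (hor_le _ _ sI); exists I0.
have [I hI] := boolp.choice hI0.
exists h, U, V, (fun s w => I (s, w)), N; split.
- by split => // w; rewrite h1 andbT /h !lt_min h00 eta0 ltr01.
- by split; [exact: process_on_le pU|exact: process_on_le pV].
- by [].
- split => // w nw; have [[hB _] hUV] := hN w nw; split => //.
    move=> s r /andP[s1 s2] /andP[r1 r2]; rewrite mul1r; move: s2 r2; rewrite !le_min.
    move=> /andP[s2 sT] /andP[r2 rT]; apply: hB.
    + by rewrite (le_trans t0).
    + by rewrite (le_trans t0).
    + by apply: le_trans (heta w); rewrite ler_norml; lra.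
  by move=> s sI; exact: (hI (s, w)).
- move=> rho rho0 rrho; have [m1 m2 p1 p2 _] := bnd rho rho0 rrho.
  by split => //; exact: aeH.
Qed.

(** Off a null set it suffices to exhibit a path Z in K with the right germ: [integral_of_germ] then
    supplies the stochastic integral. The factor n compares the two norms. *)
Lemma tangent_intro d (Omega : measurableType d) (R : realType)
    (P : probability Omega R) (B : R -> Omega -> R) (T alpha beta : R)
    (D Dt : R -> \bar R -> R) (n : nat) (K : R -> set 'cV[R]_n)
    (t rx : R) (y u v : 'cV[R]_n) (h : Omega -> R) (U V Z : R -> Omega -> 'cV[R]_n)
    (N : set Omega) :
    measurable_fun setT h -> (forall w, 0 < h w <= 1) -> t <= T ->
    let gam := 1 - alpha in let kap := Num.min beta (1 - alpha) in
    0 < kap -> gam < 1 -> 1 < kap + gam ->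
    measurable N -> P N = 0 ->
    (forall s, t <= s <= T -> mx_measurable ([set w | s <= t + h w] `\` N) (U s)) ->
    (forall s, t <= s <= T -> mx_measurable ([set w | s <= t + h w] `\` N) (V s)) ->
    let hor w := Num.min (t + h w) T in
    (forall w, ~ N w -> [/\ U t w = 0 /\ V t w = 0,
       holder_on (B ^~ w) t (hor w) 1 gam,
       exists F C, [/\ 0 <= F, 0 <= C, holder_on (U ^~ w) t (hor w) F gam,
         holder_on (V ^~ w) t (hor w) F kap &
         germ (B ^~ w) t (hor w) (kap + gam) C (fun r => u + U r w) (fun r => v + V r w)
           (Z ^~ w)],
       Z t w = y & forall s, t <= s <= hor w -> K s (Z s w)]) ->
    (forall rho, 0 < rho -> rx <= rho ->
      [/\ measurable_fun setT (bound_rv T alpha B D rho),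
          measurable_fun setT (bound_rv T alpha B Dt rho),
          forall w, 0 < bound_rv T alpha B D rho w,
          forall w, 0 < bound_rv T alpha B Dt rho w
        & {ae P, forall w, ~ N w -> exists F,
            [/\ holder_on (U ^~ w) t (hor w) F gam, holder_on (V ^~ w) t (hor w) F kap,
              (n * 1)%:R * F <= bound_rv T alpha B D rho w &
              (n * 1)%:R * F <= bound_rv T alpha B Dt rho w] } ]) ->
  tangent_set_with P B T alpha beta D Dt K t rx y (u, v).
Proof.
move=> mh h01 tT gam kap k0 g1 th1 mN PN mU mV hor path bnd.
have kg : kap <= gam by rewrite /kap ge_min lexx orbT.
(* Set to 0 on N, the processes vanish at t for every omega and are measurable on the whole of {s <=
   t + h}. *)
pose cut (W : R -> Omega -> 'cV[R]_n) s w :=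
  if [&& ~~ `[< N w >], t <= s & s <= hor w] then W s w else 0.
have cutE W s w : ~ N w -> t <= s <= hor w -> cut W s w = W s w.
  move=> nw sI; rewrite /cut; case: ifP => // /negbT.
  by rewrite sI andbT negbK => /asboolP.
have cutN W s w : N w -> cut W s w = 0.
  by move=> nw; rewrite /cut; case: asboolP.
have h0 w : 0 < h w by have /andP[] := h01 w.
have thor w : t <= hor w by rewrite /hor le_min tT andbT lerDl ltW.
have hor1 w : hor w <= t + 1.
  by rewrite /hor ge_min lerD2l; have /andP[_ ->] := h01 w.
have pcut W : (forall s, t <= s <= T -> mx_measurable ([set w | s <= t + h w] `\` N) (W s)) ->
    process_on T t h (cut W).
  move=> mW s sI i; set E := [set w | s <= t + h w].
  have mE : measurable E by exact: measurable_set_le_shift.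
  rewrite (_ : E = (E `\` N) `|` (E `&` N)); last first.
    by rewrite setUC setUIDK.
  apply/measurable_funU; [exact: measurableD|exact: measurableI|split].
    apply: (eq_measurable_fun (fun w => W s w i 0)); last exact: mW.
    move=> w; rewrite inE => -[/= sE nw]; rewrite cutE//.
    by have /andP[-> sT] := sI; rewrite /hor le_min sE sT.
  apply: (eq_measurable_fun (fun _ : Omega => 0 : R)); last exact: measurable_cst.
  by move=> w; rewrite inE => -[_ nw]; rewrite cutN// mxE.
have hcut W F k w : ~ N w -> holder_on (W ^~ w) t (hor w) F k ->
    holder_on ((cut W) ^~ w) t (hor w) F k.
  by move=> nw hW s r sI rI; rewrite !cutE//; exact: hW.
exists h, (cut U), (cut V); split.
- by [].
- by split; exact: pcut.
- move=> w; have [nw|nw] := pselect (N w); first by rewrite !cutN.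
  by have [[Ut Vt] _ _ _ _] := path w nw; rewrite !cutE ?lexx ?thor.
- move=> rho rho0 rrho; have [m1 m2 p1 p2 ae] := bnd rho rho0 rrho; split => //.
  have aeN : {ae P, forall w, ~ N w}.
    by exists N; split => // w /= /contrapT.
  apply: filterS2 ae aeN => w hw nw s r sI rI.
  have [F [hU hV F1 F2]] := hw nw.
  split; apply: (le_trans (enorm_le_mx_norm _)).
    apply: (le_trans (ler_wpM2l _ (hcut _ _ _ _ nw hU s r sI rI))) => //.
    by rewrite mulrA ler_wpM2r ?powR_ge0.
  apply: (le_trans (ler_wpM2l _ (hcut _ _ _ _ nw hV s r sI rI))) => //.
  by rewrite mulrA ler_wpM2r ?powR_ge0.
exists N; split => // w /=; apply: contra_notP => nw s sI.
have [[Ut Vt] hB [F [C [F0 C0 hU hV hZ]]] Zt KZ] := path w nw.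
have hc0 : holder_on (fun r => u + cut U r w) t (hor w) F gam.
  have := holder_onD (@holder_on_cst _ _ u t (hor w) gam) (hcut _ _ _ _ nw hU).
  by rewrite add0r.
have hc1 : holder_on (fun r => v + cut V r w) t (hor w) F kap.
  have := holder_onD (@holder_on_cst _ _ v t (hor w) kap) (hcut _ _ _ _ nw hV).
  by rewrite add0r.
have gc : germ (B ^~ w) t (hor w) (kap + gam) C (fun r => u + cut U r w)
    (fun r => v + cut V r w) (Z ^~ w).
  move=> s1 r1 ts sr rh; rewrite !cutE//; first exact: hZ.
  - by rewrite ts (le_trans sr).
  - by rewrite ts (le_trans sr).
have RI := integral_of_germ F0 F0 C0 k0 kg g1 th1 (hor1 w) hB hc0 hc1 gc sI.
exists (Z s w - Z t w - vintegral (fun r => u + cut U r w) t s) => //=.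
set vi := vintegral _ _ _; have -> : y + vi + (Z s w - Z t w - vi) = Z s w.
  by rewrite Zt addrCA -addrA [y + vi]addrC; apply/matrixP => i j; rewrite !mxE; ring.
exact: KZ.
Qed.

Lemma holder_onS (R : realType) (V : normedZmodType R) (f : R -> V) (a b b' F k : R) :
  b' <= b -> holder_on f a b F k -> holder_on f a b' F k.
Proof.
move=> bb hf s r /andP[s1 s2] /andP[r1 r2].
by apply: hf; rewrite ?s1 ?r1 (le_trans _ bb).
Qed.

(* The powers of S produced by image_path and lift_path, times the factor that
   compares the two norms, are at most S ^ 33. *)
Definition new_bound (R : realType) (s0 : R -> R) (D Dt : R -> \bar R -> R) :
    R -> \bar R -> R :=
  fun rho l => (s0 rho + D rho l + Dt rho l) ^+ 33.

Lemma new_bound_rv d (Omega : measurableType d) (R : realType) (T alpha : R)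
    (B : R -> Omega -> R) (s0 : R -> R) (D Dt : R -> \bar R -> R) (rho : R) :
    0 <= s0 rho ->
    measurable_fun setT (bound_rv T alpha B D rho) ->
    measurable_fun setT (bound_rv T alpha B Dt rho) ->
    (forall w, 0 < bound_rv T alpha B D rho w) ->
    (forall w, 0 < bound_rv T alpha B Dt rho w) ->
  measurable_fun setT (bound_rv T alpha B (new_bound s0 D Dt) rho) /\
  forall w, 0 < bound_rv T alpha B (new_bound s0 D Dt) rho w.
Proof.
move=> s00 mD mDt D0 Dt0; split.
  apply: measurable_funX; apply: measurable_funD => //.
  by apply: measurable_funD => //; exact: measurable_cst.
by move=> w; apply: exprn_gt0; rewrite ltr_wpDl ?addr_ge0// ?(ltW (D0 w)) //; exact: Dt0.
Qed.

Lemma path_measurable d (Omega : measurableType d) (R : realType) (n : nat)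
    (T t s k : R) (B : R -> Omega -> R) (h : Omega -> R) (U V I : R -> Omega -> 'cV[R]_n)
    (F : Omega -> R) (N : set Omega) (y u v : 'cV[R]_n) :
    (forall t, 0 <= t -> measurable_fun setT (B t)) -> measurable N ->
    measurable_fun setT h -> 0 <= t -> t <= s <= T -> 0 < k ->
    process_on T t h U -> process_on T t h V ->
    (forall w, ~ N w -> 0 <= F w /\ holder_on (U ^~ w) t (Num.min (t + h w) T) (F w) k) ->
    (forall w, ~ N w -> forall s, t <= s <= Num.min (t + h w) T ->
       RS_integral (fun r => v + V r w) (B ^~ w) t s (I s w)) ->
  mx_measurable ([set w | s <= t + h w] `\` N)
    (fun w => y + vintegral (fun r => u + U r w) t s + I s w).
Proof.
move=> mB mN mh t0 /andP[ts sT] k0 pU pV hU hI.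
set D := _ `\` N.
have mD : measurable D by apply: measurableD => //; exact: measurable_set_le_shift.
have procD W q : process_on T t h W -> t <= q <= s -> mx_measurable D (W q).
  move=> pW /andP[tq qs] i j; rewrite ord1.
  apply: measurable_funS (pW q _ i); last by rewrite tq (le_trans qs).
    exact: measurable_set_le_shift.
  by move=> w [/= + _]; apply: le_trans.
have horD w : D w -> s <= Num.min (t + h w) T by move=> [/= sh _]; rewrite le_min sh.
apply: mx_measurableD; first apply: mx_measurableD.
- exact: mx_measurable_cst.
- apply: (mx_measurable_vintegral (f := fun r w => u + U r w) (F := F) ts k0).
    by move=> q qI; apply: mx_measurableD; [exact: mx_measurable_cst|exact: procD].
  move=> w Dw; have [_ nw] := Dw; have [F0 hw] := hU w nw; split => //.
  have := holder_onD (@holder_on_cst _ _ u t s k) (holder_onS (horD w Dw) hw).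
  by rewrite add0r.
- apply: (mx_measurable_RS_integral (f := fun r w => v + V r w) (g := B) ts).
  + by move=> q qI; apply: mx_measurableD; [exact: mx_measurable_cst|exact: procD].
  + move=> q /andP[tq _]; apply: measurable_funTS; apply: mB; exact: le_trans tq.
  + by move=> w Dw; have [_ nw] := Dw; apply: hI => //; rewrite ts horD.
Qed.

Lemma tangent_image disp (Omega : measurableType disp) (R : realType)
    (P : probability Omega R) (B : R -> Omega -> R) (T alpha beta : R)
    (D Dt : R -> \bar R -> R) (d m : nat) (K1 : R -> set 'cV[R]_d) (K2 : R -> set 'cV[R]_m)
    (t rx Cphi : R) (phi : 'cV[R]_d -> 'cV[R]_m) (jf : 'cV[R]_d -> 'M[R]_(m, d))
    (x u v : 'cV[R]_d) (eta : Omega -> R) (s0 : R -> R) :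
    (forall t, 0 <= t -> measurable_fun setT (B t)) ->
    measurable_fun setT eta -> (forall w, 0 < eta w) ->
    {ae P, forall w, forall s r, 0 <= s <= T -> 0 <= r <= T ->
          `|s - r| <= eta w -> `|B s w - B r w| <= `|s - r| `^ (1 - alpha)} ->
    0 <= t <= T ->
    let gam := 1 - alpha in let kap := Num.min beta (1 - alpha) in
    0 < kap -> gam < 1 -> 1 < kap + gam ->
    0 <= Cphi -> continuous jf ->
    (forall x y, `|jf x - jf y| <= Cphi * `|x - y|) ->
    (forall x y, `|phi y - phi x - jf x *m (y - x)| <= Cphi * `|y - x| ^+ 2) ->
    (forall rho, rx <= rho -> [/\ 4 <= s0 rho, d%:R <= s0 rho /\ m%:R <= s0 rho,
       Cphi <= s0 rho, (1 - 2 `^ (1 - (kap + gam)))^-1 <= s0 rho &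
       [/\ `|u| <= s0 rho, `|v| <= s0 rho & `|jf x| <= s0 rho]]) ->
    (forall s z, K1 s z -> K2 s (phi z)) ->
    tangent_set_with P B T alpha beta D Dt K1 t rx x (u, v) ->
  tangent_set_with P B T alpha beta (new_bound s0 D Dt) (new_bound s0 D Dt) K2 t rx
    (phi x) (jf x *m u, jf x *m v).
Proof.
move=> mB meta eta0 aeB t0T gam kap k0 g1 th1 Cp0 cjf lip tay hs0 K12 tan.
have kg : kap <= gam by rewrite /kap ge_min lexx orbT.
have gam0 : 0 < gam := lt_le_trans k0 kg.
have [h [U [V [I [N /=]]]]] := tangent_data meta eta0 aeB t0T tan.
move=> [[mh h01] [pU pV] UV0 [mN PN hN] bnd].
pose hor w := Num.min (t + h w) T.
pose hUV rho w := holder_on (U ^~ w) t (hor w) (bound_rv T alpha B D rho w) gam /\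
  holder_on (V ^~ w) t (hor w) (bound_rv T alpha B Dt rho w) kap.
have /andP[t0 tT] := t0T.
have thor w : t <= hor w.
  by rewrite /hor le_min tT andbT lerDl ltW//; have /andP[] := h01 w.
have hor1 w : hor w <= t + 1.
  by rewrite /hor ge_min lerD2l; have /andP[_ ->] := h01 w.
pose Z s w := x + vintegral (fun r => u + U r w) t s + I s w.
pose U' s w := jf (Z s w) *m (u + U s w) - jf x *m u.
pose V' s w := jf (Z s w) *m (v + V s w) - jf x *m v.
pose S rho w := s0 rho + bound_rv T alpha B D rho w + bound_rv T alpha B Dt rho w.
(* Stated for every rho, since each index needs its own bound, although the path and its horizon are
   the same for all of them. *)
have main w rho : ~ N w -> 0 < rho -> rx <= rho -> hUV rho w -> m%:R <= S rho w /\
   [/\ 4 <= S rho w, Z t w = x, holder_on (U' ^~ w) t (hor w) (S rho w ^+ 9) gam,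
     holder_on (V' ^~ w) t (hor w) (S rho w ^+ 9) kap &
     exists2 C, 0 <= C & germ (B ^~ w) t (hor w) (kap + gam) C
        (fun r => jf x *m u + U' r w) (fun r => jf x *m v + V' r w)
        (fun s => phi (Z s w))].
  move=> nw rho0 rrho [hU hV]; have [hB _ hI] := hN w nw.
  have [_ _ D0 Dt0 _] := bnd rho rho0 rrho.
  have [s4 [sd sm] sC sth [su sv sj]] := hs0 rho rrho.
  have D0' := D0 w; have Dt0' := Dt0 w.
  have sS : s0 rho <= S rho w by rewrite /S; lra.
  have DS : 0 <= bound_rv T alpha B D rho w <= S rho w by rewrite /S; lra.
  have DtS : 0 <= bound_rv T alpha B Dt rho w <= S rho w by rewrite /S; lra.
  have le a : a <= s0 rho -> a <= S rho w by move=> /le_trans; apply.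
  have ys : young_setting (B ^~ w) t (hor w) gam kap (S rho w).
    by split => //; [rewrite thor hor1|split; exact: le].
  have [Ut Vt] := UV0 w.
  have := @path_of_integral _ _ _ _ _ _ _ _ _ _ 1 u v x (U ^~ w) (V ^~ w) (I ^~ w) ys isT.
  rewrite expr1 => /(_ _ _ (le _ su) (le _ sv) DS DtS Ut Vt hU hV (fun s sI => (hI s sI).1)).
  move=> [gZ hZ Zt bU bV].
  have S0 : 0 <= S rho w by have := le _ s4; lra.
  have hUS : holder_on (U ^~ w) t (hor w) (S rho w) gam.
    by apply: holder_on_le hU => //; have /andP[] := DS.
  have hVS : holder_on (V ^~ w) t (hor w) (S rho w) kap.
    by apply: holder_on_le hV => //; have /andP[] := DtS.
  have CS : 0 <= Cphi <= S rho w by rewrite Cp0 le.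
  have [r1 r2 r3] := image_path ys (le _ sd) CS lip tay (le _ su) (le _ sv) (le _ sj)
    bU bV hUS hVS gZ hZ Zt.
  by split; [exact: le|split => //; exact: le].
have rho00 : 0 < Num.max rx 1 by rewrite lt_max ltr01 orbT.
have rho01 : rx <= Num.max rx 1 by rewrite le_max lexx.
have mdata s : t <= s <= T -> let E := [set w | s <= t + h w] `\` N in
    [/\ measurable E, mx_measurable E (Z s), mx_measurable E (U s) & mx_measurable E (V s)].
  move=> sI E; have mE : measurable E.
    by apply: measurableD => //; exact: measurable_set_le_shift.
  have [_ _ D0 _ _] := bnd _ rho00 rho01.
  split => //.
  - have hF w : ~ N w -> 0 <= bound_rv T alpha B D (Num.max rx 1) w /\
        holder_on (U ^~ w) t (Num.min (t + h w) T) (bound_rv T alpha B D (Num.max rx 1) w) gam.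
      by move=> /hN[_ [hU _] _]; split => //; exact: ltW.
    have hI w : ~ N w -> forall s, t <= s <= Num.min (t + h w) T ->
        RS_integral (fun r => v + V r w) (B ^~ w) t s (I s w).
      by move=> /hN[_ _ hI] q /hI[].
    exact: (path_measurable x u mB mN mh t0 sI gam0 pU pV hF hI).
  - move=> i j; rewrite ord1; apply: measurable_funS (pU s sI i); last exact: subDsetl.
    exact: measurable_set_le_shift.
  - move=> i j; rewrite ord1; apply: measurable_funS (pV s sI i); last exact: subDsetl.
    exact: measurable_set_le_shift.
apply: (tangent_intro (h := h) (U := U') (V := V') (Z := fun s w => phi (Z s w)) (N := N)) => //.
- move=> s sI; have [mE mZ mU _] := mdata s sI.
  apply: mx_measurableB; last exact: mx_measurable_cst.
  apply: mx_measurable_mulmx; first exact: mx_measurable_comp.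
  by apply: mx_measurableD => //; exact: mx_measurable_cst.
- move=> s sI; have [mE mZ _ mV] := mdata s sI.
  apply: mx_measurableB; last exact: mx_measurable_cst.
  apply: mx_measurable_mulmx; first exact: mx_measurable_comp.
  by apply: mx_measurableD => //; exact: mx_measurable_cst.
- move=> w nw; have [hB hUVw hI] := hN w nw; have [Ut Vt] := UV0 w.
  have [_ [S4 Zt hU' hV' [C C0 gC]]] := main w _ nw rho00 rho01 hUVw.
  split => //.
  + by rewrite /U' /V' Zt Ut Vt !addr0 !subrr.
  + exists (S (Num.max rx 1) w ^+ 9), C; split => //.
    by rewrite exprn_ge0//; lra.
  + by rewrite Zt.
  + by move=> s sI; apply: K12; have [] := hI s sI.
- move=> rho rho0 rrho; have [m1 m2 p1 p2 ae] := bnd rho rho0 rrho.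
  have [s4 _ _ _ _] := hs0 rho rrho; have s00 : 0 <= s0 rho by lra.
  have [nm np] := new_bound_rv s00 m1 m2 p1 p2.
  split => //; apply: filterS ae => w hw nw.
  have [mS [S4 Zt hU' hV' _]] := main w _ nw rho0 rrho hw.
  have S0 : 0 <= S rho w by lra.
  have FS : (m * 1)%:R * S rho w ^+ 9 <= S rho w ^+ 33.
    apply: (expS_le (a := 1 + 9)) => //.
    by apply: (expS_mul (a := 1)); rewrite ?expr1 ?muln1 ?exprn_ge0.
  by exists (S rho w ^+ 9).
Qed.

Lemma tangent_lift disp (Omega : measurableType disp) (R : realType)
    (P : probability Omega R) (B : R -> Omega -> R) (T alpha beta : R)
    (D Dt : R -> \bar R -> R) (d m : nat) (K1 : R -> set 'cV[R]_d) (K2 : R -> set 'cV[R]_m)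
    (t rx Cphi : R) (phi : 'cV[R]_d -> 'cV[R]_m) (jf : 'cV[R]_d -> 'M[R]_(m, d))
    (Q : 'M[R]_(d, m)) (x u v : 'cV[R]_d) (eta : Omega -> R) (s0 : R -> R) :
    (forall t, 0 <= t -> measurable_fun setT (B t)) ->
    measurable_fun setT eta -> (forall w, 0 < eta w) ->
    {ae P, forall w, forall s r, 0 <= s <= T -> 0 <= r <= T ->
          `|s - r| <= eta w -> `|B s w - B r w| <= `|s - r| `^ (1 - alpha)} ->
    0 <= t <= T ->
    let gam := 1 - alpha in let kap := Num.min beta (1 - alpha) in
    0 < kap -> gam < 1 -> 1 < kap + gam ->
    0 <= Cphi -> continuous phi -> continuous jf ->
    (forall x y, `|jf x - jf y| <= Cphi * `|x - y|) ->
    (forall x y, `|phi y - phi x - jf x *m (y - x)| <= Cphi * `|y - x| ^+ 2) ->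
    jf x *m Q = 1%:M ->
    (forall rho, rx <= rho -> [/\ 4 <= s0 rho, d%:R <= s0 rho /\ m%:R <= s0 rho,
       Cphi <= s0 rho, (1 - 2 `^ (1 - (kap + gam)))^-1 <= s0 rho &
       [/\ `|u| <= s0 rho, `|v| <= s0 rho, `|jf x| <= s0 rho & `|Q| <= s0 rho]]) ->
    (forall s z, K2 s (phi z) -> K1 s z) ->
    tangent_set_with P B T alpha beta D Dt K2 t rx (phi x) (jf x *m u, jf x *m v) ->
  tangent_set_with P B T alpha beta (new_bound s0 D Dt) (new_bound s0 D Dt) K1 t rx x (u, v).
Proof.
move=> mB meta eta0 aeB t0T gam kap k0 g1 th1 Cp0 cphi cjf lip tay JQ hs0 K21 tan.
have kg : kap <= gam by rewrite /kap ge_min lexx orbT.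
have gam0 : 0 < gam := lt_le_trans k0 kg.
have [h0 [U [V [I [N /=]]]]] := tangent_data meta eta0 aeB t0T tan.
move=> [[mh0 h001] [pU pV] UV0 [mN PN hN] bnd].
have /andP[t0 tT] := t0T.
have [r0 [r1 [cc [r10 [cc1 ccL cc0 low]]]]] := local_right_inverse Cp0 JQ lip tay.
pose S rho w := s0 rho + bound_rv T alpha B D rho w + bound_rv T alpha B Dt rho w.
pose rho1 := Num.max rx 1.
have rho00 : 0 < rho1 by rewrite lt_max ltr01 orbT.
have rho01 : rx <= rho1 by rewrite le_max lexx.
have S4 rho w : 0 < rho -> rx <= rho -> 4 <= S rho w.
  move=> p0 prx; have [_ _ D0 Dt0 _] := bnd rho p0 prx; have [s4 _ _ _ _] := hs0 rho prx.
  by have D0' := D0 w; have Dt0' := Dt0 w; rewrite /S; lra.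
(* Y is S^6-Hölder and z is S^2-Hölder with exponent gam > 1/2, so s - t <= (r1 / S^6)^2 keeps both
   within r1 of their starting points. S is taken at the single index rho1, so the horizon does not
   vary with rho. *)
pose h w := Num.min (h0 w) ((r1 * (S rho1 w ^+ 6)^-1) ^+ 2).
have Sp w k : 0 < S rho1 w ^+ k by rewrite exprn_gt0//; have := S4 _ w rho00 rho01; lra.
have mh : measurable_fun setT h.
  have [mD mDt _ _ _] := bnd rho1 rho00 rho01.
  have mS : measurable_fun setT (S rho1).
    by apply: measurable_funD => //; apply: measurable_funD => //; exact: measurable_cst.
  apply: measurable_minr => //; apply: measurable_funX; apply: measurable_funM.
    exact: measurable_cst.
  by apply: measurable_fun_invr; exact: measurable_funX.
have hh0 w : h w <= h0 w by rewrite ge_min lexx.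
have h01 w : 0 < h w <= 1.
  have /andP[a1 a2] := h001 w.
  rewrite (le_trans (hh0 w) a2) andbT lt_min a1/= exprn_gt0// mulr_gt0// invr_gt0.
  exact: Sp.
pose hor w := Num.min (t + h w) T.
have hor_le w : hor w <= Num.min (t + h0 w) T.
  by rewrite le_min !ge_min lerD2l hh0/= lexx orbT.
have hor_sub w s : t <= s <= hor w -> t <= s <= Num.min (t + h0 w) T.
  by move=> /andP[-> /le_trans]; apply.
have thor w : t <= hor w.
  by rewrite /hor le_min tT andbT lerDl ltW//; have /andP[] := h01 w.
have hor1 w : hor w <= t + 1.
  by rewrite /hor ge_min lerD2l; have /andP[_ ->] := h01 w.
pose Y s w := phi x + vintegral (fun r => jf x *m u + U r w) t s + I s w.
pose z s w := x + (s - t) *: u + (B s w - B t w) *: v.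
pose X s w := z s w + Q *m cc (z s w) (Y s w).
pose U' s w := Q *m (invmx (jf (X s w) *m Q) *m (jf x *m u + U s w - jf (X s w) *m u)).
pose V' s w := Q *m (invmx (jf (X s w) *m Q) *m (jf x *m v + V s w - jf (X s w) *m v)).
pose hUV rho w :=
  holder_on (U ^~ w) t (Num.min (t + h0 w) T) (bound_rv T alpha B D rho w) gam /\
  holder_on (V ^~ w) t (Num.min (t + h0 w) T) (bound_rv T alpha B Dt rho w) kap.
have setting w rho : ~ N w -> 0 < rho -> rx <= rho ->
    young_setting (B ^~ w) t (hor w) gam kap (S rho w).
  move=> nw rho0 rrho; have [hB _ _] := hN w nw.
  have [_ _ D0 Dt0 _] := bnd rho rho0 rrho; have [_ _ _ sth _] := hs0 rho rrho.
  have D0' := D0 w; have Dt0' := Dt0 w.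
  split => //; first by rewrite thor hor1.
    exact: holder_onS hB.
  by split; [exact: S4|apply: (le_trans sth); rewrite /S; lra].
have Ypath w rho : ~ N w -> 0 < rho -> rx <= rho -> hUV rho w ->
   [/\ germ (B ^~ w) t (hor w) (kap + gam) (S rho w ^+ 3) (fun r => jf x *m u + U r w)
         (fun r => jf x *m v + V r w) (Y ^~ w),
       holder_on (Y ^~ w) t (hor w) (S rho w ^+ 6) gam, Y t w = phi x,
       holder_on (U ^~ w) t (hor w) (S rho w) gam &
       holder_on (V ^~ w) t (hor w) (S rho w) kap].
  move=> nw rho0 rrho [/(holder_onS (hor_le w)) hU /(holder_onS (hor_le w)) hV].
  have ys := setting w rho nw rho0 rrho; have [_ _ hI] := hN w nw.
  have [_ _ D0 Dt0 _] := bnd rho rho0 rrho.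
  have [s4 [sd sm] sC sth [su sv sj sQ]] := hs0 rho rrho.
  have D0' := D0 w; have Dt0' := Dt0 w.
  have S44 := S4 rho w rho0 rrho.
  have le a : a <= s0 rho -> a <= S rho w by move=> h1; rewrite /S; lra.
  have DS : 0 <= bound_rv T alpha B D rho w <= S rho w by rewrite /S; lra.
  have DtS : 0 <= bound_rv T alpha B Dt rho w <= S rho w by rewrite /S; lra.
  have [Ut Vt] := UV0 w.
  have jb (a : 'cV[R]_d) : `|a| <= s0 rho -> `|jf x *m a| <= S rho w ^+ 3.
    move=> ha; apply: (le_trans (mx_norm_mulmx _ _)).
    apply: (expS_mul (a := 2) (b := 1)); rewrite ?expr1 ?le// ?mulr_ge0//.
    by apply: (expS_mul (a := 1) (b := 1)); rewrite ?expr1 ?le.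
  have [gY hY Yt _ _] := @path_of_integral _ _ _ _ _ _ _ _ _ _ 3 (jf x *m u) (jf x *m v)
    (phi x) (U ^~ w) (V ^~ w) (I ^~ w) ys isT (jb u su) (jb v sv) DS DtS Ut Vt hU hV
    (fun s sI => (hI s (hor_sub w s sI)).1).
  have S0 : 0 <= S rho w by lra.
  split => //.
  - by apply: holder_on_le hU => //; have /andP[] := DS.
  - by apply: holder_on_le hV => //; have /andP[] := DtS.
have near w : ~ N w -> forall s, t <= s <= hor w ->
    `|z s w - x| <= r1 /\ `|Y s w - phi x| <= r1.
  move=> nw s sI; have [hB hUVw hI] := hN w nw.
  have [_ hY Yt _ _] := Ypath w _ nw rho00 rho01 hUVw.
  have [s4 _ _ _ [su sv _ _]] := hs0 rho1 rho01.
  have S44 := S4 rho1 w rho00 rho01; set S1 := S rho1 w in hY S44.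
  have [_ _ D0 Dt0 _] := bnd rho1 rho00 rho01; have D0' := D0 w; have Dt0' := Dt0 w.
  have sS : s0 rho1 <= S1 by rewrite /S1 /S; lra.
  have /andP[ts sh] := sI; have st0 : 0 <= s - t by rewrite subr_ge0.
  have tI : t <= t <= hor w by rewrite lexx thor.
  have s1 : s - t <= 1 by have := hor1 w; lra.
  have key : S1 ^+ 6 * (s - t) `^ gam <= r1.
    have e1 : s - t <= (r1 / S1 ^+ 6) ^+ 2.
      by move: sh; rewrite /hor le_min => /andP[+ _]; rewrite /h addrC -lerBlDr le_min => /andP[].
    have r1S : 0 <= r1 / S1 ^+ 6 by rewrite divr_ge0 ?(ltW r10) ?(ltW (Sp w 6)).
    rewrite mulrC -ler_pdivlMr; last exact: Sp.
    (* Here gam > 1/2, because kap <= gam and kap + gam > 1. *)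
    apply: (@le_trans _ _ ((s - t) `^ 2^-1)); first by apply: powR_le01; lra.
    have -> : r1 / S1 ^+ 6 = ((r1 / S1 ^+ 6) ^+ 2) `^ 2^-1.
      by rewrite powR12_sqrt ?sqr_ge0// sqrtr_sqr ger0_norm.
    by rewrite ge0_ler_powR ?nnegrE ?sqr_ge0.
  split; last first.
    by have := hY s t sI tI; rewrite Yt (ger0_norm st0) => /le_trans; apply.
  apply: le_trans key.
  have -> : z s w - x = (s - t) *: u + (B s w - B t w) *: v.
    by rewrite /z; apply/matrixP => i j; rewrite !mxE; ring.
  apply: (le_trans (ler_normD _ _)); rewrite !mx_normZ (ger0_norm st0).
  apply: (@le_trans _ _ ((S1 + S1) * (s - t) `^ gam)); last first.
    rewrite ler_wpM2r ?powR_ge0//; apply: (expS_le (a := 2)) => //.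
    by apply: expS_add; rewrite ?expr1.
  rewrite [leRHS]mulrDl; apply: lerD; rewrite mulrC ler_pM//; try exact: le_trans sS.
    by rewrite -[leLHS]powRr1// powR_le01 ?st0//; lra.
  have := hB s t (hor_sub w s sI) (hor_sub w t tI).
  by rewrite mul1r (ger0_norm st0).
have main w rho : ~ N w -> 0 < rho -> rx <= rho -> hUV rho w -> d%:R <= S rho w /\
   [/\ holder_on (U' ^~ w) t (hor w) (S rho w ^+ 32) gam,
     holder_on (V' ^~ w) t (hor w) (S rho w ^+ 32) kap,
     U' t w = 0 /\ V' t w = 0, X t w = x &
     exists2 C, 0 <= C & germ (B ^~ w) t (hor w) (kap + gam) C
        (fun r => u + U' r w) (fun r => v + V' r w) (X ^~ w)].
  move=> nw rho0 rrho hUVw.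
  have [gY hY Yt hU hV] := Ypath w rho nw rho0 rrho hUVw.
  have ys := setting w rho nw rho0 rrho.
  have [_ _ D0 Dt0 _] := bnd rho rho0 rrho.
  have [s4 [sd sm] sC sth [su sv sj sQ]] := hs0 rho rrho.
  have D0' := D0 w; have Dt0' := Dt0 w.
  have le a : a <= s0 rho -> a <= S rho w by move=> h1; rewrite /S; lra.
  have CS : 0 <= Cphi <= S rho w by rewrite Cp0 le.
  have [Ut Vt] := UV0 w.
  have cca z1 y1 : `|z1 - x| <= r1 -> `|y1 - phi x| <= r1 -> `|z1 + Q *m cc z1 y1 - x| <= r0.
    by move=> hz hy; have [] := cc1 z1 y1 hz hy.
  have ccb z1 y1 : `|z1 - x| <= r1 -> `|y1 - phi x| <= r1 -> phi (z1 + Q *m cc z1 y1) = y1.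
    by move=> hz hy; have [] := cc1 z1 y1 hz hy.
  split; first exact: le.
  exact: (lift_path ys (le _ sd) (le _ sm) CS lip tay cca ccb ccL cc0 low (le _ su) (le _ sv)
    (le _ sj) (le _ sQ) Ut Vt hU hV gY hY Yt (fun s sI => (near w nw s sI).1)
    (fun s sI => (near w nw s sI).2)).
have mdata s : t <= s <= T -> let E := [set w | s <= t + h w] `\` N in
    [/\ measurable E, mx_measurable E (X s), mx_measurable E (U s), mx_measurable E (V s)
      & mx_measurable E (fun w => invmx (jf (X s w) *m Q))].
  move=> sI E; have mE : measurable E.
    by apply: measurableD => //; exact: measurable_set_le_shift.
  have [ts sT] := andP sI.
  pose E0 := [set w | s <= t + h0 w] `\` N.
  have mE0 : measurable E0.
    by apply: measurableD => //; exact: measurable_set_le_shift.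
  have EE0 : E `<=` E0.
    by move=> w [/= sw nw]; split => //=; apply: (le_trans sw); rewrite lerD2l.
  have Ehor w : E w -> t <= s <= hor w.
    by move=> [/= sw nw]; rewrite ts /hor le_min sw sT.
  have [_ _ D0 _ _] := bnd _ rho00 rho01.
  have mY : mx_measurable E (Y s).
    have hF w : ~ N w -> 0 <= bound_rv T alpha B D rho1 w /\
        holder_on (U ^~ w) t (Num.min (t + h0 w) T) (bound_rv T alpha B D rho1 w) gam.
      by move=> /hN[_ [hU _] _]; split => //; exact: ltW.
    have hI w : ~ N w -> forall s, t <= s <= Num.min (t + h0 w) T ->
        RS_integral (fun r => jf x *m v + V r w) (B ^~ w) t s (I s w).
      by move=> /hN[_ _ hI] q /hI[].
    apply: (mx_measurableS mE0 EE0).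
    exact: (path_measurable (phi x) (jf x *m u) mB mN mh0 t0 sI gam0 pU pV hF hI).
  have mz : mx_measurable E (z s).
    apply: mx_measurableD; first exact: mx_measurable_cst.
    apply: mx_measurableZ; last exact: mx_measurable_cst.
    by apply: measurable_funB; apply: measurable_funTS; apply: mB => //; exact: le_trans ts.
  (* [cc] is not known to be continuous off the small balls, so measurability is obtained from the
     iterates, which involve only phi and Q. *)
  have mcc : mx_measurable E (fun w => cc (z s w) (Y s w)).
    apply: (mx_measurable_cvg
      (A := fun k w => iter k (newton_step phi Q (z s w) (Y s w)) 0)); last first.
      move=> w Ew; have [_ nw] := Ew; have [hz hy] := near w nw s (Ehor w Ew).
      by have [] := cc1 _ _ hz hy.
    elim=> [|k IH]; first exact: mx_measurable_cst.
    apply: mx_measurableB => //; apply: mx_measurableB => //.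
    apply: (mx_measurable_comp (F := phi)) => //.
    apply: mx_measurableD => //.
    by apply: mx_measurable_mulmx => //; exact: mx_measurable_cst.
  have mX : mx_measurable E (X s).
    apply: mx_measurableD => //.
    by apply: mx_measurable_mulmx => //; exact: mx_measurable_cst.
  split => //.
  - move=> i j; rewrite ord1; apply: measurable_funS (pU s sI i).
      exact: measurable_set_le_shift.
    by move=> w /EE0[].
  - move=> i j; rewrite ord1; apply: measurable_funS (pV s sI i).
      exact: measurable_set_le_shift.
    by move=> w /EE0[].
  - apply: mx_measurable_invmx.
      move=> w Ew; have [_ nw] := Ew; have [hz hy] := near w nw s (Ehor w Ew).
      apply: (unitmx_of_lower_bound (K := 2)) => c; apply: low.
      by have [] := cc1 _ _ hz hy.
    apply: mx_measurable_mulmx; last exact: mx_measurable_cst.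
    exact: mx_measurable_comp.
have mW (W : R -> Omega -> 'cV[R]_m) (a : 'cV[R]_d) s :
    t <= s <= T -> mx_measurable ([set w | s <= t + h w] `\` N) (W s) ->
    mx_measurable ([set w | s <= t + h w] `\` N) (fun w =>
      Q *m (invmx (jf (X s w) *m Q) *m (jf x *m a + W s w - jf (X s w) *m a))).
  move=> sI mWs; have [mE mX _ _ minv] := mdata s sI.
  apply: mx_measurable_mulmx; first exact: mx_measurable_cst.
  apply: mx_measurable_mulmx => //; apply: mx_measurableB.
    by apply: mx_measurableD => //; exact: mx_measurable_cst.
  apply: mx_measurable_mulmx; last exact: mx_measurable_cst.
  exact: mx_measurable_comp.
apply: (tangent_intro (h := h) (U := U') (V := V') (Z := X) (N := N)) => //.
- by move=> s sI; apply: mW => //; have [] := mdata s sI.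
- by move=> s sI; apply: mW => //; have [] := mdata s sI.
- move=> w nw; have [hB hUVw hI] := hN w nw.
  have [_ [hU' hV' UVt Xt [C C0 gC]]] := main w _ nw rho00 rho01 hUVw.
  split => //.
  + exact: holder_onS (hor_le w) hB.
  + exists (S rho1 w ^+ 32), C; split => //; exact: ltW.
  + move=> s sI; apply: K21; have [hz hy] := near w nw s sI.
    have [_ E _] := cc1 _ _ hz hy; rewrite /X E.
    by have [] := hI s (hor_sub w s sI).
- move=> rho rho0 rrho; have [m1 m2 p1 p2 ae] := bnd rho rho0 rrho.
  have [s4 _ _ _ _] := hs0 rho rrho; have s00 : 0 <= s0 rho by lra.
  have [nm np] := new_bound_rv s00 m1 m2 p1 p2.
  split => //; apply: filterS ae => w hw nw.
  have [dS [hU' hV' _ _ _]] := main w _ nw rho0 rrho hw.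
  have S0 : 0 <= S rho w by have := S4 rho w rho0 rrho; lra.
  have FS : (d * 1)%:R * S rho w ^+ 32 <= S rho w ^+ 33.
    by apply: (expS_mul (a := 1)); rewrite ?expr1 ?muln1 ?exprn_ge0.
  by exists (S rho w ^+ 32).
Qed.

(** * Constants uniform in the point, and the equivalence *)

Lemma le_sum9 (R : realDomainType) (S a1 a2 a3 a4 a5 a6 a7 a8 a9 : R) :
  S = a1 + a2 + a3 + a4 + a5 + a6 + a7 + a8 + a9 ->
  0 <= a1 -> 0 <= a2 -> 0 <= a3 -> 0 <= a4 -> 0 <= a5 -> 0 <= a6 -> 0 <= a7 ->
  0 <= a8 -> 0 <= a9 ->
  [/\ [/\ a1 <= S, a2 <= S & a3 <= S], [/\ a4 <= S, a5 <= S & a6 <= S]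
    & [/\ a7 <= S, a8 <= S & a9 <= S]].
Proof. by move=> -> *; do !split; lra. Qed.

Theorem theorem3p2 (R : realType) (disp : measure_display)
    (Omega : measurableType disp) (P : probability Omega R)
    (T H alpha : R) (B : R -> Omega -> R) (d m : nat)
    (b sigma : R -> 'cV[R]_d -> 'cV[R]_d)
    (beta delta M0 : R) (M : R -> R) (mu L0 : R) (L : R -> R)
    (K : R -> set 'cV[R]_d) (phi : 'cV[R]_d -> 'cV[R]_m) (a_phi b_phi : R) :
  measure_is_complete P ->
  0 < T -> (0 < d)%N -> (0 < m)%N -> 2^-1 < H < 1 ->
  fBm P H B ->
  {within `[0, T] `*` setT, continuous (fun p : R * 'cV[R]_d => b p.1 p.2)} ->
  {within `[0, T] `*` setT, continuous (fun p : R * 'cV[R]_d => sigma p.1 p.2)} ->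
  H1 T sigma beta delta M0 M ->
  H2 T b (alpha0 beta delta) mu L0 L ->
  1 - H < alpha < alpha0 beta delta ->
  (forall t, 0 <= t <= T -> closed (K t)) ->
  calH phi a_phi b_phi ->
  let region (eps t : R) (x : 'cV[R]_d) :=
    [/\ 0 < eps, 0 <= t <= T, K t x & a_phi + eps <= enorm x <= b_phi - eps] in
  let K1 (s : R) := phi @^-1` (phi @` K s) in
  let K2 (s : R) := phi @` K s in
  (* the equivalence *)
  (forall eps t x, region eps t x ->
     tangent_set P B T alpha beta K1 t (enorm x) x (b t x, sigma t x) <->
     tangent_set P B T alpha beta K2 t (enorm x) (phi x)
       (jac phi x *m b t x, jac phi x *m sigma t x))
  (* ... where the bounds in the tangent sets do not depend on the point *)
  /\ (forall D Dt, exists D' Dt', forall eps t x, region eps t x ->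
       tangent_set_with P B T alpha beta D Dt K1 t (enorm x) x
         (b t x, sigma t x) ->
       tangent_set_with P B T alpha beta D' Dt' K2 t (enorm x) (phi x)
         (jac phi x *m b t x, jac phi x *m sigma t x))
  /\ (forall D' Dt', exists D Dt, forall eps t x, region eps t x ->
       tangent_set_with P B T alpha beta D' Dt' K2 t (enorm x) (phi x)
         (jac phi x *m b t x, jac phi x *m sigma t x) ->
       tangent_set_with P B T alpha beta D Dt K1 t (enorm x) x
         (b t x, sigma t x)).
Proof.
move=> _ T0 d0 m0 /andP[_ H1lt] hB _ _ [[/andP[beta0 _] _] [M00 _] _ sigL _] [_ [L00 _] _ bL].
move=> /andP[aH]; rewrite /alpha0 !lt_min => /andP[a2 /andP[ab _]] _ hphi.
pose region (eps t : R) (x : 'cV[R]_d) :=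
  [/\ 0 < eps, 0 <= t <= T, K t x & a_phi + eps <= enorm x <= b_phi - eps].
pose K1 (s : R) := phi @^-1` (phi @` K s).
pose K2 (s : R) := phi @` K s.
have gam0 : 0 < 1 - alpha < H by lra.
have [eta [meta eta0 aeB]] := fBm_local_holder hB gam0 (ltW T0).
have mB : forall t, 0 <= t -> measurable_fun setT (B t) by have [] := hB.
have k0 : 0 < Num.min beta (1 - alpha) by rewrite lt_min beta0; lra.
have g1 : 1 - alpha < 1 by lra.
(* For the two values of the minimum this is beta > alpha and 2 (1 - alpha) > 1. *)
have th1 : 1 < Num.min beta (1 - alpha) + (1 - alpha).
  by rewrite -ltrBlDr lt_min; apply/andP; split; lra.
have [C C0 [lip tay]] : exists2 C : R, 0 <= C &
    (forall x y, `|jac phi x - jac phi y| <= C * `|x - y|) /\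
    (forall x y, `|phi y - phi x - jac phi x *m (y - x)| <= C * `|y - x| ^+ 2).
  by apply: C2_jac_lipschitz; case: hphi.
have [psi [Cpsi hpsi]] := calH_right_inverse hphi.
have cphi : continuous phi.
  by move=> x; apply: differentiable_continuous; case: hphi => -[].
have cjac : continuous (jac phi).
  by move=> x; apply: differentiable_continuous; case: hphi => -[].
pose cth := (1 - 2 `^ (1 - (Num.min beta (1 - alpha) + (1 - alpha))))^-1 : R.
(* Each summand bounds one datum at all points with |x| <= rho: linear growth for b, the Hölder and
   Lipschitz condition for sigma, the Lipschitz bound for phi', compactness for its right inverse.
   Hence the new bounds depend on the point only through rho. *)
pose s0 (rho : R) : R := 4 + d%:R + m%:R + C + `|cth| + L0 * (1 + `|rho|) +
  (`|sigma 0 0| + M0 * (T `^ beta + `|rho|)) + (`|jac phi 0| + C * `|rho|) + `|Cpsi|.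
have hs0 t x rho : 0 <= t <= T -> annulus a_phi b_phi x -> enorm x <= rho ->
    [/\ 4 <= s0 rho, d%:R <= s0 rho /\ m%:R <= s0 rho, C <= s0 rho, cth <= s0 rho &
       [/\ `|b t x| <= s0 rho, `|sigma t x| <= s0 rho, `|jac phi x| <= s0 rho
         & `|psi x| <= s0 rho]].
  move=> tT ax xr; have /andP[t0 tT'] := tT.
  have rr : rho <= `|rho| by exact: ler_norm.
  have xr' : enorm x <= `|rho| := le_trans xr rr.
  have b1 : `|b t x| <= L0 * (1 + `|rho|).
    apply: (le_trans (mx_norm_le_enorm _)); apply: (le_trans (bL t x tT)).
    by apply: ler_wpM2l; [exact: ltW|rewrite lerD2l].
  have b2 : `|sigma t x| <= `|sigma 0 0| + M0 * (T `^ beta + `|rho|).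
    rewrite -[sigma t x](subrK (sigma 0 0)) addrC; apply: (le_trans (ler_normD _ _)).
    rewrite lerD2l; apply: (le_trans (mx_norm_le_enorm _)).
    have z0 : 0 <= (0 : R) <= T by rewrite lexx ltW.
    apply: (le_trans (sigL 0 t x 0 z0 tT)); rewrite !subr0.
    apply: ler_wpM2l; first exact: ltW.
    apply: lerD => //; apply: ge0_ler_powR; rewrite ?nnegrE ?(ltW beta0) ?(ltW T0)//.
    by rewrite ger0_norm.
  have b3 : `|jac phi x| <= `|jac phi 0| + C * `|rho|.
    rewrite -[jac phi x](subrK (jac phi 0)) addrC; apply: (le_trans (ler_normD _ _)).
    rewrite lerD2l; apply: (le_trans (lip _ _)); rewrite subr0.
    by apply: ler_wpM2l => //; exact: le_trans (mx_norm_le_enorm _) xr'.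
  have b4 : `|psi x| <= `|Cpsi|.
    by have [_ /le_trans] := hpsi x ax; apply; exact: ler_norm.
  have p1 : 0 <= L0 * (1 + `|rho|) := le_trans (normr_ge0 _) b1.
  have p2 := le_trans (normr_ge0 _) b2; have p3 := le_trans (normr_ge0 _) b3.
  have [[s1 s2 s3] [s4 s5 s6] [s7 s8 s9]] := le_sum9 (erefl (s0 rho)) (ler0n R 4)
    (ler0n R d) (ler0n R m) C0 (normr_ge0 cth) p1 p2 p3 (normr_ge0 Cpsi).
  split => //; first exact: le_trans (ler_norm _) s5.
  by split; [exact: le_trans b1 s6|exact: le_trans b2 s7|exact: le_trans b3 s8
            |exact: le_trans b4 s9].
have ann eps t x : region eps t x -> 0 <= t <= T /\ annulus a_phi b_phi x.
  by move=> [e0 tT _ /andP[x1 x2]]; split => //; apply/andP; split; lra.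
(* [K1 s z] and [K2 s (phi z)] are the same proposition by unfolding, so the constraint transfers in
   both directions. *)
have image D Dt eps t x : region eps t x ->
    tangent_set_with P B T alpha beta D Dt K1 t (enorm x) x (b t x, sigma t x) ->
    tangent_set_with P B T alpha beta (new_bound s0 D Dt) (new_bound s0 D Dt) K2 t
      (enorm x) (phi x) (jac phi x *m b t x, jac phi x *m sigma t x).
  move=> /ann[tT ax].
  apply: (tangent_image mB meta eta0 aeB tT k0 g1 th1 C0 cjac lip tay) => // rho xr.
  by have [? ? ? ? [? ? ? _]] := hs0 t x rho tT ax xr.
have lift D Dt eps t x : region eps t x ->
    tangent_set_with P B T alpha beta D Dt K2 t (enorm x) (phi x)
      (jac phi x *m b t x, jac phi x *m sigma t x) ->
    tangent_set_with P B T alpha beta (new_bound s0 D Dt) (new_bound s0 D Dt) K1 t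
      (enorm x) x (b t x, sigma t x).
  move=> /ann[tT ax]; have [JQ _] := hpsi x ax.
  apply: (tangent_lift mB meta eta0 aeB tT k0 g1 th1 C0 cphi cjac lip tay JQ) => // rho xr.
  exact: hs0.
split; [|split].
- move=> eps t x reg; split=> -[D [Dt xD]]; exists (new_bound s0 D Dt), (new_bound s0 D Dt).
    exact: (image D Dt eps t x reg xD).
  exact: (lift D Dt eps t x reg xD).
- move=> D Dt; exists (new_bound s0 D Dt), (new_bound s0 D Dt) => eps t x reg.
  exact: (image D Dt eps t x reg).
- move=> D Dt; exists (new_bound s0 D Dt), (new_bound s0 D Dt) => eps t x reg.
  exact: (lift D Dt eps t x reg).
Qed.
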